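(* Let $\widehat H\in(0,1)$ and let $\xi_n\sim N(0,T_n(f_{\widehat H}))$, $n\ge1$, be random vectors on a common probability space. Let $I=(\widehat H-\tfrac12,1)\cap(0,1)$. Put $\rho_n(u)=n^{-1}\langle\xi_n,T_n(f_u)^{-1}\xi_n\rangle$ and $\rho_\infty(u)=F(u,\widehat H):=\frac1{2\pi}\int_{-\pi}^{\pi}\frac{f_{\widehat H}(t)}{f_u(t)}\,dt$ for $u\in I$. Then \[ \mathbb P\big(\rho_n\to\rho_\infty\ \text{uniformly on every compact subset of } I\big)=1 . \]
   Context: For $H\in(0,1)$ let $f_H(\lambda)=C_H|e^{i\lambda}-1|^2\sum_{k\in\mathbb Z}|\lambda-2\pi k|^{-(2H+1)}$, $\lambda\in[-\pi,\pi)$, with $C_H>0$ the normalizing constant making $f_H$ the spectral density of fractional Gaussian noise (unit-spaced increments of fractional Brownian motion $Z$ with $\mathrm{Var}\,Z_t=|t|^{2H}$). For integrable $g$ on $[-\pi,\pi)$, $\hat g(m)=\frac1{2\pi}\int_{-\pi}^{\pi}e^{-imt}g(t)\,dt$ and $T_n(g)=(\hat g(j-k))_{j,k=1}^n$. *)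

(* Defs.v *)
From HB Require Import structures.
From mathcomp Require Import all_boot all_order all_algebra.
From mathcomp Require Import all_classical all_reals all_analysis.
Set Implicit Arguments. Unset Strict Implicit. Unset Printing Implicit Defensive.
Import Order.TTheory GRing.Theory Num.Theory.
Import numFieldNormedType.Exports.
Local Open Scope classical_set_scope.
Local Open Scope ring_scope.

Section Defs.
Variable R : realType.

Definition leb := (@lebesgue_measure R).

(* Fourier coefficient  \hat g(m) = (1/2pi) \int_{[-pi,pi)} e^{-imt} g(t) dt,
   for the real, even functions g to which it is applied below: then the
   sine part vanishes and \hat g(m) = (1/2pi) \int cos(mt) g(t) dt. *)
Definition fourier_coef (g : R -> R) (m : int) : R :=
  (2 * pi)^-1 * \int[leb]_(t in `[- pi, pi[) (cos (m%:~R * t) * g t).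

Definition toeplitz (n : nat) (g : R -> R) : 'M[R]_n :=
  \matrix_(j < n, k < n) fourier_coef g (j%:Z - k%:Z).

(* sum_{k in Z} |lam - 2 pi k|^{-(2H+1)}, split as k >= 0 and k <= -1 *)
Definition fgn_series (H lam : R) : R :=
  limn (series (fun k : nat =>
     `|lam - 2 * pi * k%:R| `^ (- (2 * H + 1))
   + `|lam + 2 * pi * k.+1%:R| `^ (- (2 * H + 1)))).

(* unnormalized density: |e^{i lam} - 1|^2 * series, with |e^{il}-1|^2 = 2 - 2 cos l *)
Definition fgn_unnormalized (H lam : R) : R :=
  (2 - 2 * cos lam) * fgn_series H lam.

(* C_H : normalizing constant, fixed by \hat f_H(0) = Var(Z_1) = 1 *)
Definition C_fgn (H : R) : R := (fourier_coef (fgn_unnormalized H) 0)^-1.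

Definition f_fgn (H : R) (lam : R) : R := C_fgn H * fgn_unnormalized H lam.

Definition F_lim (u Hh : R) : R :=
  (2 * pi)^-1 * \int[leb]_(t in `[- pi, pi[) (f_fgn Hh t / f_fgn u t).

(* a centered Gaussian random vector in R^n with covariance matrix S,
   characterized by its characteristic function
   E[exp(i<a,xi>)] = exp(-a^T S a / 2), written in real and imaginary parts *)
Definition centered_gaussian_vector {d} {T : measurableType d}
  (P : probability T R) (n : nat) (xi : T -> 'cV[R]_n) (S : 'M[R]_n) : Prop :=
  (forall i : 'I_n, measurable_fun setT (fun w => xi w i ord0)) /\
  forall a : 'cV[R]_n,
    ('E_P[fun w => cos ((a^T *m xi w) ord0 ord0)]
       = (expR (- ((a^T *m S *m a) ord0 ord0) / 2))%:E)%E /\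
    ('E_P[fun w => sin ((a^T *m xi w) ord0 ord0)] = 0)%E.

Definition rho_n (n : nat) (xi : 'cV[R]_n) (u : R) : R :=
  n%:R^-1 * ((xi^T *m invmx (toeplitz n (f_fgn u)) *m xi) ord0 ord0).

End Defs.

(* Main.v *)
(** For a centered Gaussian vector xi with covariance S, tilting its law by the rank-one pieces of
    a positive form B bounds the exponential moments of <xi, B xi>, so that <xi, B xi> deviates
    from tr (B S) by more than eps n with summable probability as soon as |B| |S| = O(n^r), r < 1.
    The inverse T_n(f)^-1 lies below T_n(1/f) and above every form 2 <x, y> - <y, T_n(f) y>; taking
    y = T_n(phi) D x, with phi a cosine polynomial close to 1/f and D a cutoff of the first and last
    coordinates, yields an explicit lower form.  The traces of these forms against T_n(g) obey a
    Szego limit because one of the two symbols can be replaced by a cosine polynomial, the singularity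
    at 0 being controlled by the positivity of a trigonometric kernel.  This gives the limit for each
    fixed u.  Finally f_u <= (1 + L (v - u)) f_v for u < v (before normalization), hence
    T_n(f_v)^-1 <= (1 + L (v - u)) T_n(f_u)^-1: convergence at all rational parameters then forces
    locally uniform convergence. *)

(* The range of [u] is dictated by the singularity at 0. There [f_u] behaves like [|t|^(1 - 2 u)],
   so the norms of [T_n(1/f_u)] and [T_n(f_Hh)] multiply to at most a constant times [n] to the
   power [max(1 - 2 u, 0) + max(2 Hh - 1, 0)]; given [0 < u] and [Hh < 1], this power is below 1
   exactly when [u > Hh - 1/2]. The vectors are known only through their characteristic functions,
   and nothing links different [n]. Exponential moments are therefore built one square at a time,
   each square being linearized by an auxiliary normal variable, and only the first Borel-Cantelli
   lemma is available. The two bounds on the inverse are not symmetric. The upper form is the same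
   for every tolerance but has unbounded norm; the lower one has bounded norm but depends on the
   tolerance, and its symbols must be continuous although [f] may have a pole, whence a factor
   [1 - cos t] inside [phi]. The comparison in the parameter goes one way only, since [f_v / f_u] is
   unbounded at 0 for [u < v]; it is enough because the values at [u] are squeezed between those at
   two neighbours [p < u < q]. *)
Require Import Defs.
From HB Require Import structures.
From mathcomp Require Import all_boot all_order all_algebra.
From mathcomp Require Import all_classical all_reals all_analysis.
From mathcomp Require Import measurable_realfun ring lra.
Import Order.TTheory GRing.Theory Num.Theory.
Import numFieldNormedType.Exports.
Local Open Scope classical_set_scope.
Local Open Scope ring_scope.

(** * Gaussian moment generating functions *)

Section GaussianIntegrals.
Context {R : realType}.
Notation mu := (@lebesgue_measure R).
Implicit Types (s c x y z : R).

Lemma measurable_cos_mul c : measurable_fun setT (fun z : R => cos (c * z)).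
Proof.
apply: measurableT_comp; last exact: mulrl_measurable.
by apply: continuous_measurable_fun; exact: continuous_cos.
Qed.

Lemma measurable_sin_mul c : measurable_fun setT (fun z : R => sin (c * z)).
Proof.
apply: measurableT_comp; last exact: mulrl_measurable.
by apply: continuous_measurable_fun; exact: continuous_sin.
Qed.

(** Completing the square: the factor [expR (c z)] turns [N(0, s^2)] into [N(c s^2, s^2)] up to a
    constant. *)
Lemma normal_mgf s c : s != 0 ->
  (\int[mu]_z (normal_pdf 0 s z * expR (c * z))%:E = (expR (c ^+ 2 * s ^+ 2 / 2))%:E)%E.
Proof.
move=> s0.
transitivity (\int[mu]_z ((expR (c ^+ 2 * s ^+ 2 / 2))%:E * (normal_pdf (c * s ^+ 2) s z)%:E))%E.
  apply: eq_integral => z _; rewrite -EFinM; congr EFin.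
  rewrite !normal_pdfE //= /normal_fun [RHS]mulrCA -[LHS]mulrA; congr (_ * _).
  rewrite -!expRD; congr expR; field.
  by rewrite s0.
rewrite ge0_integralZl //= ?integral_normal_pdf ?mule1 //.
- apply/measurable_EFinP; exact: measurable_normal_pdf.
- by move=> z _; rewrite lee_fin normal_pdf_ge0.
Qed.

Lemma integrable_normal_pdf_exp s c : s != 0 ->
  mu.-integrable setT (fun z => (normal_pdf 0 s z * expR (c * z))%:E).
Proof.
move=> s0; apply/integrableP; split.
  apply/measurable_EFinP/measurable_funM; first exact: measurable_normal_pdf.
  by apply: measurableT_comp => //; exact: mulrl_measurable.
under eq_integral.
  move=> z _; rewrite gee0_abs; last by rewrite lee_fin mulr_ge0 ?expR_ge0// normal_pdf_ge0.
  over.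
by rewrite /= normal_mgf// ltry.
Qed.

Lemma integrable_normal_pdfM s (h : R -> R) : s != 0 -> measurable_fun setT h ->
  (exists c, forall z, `|h z| <= c) ->
  mu.-integrable setT (fun z => (normal_pdf 0 s z * h z)%:E).
Proof.
move=> s0 mh [c hc].
apply: (@le_integrable _ _ _ mu setT measurableT _ (fun z => (c * normal_pdf 0 s z)%:E)).
- by apply/measurable_EFinP/measurable_funM => //; exact: measurable_normal_pdf.
- move=> z _ /=; rewrite lee_fin normrM (ger0_norm (normal_pdf_ge0 _ _ _)) mulrC.
  rewrite (@ger0_norm _ (c * _)); first by rewrite ler_wpM2r// normal_pdf_ge0.
  by rewrite mulr_ge0 ?normal_pdf_ge0// (le_trans (normr_ge0 _) (hc 0)).
- have : mu.-integrable setT (fun z => (c%:E * (normal_pdf 0 s z)%:E)%E).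
    by apply: integrableZl => //; exact: integrable_normal_pdf.
  by [].
Qed.

Lemma is_derive_normal_pdf s z : s != 0 ->
  is_derive z 1 (normal_pdf 0 s) (- (z / s ^+ 2) * normal_pdf 0 s z).
Proof.
move=> s0; rewrite normal_pdfE //.
have -> : (fun x => normal_peak s * normal_fun 0 s x) =
  (fun x => normal_peak s * expR (- (x - 0) ^+ 2 / (s ^+ 2 *+ 2))) by [].
apply: is_derive_eq.
rewrite /normal_fun /= /GRing.scale /=.
field.
by rewrite s0.
Qed.

Lemma cvg_Rintegral_symitv (h : R -> R) : mu.-integrable setT (EFin \o h) ->
  (fun n : nat => \int[mu]_(x in `[- n%:R, n%:R]) h x) @ \oo --> \int[mu]_x h x.
Proof.
move=> ih.
have mh : measurable_fun setT h by apply/measurable_EFinP; exact: measurable_int ih.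
pose fn n x := ((h \_ `[- n%:R, n%:R]) x)%:E.
have [] := @dominated_convergence _ _ _ mu setT measurableT (fun n x => fn n x)
   (EFin \o h) (fun x => `|h x|%:E).
- move=> n; apply/measurable_EFinP; rewrite /=.
  have := (measurable_restrictT h (measurable_itv `[(- n%:R : R), n%:R])).1; apply.
  exact: measurable_funTS.
- by apply/measurable_EFinP.
- apply: aeW => x _ /=; apply: cvg_EFin => /=.
    by near=> n.
  apply: (@cvg_near_cst _ _ _ _ _ _).
  near=> n; rewrite /fn /= patchE mem_set//= in_itv/= -ler_norml.
  near: n; exact: nbhs_infty_ger.
- exact: integrable_abse ih.
- apply: aeW => x n _ /=; rewrite /fn lee_fin patchE; case: ifPn => // _.
  by rewrite normr0.
move=> _ _ cv; rewrite /Rintegral.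
apply: fine_cvg; rewrite fineK; last exact: integrable_fin_num.
have -> : (fun n : nat => (\int[mu]_(x in `[(- n%:R)%R, n%:R]) (h x)%:E)%E) =
  [sequence (\int[mu]_x fn n x)%E]_n.
  apply/funext => n /=; rewrite integral_mkcond; apply: eq_integral => x _ /=.
  by rewrite /fn restrict_EFin.
exact: cv.
Unshelve. all: by end_near. Qed.

Lemma cvg_normal_pdf s : s != 0 -> normal_pdf 0 s n%:R @[n --> \oo] --> (0 : R).
Proof.
(* With [y = n^2 / (2 s^2)], one has [expR y >= 1 + y] and [n + 1 <= (1 + 2 s^2) (1 + y)], hence a
   harmonic majorant. *)
move=> s0; set M := normal_peak s * (1 + 2 * s ^+ 2).
apply: (@squeeze_cvgr _ _ _ _ (cst 0) (fun n => M * n.+1%:R^-1)).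
- near=> n; rewrite normal_pdf_ge0 /= ler_pdivlMr ?ltr0n//.
  rewrite normal_pdfE // /M -mulrA ler_wpM2l ?normal_peak_ge0 // /normal_fun subr0.
  have s2 : 0 < s ^+ 2 by rewrite exprn_even_gt0.
  rewrite mulNr expRN mulrC ler_pdivrMr ?expR_gt0 //.
  set y := (n%:R ^+ 2 / _).
  have ye : y * (2 * s ^+ 2) = n%:R ^+ 2 by rewrite /y -mulr_natl; field; rewrite s0.
  have y0 : 0 <= y by rewrite divr_ge0 ?sqr_ge0 // mulrn_wge0 // ltW.
  have := expR_ge1Dx y => ey.
  have n2 : (n%:R : R) <= n%:R ^+ 2 by rewrite -natrX ler_nat; case: (n) => // m; rewrite leq_pmulr.
  apply: (@le_trans _ _ ((1 + 2 * s ^+ 2) * (1 + y))); last first.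
    by rewrite ler_wpM2l // addr_ge0 // mulr_ge0 // ltW.
  rewrite -natr1; nra.
- exact: cvg_cst.
- by rewrite -[X in _ --> X](mulr0 M); apply: cvgMr; exact: cvg_harmonic.
Unshelve. all: by end_near. Qed.

Lemma integrable_normal_pdf_id s (h : R -> R) : s != 0 -> measurable_fun setT h ->
  (forall z, `|h z| <= 1) ->
  mu.-integrable setT (fun z => (normal_pdf 0 s z * (z * h z))%:E).
Proof.
move=> s0 mh h1.
(* [|z| <= expR z + expR (- z)] provides an integrable majorant made of two tilted densities. *)
have iG : mu.-integrable setT (fun z => ((normal_pdf 0 s z * expR (1 * z))%:E + (normal_pdf 0 s z * expR ((-1) * z))%:E)%E).
  by apply: integrableD => //; exact: integrable_normal_pdf_exp.
apply: (@le_integrable _ _ _ mu setT measurableT _ _ _ _ iG).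
- apply/measurable_EFinP/measurable_funM; first exact: measurable_normal_pdf.
  by apply: measurable_funM.
- move=> z _ /=; rewrite lee_fin normrM (ger0_norm (normal_pdf_ge0 _ _ _)).
  rewrite -mulrDr (@ger0_norm _ (_ * (_ + _))); last first.
    by rewrite mulr_ge0 ?normal_pdf_ge0 // addr_ge0 ?expR_ge0.
  rewrite ler_wpM2l ?normal_pdf_ge0 // normrM (le_trans (ler_wpM2l _ (h1 z))) // mulr1.
  have := expR_ge1Dx (1 * z); have := expR_ge1Dx (-1 * z).
  have := expR_ge0 (1 * z); have := expR_ge0 (-1 * z).
  case: (lerP 0 z) => z0; [rewrite ger0_norm //|rewrite ltr0_norm //]; lra.
Qed.

(** The density has derivative [- z / s^2] times itself, so the difference of the two integrands is
    the derivative of [H = - s^2 normal_pdf sin (c z)], which vanishes at infinity. *)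
Lemma normal_cf_by_parts s c : s != 0 ->
  \int[mu]_z (normal_pdf 0 s z * (z * sin (c * z))) =
  s ^+ 2 * c * \int[mu]_z (normal_pdf 0 s z * cos (c * z)).
Proof.
move=> s0.
have msin : measurable_fun setT (fun z : R => sin (c * z)).
  exact: measurable_sin_mul.
have mcos : measurable_fun setT (fun z : R => cos (c * z)).
  exact: measurable_cos_mul.
have i1 : mu.-integrable setT (EFin \o (fun z => normal_pdf 0 s z * (z * sin (c * z)))).
  by apply: integrable_normal_pdf_id => // z; exact: sin_max.
have i2 : mu.-integrable setT (EFin \o (fun z => normal_pdf 0 s z * cos (c * z))).
  by apply: integrable_normal_pdfM => //; exists 1 => z; exact: cos_max.
have i3 : mu.-integrable setT (EFin \o (fun z => s ^+ 2 * c * (normal_pdf 0 s z * cos (c * z)))).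
  have : mu.-integrable setT (fun z => ((s ^+ 2 * c)%:E * (normal_pdf 0 s z * cos (c * z))%:E)%E).
    exact: integrableZl.
  by [].
apply/eqP; rewrite -subr_eq0 -RintegralZl // -RintegralB //; apply/eqP.
set h := (fun z => _ - _).
have ih : mu.-integrable setT (EFin \o h).
  have : mu.-integrable setT (fun z => ((normal_pdf 0 s z * (z * sin (c * z)))%:E
     - (s ^+ 2 * c * (normal_pdf 0 s z * cos (c * z)))%:E)%E) by exact: integrableB.
  by [].
pose H (z : R) : R := - (s ^+ 2) * (normal_pdf 0 s z * sin (c * z)).
have dH z : is_derive z 1 H (h z).
  have ? := is_derive_normal_pdf s z s0.
  rewrite /H; apply: is_derive_eq.
  by rewrite /h /GRing.scale /=; field; rewrite s0.
have cH : continuous H.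
  by move=> z; apply/differentiable_continuous/derivable1_diffP; exact: ex_derive.
have ch : continuous h.
  move=> z; apply: cvgB.
    apply: cvgM; first exact: continuous_normal_pdf.
    by apply: cvgM => //; apply: continuous_comp; [exact: mulrl_continuous|exact: continuous_sin].
  apply: cvgMr; apply: cvgM; first exact: continuous_normal_pdf.
  by apply: continuous_comp; [exact: mulrl_continuous|exact: continuous_cos].
have cv := cvg_Rintegral_symitv h ih.
(* The index [n.+1] keeps the interval nondegenerate, as the fundamental theorem of calculus
   demands. *)
have e n : \int[mu]_(x in `[- n.+1%:R, n.+1%:R]) h x = H n.+1%:R - H (- n.+1%:R).
  rewrite /Rintegral (@continuous_FTC2 _ h H) //.
  - by rewrite -subr_gt0 opprK -natrD ltr0n.
  - exact: continuous_subspaceT.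
  - split.
    + by move=> z _; exact: ex_derive.
    + by apply: cvg_at_right_filter; exact: cH.
    + by apply: cvg_at_left_filter; exact: cH.
  - by move=> z _; rewrite derive1E; exact: derive_val.
have H0 : H n%:R @[n --> \oo] --> (0 : R).
  apply: norm_cvg0.
  apply: (@squeeze_cvgr _ _ _ _ (cst 0) (fun n => s ^+ 2 * normal_pdf 0 s n%:R)).
  + near=> n; rewrite normr_ge0 /= /H normrM normrN (ger0_norm (sqr_ge0 _)) ler_wpM2l ?sqr_ge0 //.
    rewrite normrM (ger0_norm (normal_pdf_ge0 _ _ _)) ler_piMr ?normal_pdf_ge0 //.
    exact: sin_max.
  + exact: cvg_cst.
  + by rewrite -[X in _ --> X](mulr0 (s ^+ 2)); apply: cvgMr; exact: cvg_normal_pdf.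
have HN z : H (- z) = - H z.
  rewrite /H !normal_pdfE // /normal_fun !subr0 sqrrN mulrN sinN; ring.
have H1 : H n.+1%:R @[n --> \oo] --> (0 : R) by rewrite (cvg_shiftS (fun n => H n%:R)).
have cv0 : \int[mu]_(x in `[- n.+1%:R, n.+1%:R]) h x @[n --> \oo] --> (0 : R).
  under eq_fun do rewrite e HN opprK.
  have H2 := cvgD H1 H1; rewrite addr0 in H2; exact: H2.
rewrite (cvg_shiftS (fun n : nat => \int[mu]_(x in `[- n%:R, n%:R]) h x)) in cv0.
exact: (cvg_unique _ cv cv0).
Unshelve. all: by end_near. Qed.

Lemma is_derive_normal_cf s c : s != 0 ->
  is_derive c 1 (fun c => \int[mu]_z (normal_pdf 0 s z * cos (c * z)))
    (- \int[mu]_z (normal_pdf 0 s z * (z * sin (c * z)))).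
Proof.
move=> s0.
pose f x z := normal_pdf 0 s z * cos (x * z).
have fi x : `]c - 1, c + 1[%classic x -> mu.-integrable setT (EFin \o f x).
  move=> _; apply: integrable_normal_pdfM => //; last by exists 1 => z; exact: cos_max.
  exact: measurable_cos_mul.
have df x z : is_derive x (1 : R) (f ^~ z) (- (normal_pdf 0 s z * (z * sin (x * z)))).
  rewrite /f; apply: is_derive_eq; rewrite /GRing.scale /=; ring.
have dd x z : `]c - 1, c + 1[%classic x -> setT z -> derivable (f ^~ z) x 1.
  by move=> _ _; exact: ex_derive.
have d1 x z : partial1of2 f x z = - (normal_pdf 0 s z * (z * sin (x * z))).
  by rewrite partial1of2E; exact: derive_val.
have iG : mu.-integrable setT (EFin \o (fun z => normal_pdf 0 s z * `|z|)).
  apply: (@le_integrable _ _ _ mu setT measurableT _ (fun z => (normal_pdf 0 s z * (z * 1))%:E)).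
  - apply/measurable_EFinP/measurable_funM; first exact: measurable_normal_pdf.
    by apply: continuous_measurable_fun; exact: norm_continuous.
  - by move=> z _ /=; rewrite lee_fin !normrM !normr1 normr_id mulr1.
  - by apply: (@integrable_normal_pdf_id _ (cst 1)) => // z; rewrite normr1.
have cI : `]c - 1, c + 1[%classic c by rewrite /= in_itv /=; apply/andP; split; lra.
have G0 z : 0 <= normal_pdf 0 s z * `|z| by rewrite mulr_ge0 // normal_pdf_ge0.
have Gub x z : `]c - 1, c + 1[%classic x -> setT z -> `|partial1of2 f x z| <= normal_pdf 0 s z * `|z|.
  move=> _ _; rewrite d1 normrN normrM (ger0_norm (normal_pdf_ge0 _ _ _)) ler_wpM2l ?normal_pdf_ge0 //.
  by rewrite normrM ler_piMr // sin_max.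
have D := @derivable_under_integral _ _ _ mu f setT measurableT c _ _ cI fi dd _ G0 iG Gub.
have E := @differentiation_under_integral _ _ _ mu f setT measurableT c _ _ cI fi dd _ G0 iG Gub.
have -> : - (\int[mu]_z (normal_pdf 0 s z * (z * sin (c * z)))) =
   (fun x => \int[mu]_y f x y)^`()%classic c.
  rewrite E -mulN1r -RintegralZl //.
    by apply: eq_Rintegral => z _; rewrite d1 mulN1r.
  apply: integrable_normal_pdf_id => //; last by move=> z; exact: sin_max.
  exact: measurable_sin_mul.
by rewrite derive1E; exact: DeriveDef.
Qed.

(* As a function of [c], the left-hand side solves [y' = - s^2 c y]. *)
Lemma normal_cf s c : s != 0 ->
  \int[mu]_z (normal_pdf 0 s z * cos (c * z)) = expR (- (c ^+ 2 * s ^+ 2 / 2)).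
Proof.
move=> s0.
set F := fun c => \int[mu]_z (normal_pdf 0 s z * cos (c * z)).
pose G (x : R) : R := F x * expR (x ^+ 2 * s ^+ 2 / 2).
have dG x : is_derive x 1 G 0.
  have ? := is_derive_normal_cf s x s0.
  rewrite /G; apply: is_derive_eq.
  rewrite normal_cf_by_parts // -/(F x) /GRing.scale /=; field => //.
have GE : G c = G 0 by apply: is_derive_0_is_cst.
have F0 : F 0 = 1.
  rewrite /F /Rintegral.
  under eq_integral do rewrite mul0r cos0 mulr1.
  by rewrite integral_normal_pdf.
move: GE; rewrite /G F0 expr0n /= !mul0r expR0 mulr1 => GE.
change (F c = expR (- (c ^+ 2 * s ^+ 2 / 2))).
apply: (mulIf (lt0r_neq0 (expR_gt0 (c ^+ 2 * s ^+ 2 / 2)))).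
by rewrite GE -expRD addNr expR0.
Qed.

(** A quadratic tilt of the standard normal only changes its variance, to [1 / (1 - v)]. Negative
    [v] is allowed and serves the decreasing weights and the smoothing of a law. *)
Lemma normal_pdf_tilt v z : v < 1 ->
  normal_pdf 0 1 z * expR (z ^+ 2 * v / 2) =
  (Num.sqrt (1 - v))^-1 * normal_pdf 0 (Num.sqrt (1 - v))^-1 z.
Proof.
move=> v1; set t := Num.sqrt (1 - v).
have v10 : 0 < 1 - v by rewrite subr_gt0.
have t2 : t ^+ 2 = 1 - v by rewrite sqr_sqrtr // ltW.
have tn0 : t != 0 by rewrite gt_eqF // sqrtr_gt0.
have ti0 : t^-1 != 0 by rewrite invr_eq0.
rewrite !normal_pdfE ?oner_neq0 // /normal_peak /normal_fun !subr0 expr1n exprVn t2.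
have -> : (1 - v)^-1 * pi *+ 2 = (1 * pi *+ 2) * (1 - v)^-1 :> R by rewrite mul1r mulrC mulrnAl.
rewrite sqrtrM; last by rewrite mul1r mulrn_wge0 // pi_ge0.
rewrite sqrtrV; last by rewrite ltW.
rewrite -/t invfM invrK [in RHS]mulrA [in RHS]mulrA (mulrC t^-1) mulfVK //.
rewrite -[LHS]mulrA -expRD; congr (_ * expR _); field.
by rewrite -t2 expf_neq0.
Qed.

End GaussianIntegrals.

(** * From the characteristic function to the moment generating function *)

Section CharacteristicFunction.
Context {R : realType} {d : measure_display} {T : measurableType d} (P : probability T R).
Notation mu := (@lebesgue_measure R).

Lemma fubini_normal (s : R) (h : T * R -> R) (K : R) : s != 0 ->
  measurable_fun setT h -> (forall q, `|h q| <= K) ->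
  \int[P]_w (\int[mu]_z (normal_pdf 0 s z * h (w, z))) =
  \int[mu]_z (normal_pdf 0 s z * \int[P]_w h (w, z)).
Proof.
move=> s0 mh hK.
have K0 : 0 <= K by rewrite (le_trans (normr_ge0 _) (hK (point, 0))).
pose f (q : T * R) := (normal_pdf 0 s q.2 * h q)%:E.
have mf : measurable_fun setT f.
  apply/measurable_EFinP/measurable_funM => //.
  by apply: (measurableT_comp (measurable_normal_pdf 0 s)); exact: measurable_snd.
have mhw w : measurable_fun setT (fun z => h (w, z)) by exact: (measurableT_comp mh (pair1_measurable w)).
have mhz z : measurable_fun setT (fun w => h (w, z)) by exact: (measurableT_comp mh (pair2_measurable z)).
have iz w : mu.-integrable setT (fun z => (normal_pdf 0 s z * h (w, z))%:E).
  by apply: integrable_normal_pdfM => //; exists K => z.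
have iw z : P.-integrable setT (fun w => (h (w, z))%:E).
  apply: measurable_bounded_integrable => //.
    exact: le_lt_trans (probability_le1 P measurableT) (ltry 1).
  by exists K; split; [exact: num_real|move=> x Kx w _ /=; rewrite (le_trans (hK _)) // ltW].
have intf : (P \x mu)%E.-integrable setT f.
  apply/integrable12ltyP => //.
  apply: (@le_lt_trans _ _ (\int[P]_w K%:E)%E); last first.
    by rewrite integral_cst //= [X in (_ * X)%E](@probability_setT _ _ _ P) mule1 ltry.
  apply: ge0_le_integral => //.
  - by move=> w _; apply: integral_ge0.
  - exact: (@measurable_fun_fubini_tonelli_F _ _ _ _ _ mu _ (measurableT_comp (@abse_measurable R setT) mf) (fun q => abse_ge0 _)).
  - move=> w _.
    apply: (@le_trans _ _ (\int[mu]_z (K%:E * (normal_pdf 0 s z)%:E))%E).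
      apply: ge0_le_integral => //.
      + by apply: measurableT_comp => //; exact: measurable_int (iz w).
      + by apply/measurable_EFinP/measurable_funM => //; exact: measurable_normal_pdf.
      + move=> z _ /=; rewrite lee_fin normrM (ger0_norm (normal_pdf_ge0 _ _ _)) mulrC.
        by rewrite ler_wpM2r // normal_pdf_ge0.
    rewrite ge0_integralZl //= ?integral_normal_pdf ?mule1 //.
    + by apply/measurable_EFinP; exact: measurable_normal_pdf.
    + by move=> z _; rewrite lee_fin normal_pdf_ge0.
have F := @Fubini _ _ _ _ _ P mu f intf.
rewrite /Rintegral; congr fine.
transitivity (\int[P]_x \int[mu]_y f (x, y))%E.
  apply: eq_integral => w _; rewrite fineK //.
  exact: integrable_fin_num (iz w).
rewrite F; apply: eq_integral => z _.
rewrite EFinM fineK; last exact: integrable_fin_num (iw z).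
rewrite -integralZl //.
Qed.

Variables (X : T -> R) (v : R).
Hypothesis mX : measurable_fun setT X.
Hypothesis v0 : 0 <= v.
Hypothesis cosX : forall z, (\int[P]_w (cos (z * X w))%:E = (expR (- (z ^+ 2 * v / 2)))%:E)%E.
Hypothesis sinX : forall z, (\int[P]_w (sin (z * X w))%:E = 0)%E.

Let one_neq0 : (1 : R) != 0. Proof. exact: oner_neq0. Qed.

(** The Gaussian density is its own Fourier transform; in this form its mean over [x = X w] involves
    only the characteristic function of [X]. *)
Lemma normal_cf1 (x y : R) :
  normal_pdf x 1 y = normal_peak 1 * \int[mu]_z (normal_pdf 0 1 z * cos ((y - x) * z)).
Proof.
rewrite normal_cf // normal_pdfE // /normal_fun; congr (_ * expR _).
by field.
Qed.

(** After Fubini the sine part drops out by [sinX], and what remains is the Fourier inversion of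
    [expR (- z^2 (1 + v) / 2)]. The added unit variance keeps a genuine density even for [v = 0]. *)
Lemma expectation_normal_pdf (y : R) :
  \int[P]_w (normal_pdf (X w) 1 y) = normal_pdf 0 (Num.sqrt (1 + v)) y.
Proof.
have bint (h : T -> R) : measurable_fun setT h -> (forall w, `|h w| <= 1) -> P.-integrable setT (EFin \o h).
  move=> mh h1; apply: measurable_bounded_integrable => //.
    exact: le_lt_trans (probability_le1 P measurableT) (ltry 1).
  by exists 1; split; [exact: num_real|move=> x x1 w _ /=; rewrite (le_trans (h1 _)) // ltW].
pose t := Num.sqrt (1 + v).
have t2 : t ^+ 2 = 1 + v by rewrite sqr_sqrtr // addr_ge0.
have t0 : 0 < t by rewrite sqrtr_gt0 ltr_wpDr.
have tn0 : t != 0 by rewrite gt_eqF.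
have mXz z : measurable_fun setT (fun w => z * X w) by apply: measurable_funM.
have mh : measurable_fun setT (fun q : T * R => cos ((y - X q.1) * q.2)).
  apply: (measurableT_comp (continuous_measurable_fun (@continuous_cos R))).
  apply: measurable_funM; last exact: measurable_snd.
  by apply: measurable_funB => //; apply: (measurableT_comp mX); exact: measurable_fst.
transitivity (\int[P]_w (normal_peak 1 * \int[mu]_z (normal_pdf 0 1 z * cos ((y - X w) * z)))).
  by apply: eq_Rintegral => w _; exact: normal_cf1.
have pk x : normal_pdf x 1 y = normal_peak 1 * expR (- ((y - x) ^+ 2 * 1 ^+ 2 / 2)).
  by rewrite normal_cf1 normal_cf.
rewrite RintegralZl //; last first.
  apply: bint.
    under eq_fun do rewrite normal_cf //.
    apply: measurableT_comp => //; apply: measurableT_comp => //.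
    apply: measurable_funM => //; apply: measurable_funM => //; apply: measurable_funX.
    exact: measurable_funB.
  move=> w; rewrite normal_cf // ger0_norm ?expR_ge0 // -[leRHS]expR0 ler_expR oppr_le0.
  by rewrite divr_ge0 // mulr_ge0 // sqr_ge0.
rewrite (fubini_normal 1 _ 1 one_neq0 mh); last by move=> q; exact: cos_max.
have cz z : \int[P]_w (cos ((y - X w) * z)) = cos (y * z) * expR (- (z ^+ 2 * v / 2)).
  have e w : cos ((y - X w) * z) = cos (y * z) * cos (z * X w) + sin (y * z) * sin (z * X w).
    by rewrite mulrBl cosB (mulrC (X w)).
  have i1 : P.-integrable setT (EFin \o (fun w => cos (z * X w))).
    apply: bint; last by move=> w; exact: cos_max.
    by apply: measurableT_comp => //; exact: (continuous_measurable_fun (@continuous_cos R)).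
  have i2 : P.-integrable setT (EFin \o (fun w => sin (z * X w))).
    apply: bint; last by move=> w; exact: sin_max.
    by apply: measurableT_comp => //; exact: (continuous_measurable_fun (@continuous_sin R)).
  under eq_Rintegral do rewrite e.
  rewrite RintegralD //.
  - by rewrite !RintegralZl // /Rintegral cosX sinX /= mulr0 addr0.
  - exact: (integrableZl measurableT (cos (y * z)) i1).
  - exact: (integrableZl measurableT (sin (y * z)) i2).
transitivity (normal_peak 1 * \int[mu]_z (t^-1 * (normal_pdf 0 t^-1 z * cos (y * z)))).
  congr (_ * _); apply: eq_Rintegral => z _; rewrite cz mulrCA mulrC mulrA; congr (_ * _).
  have v1 : - v < 1 by rewrite (le_lt_trans _ ltr01) // oppr_le0.
  by have := normal_pdf_tilt (- v) z v1; rewrite mulrN mulNr !opprK.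
rewrite RintegralZl //; last first.
  apply: integrable_normal_pdfM; [by rewrite invr_eq0|exact: measurable_cos_mul|].
  by exists 1 => z; exact: cos_max.
rewrite normal_cf ?invr_eq0 // normal_pdfE // /normal_peak /normal_fun subr0 expr1n mul1r -/t t2.
rewrite -mulrnAr sqrtrM ?addr_ge0 // -/t invfM.
have -> : - y ^+ 2 / ((1 + v) *+ 2) = - (y ^+ 2 * t^-1 ^+ 2 / 2).
  by rewrite exprVn t2; field; rewrite -t2 expf_neq0.
by rewrite mulrA (mulrC t^-1).
Qed.

(* The characteristic function determines the density of [X] plus an independent standard normal;
   integrating that density against [expR] gives the moment generating function of [X]. *)
Lemma mgf_of_cf : (\int[P]_w (expR (X w))%:E = (expR (v / 2))%:E)%E.
Proof.
pose t := Num.sqrt (1 + v).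
have t2 : t ^+ 2 = 1 + v by rewrite sqr_sqrtr // addr_ge0.
have t0 : 0 < t by rewrite sqrtr_gt0 ltr_wpDr.
have tn0 : t != 0 by rewrite gt_eqF.
pose f (q : T * R) := (normal_pdf (X q.1) 1 q.2 * expR q.2)%:E.
have f0 q : (0 <= f q)%E by rewrite lee_fin mulr_ge0 ?expR_ge0 // normal_pdf_ge0.
have mf : measurable_fun setT f.
  apply/measurable_EFinP/measurable_funM; last by apply: measurableT_comp => //; exact: measurable_snd.
  under eq_fun do rewrite normal_pdfE //.
  apply: measurable_funM => //; apply: measurableT_comp => //.
  apply: measurable_funM => //; apply: measurableT_comp => //; apply: measurable_funX.
  by apply: measurable_funB; [exact: measurable_snd|apply: (measurableT_comp mX); exact: measurable_fst].
have fx w : (\int[mu]_y f (w, y) = (expR (2^-1))%:E * (expR (X w))%:E)%E.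
  transitivity (\int[mu]_y ((expR (2^-1 + X w))%:E * (normal_pdf (X w + 1) 1 y)%:E))%E.
    apply: eq_integral => y _; rewrite -EFinM /f /=; congr EFin.
    rewrite !normal_pdfE // /normal_fun [RHS]mulrCA -[LHS]mulrA; congr (_ * _).
    by rewrite -!expRD; congr expR; field.
  rewrite ge0_integralZl //= ?integral_normal_pdf ?mule1 -?EFinM -?expRD //.
  - by apply/measurable_EFinP; exact: measurable_normal_pdf.
  - by move=> z _; rewrite lee_fin normal_pdf_ge0.
have mpw (y : R) : measurable_fun setT (fun w => normal_pdf (X w) 1 y).
  under eq_fun do rewrite normal_pdfE //.
  apply: measurable_funM => //; apply: measurableT_comp => //.
  apply: measurable_funM => //; apply: measurableT_comp => //; apply: measurable_funX.
  exact: measurable_funB.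
have fy (y : R) : (\int[P]_w f (w, y) = (normal_pdf 0 t y * expR (1 * y))%:E)%E.
  have ip : P.-integrable setT (EFin \o (fun w => normal_pdf (X w) 1 y)).
    apply: measurable_bounded_integrable => //.
      exact: le_lt_trans (probability_le1 P measurableT) (ltry 1).
    exists (normal_peak 1); split; [exact: num_real|move=> x x1 w _ /=].
    by rewrite ger0_norm ?normal_pdf_ge0 // (le_trans (normal_pdf_ub _ _ _)) // ltW.
  rewrite -expectation_normal_pdf mul1r EFinM /Rintegral fineK; last exact: integrable_fin_num ip.
  rewrite muleC -ge0_integralZl //.
  - by apply: eq_integral => w _; rewrite -EFinM mulrC.
  - by apply/measurable_EFinP.
  - by move=> w _; rewrite lee_fin normal_pdf_ge0.
have := @fubini_tonelli _ _ _ _ _ P mu f mf f0.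
under eq_integral do rewrite fx.
under [X in _ = X -> _]eq_integral do rewrite fy.
rewrite normal_mgf // ge0_integralZl //=; last by apply/measurable_EFinP; exact: measurableT_comp.
rewrite expr1n mul1r t2 => E.
(* The smoothing normal variable contributed the factor [expR (1/2)] in [fx]; it is divided out
   here. *)
rewrite -[LHS]mul1e -[in LHS](_ : (expR (- 2^-1))%:E * (expR 2^-1)%:E = 1)%E; last first.
  by rewrite -EFinM -expRD addNr expR0.
rewrite -muleA E -EFinM -expRD; congr (expR _)%:E; field => //.
Qed.

End CharacteristicFunction.

(** * Gaussian quadratic forms *)

Section QuadraticForms.
Context {R : realType}.

Definition dotv {n} (a x : 'cV[R]_n) : R := (a^T *m x) ord0 ord0.
Definition qform {n} (S : 'M[R]_n) (a b : 'cV[R]_n) : R := (a^T *m S *m b) ord0 ord0.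
Definition psd {n} (S : 'M[R]_n) := S^T = S /\ forall a, 0 <= qform S a a.

Context {n : nat}.
Implicit Types (S A B : 'M[R]_n) (a b x y : 'cV[R]_n) (bs : seq 'cV[R]_n).

Lemma dotvE a x : dotv a x = \sum_j a j ord0 * x j ord0.
Proof. by rewrite /dotv mxE; apply: eq_bigr => j _; rewrite mxE. Qed.

Lemma dotvDl a b x : dotv (a + b) x = dotv a x + dotv b x.
Proof. by rewrite /dotv linearD mulmxDl mxE. Qed.
Lemma dotvZl c a x : dotv (c *: a) x = c * dotv a x.
Proof. by rewrite /dotv linearZ /= -scalemxAl mxE. Qed.
Lemma dotvC a x : dotv a x = dotv x a.
Proof. by rewrite !dotvE; apply: eq_bigr => j _; rewrite mulrC. Qed.
Lemma dotv0l x : dotv 0 x = 0.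
Proof. by rewrite -(scale0r 0) dotvZl mul0r. Qed.
Lemma dotvDr a x y : dotv a (x + y) = dotv a x + dotv a y.
Proof. by rewrite dotvC dotvDl !(dotvC a). Qed.
Lemma dotvZr c a x : dotv a (c *: x) = c * dotv a x.
Proof. by rewrite dotvC dotvZl dotvC. Qed.
Lemma dotvNl a x : dotv (- a) x = - dotv a x.
Proof. by rewrite -scaleN1r dotvZl mulN1r. Qed.
Lemma dotv_ge0 a : 0 <= dotv a a.
Proof. by rewrite dotvE sumr_ge0 // => j _; rewrite -expr2 sqr_ge0. Qed.

Lemma qformE S a b : qform S a b = dotv a (S *m b).
Proof. by rewrite /qform /dotv mulmxA. Qed.
Lemma qformDl S a b y : qform S (a + b) y = qform S a y + qform S b y.
Proof. by rewrite !qformE dotvDl. Qed.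
Lemma qformDr S y a b : qform S y (a + b) = qform S y a + qform S y b.
Proof. by rewrite !qformE mulmxDr dotvDr. Qed.
Lemma qformZl S c a y : qform S (c *: a) y = c * qform S a y.
Proof. by rewrite !qformE dotvZl. Qed.
Lemma qformZr S c a y : qform S y (c *: a) = c * qform S y a.
Proof. by rewrite !qformE -scalemxAr dotvZr. Qed.
Lemma qformNl S a y : qform S (- a) y = - qform S a y.
Proof. by rewrite !qformE dotvNl. Qed.
Lemma qformNr S a y : qform S y (- a) = - qform S y a.
Proof. by rewrite -scaleN1r qformZr mulN1r. Qed.
Lemma qform_addM S A a b : qform (S + A) a b = qform S a b + qform A a b.
Proof. by rewrite /qform mulmxDr mulmxDl mxE. Qed.
Lemma qform_scaleM c S a b : qform (c *: S) a b = c * qform S a b.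
Proof. by rewrite /qform -scalemxAr -scalemxAl mxE. Qed.
Lemma qform_oppM S a b : qform (- S) a b = - qform S a b.
Proof. by rewrite -scaleN1r qform_scaleM mulN1r. Qed.
Lemma qformC S a b : S^T = S -> qform S a b = qform S b a.
Proof.
by move=> sS; rewrite qformE dotvC /dotv /qform trmx_mul sS.
Qed.
Lemma qform_mulM S a b : qform (S *m b *m b^T *m S) a a = qform S a b * qform S b a.
Proof.
rewrite /qform.
have -> : a^T *m (S *m b *m b^T *m S) *m a = (a^T *m S *m b) *m (b^T *m S *m a) by rewrite !mulmxA.
by rewrite mxE big_ord1.
Qed.

Definition outer bs : 'M[R]_n := \sum_(b <- bs) b *m b^T.

Lemma outer_cons b bs : outer (b :: bs) = b *m b^T + outer bs.
Proof. by rewrite /outer big_cons. Qed.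

Lemma qform_rank1 a b x : qform (b *m b^T) a x = dotv b a * dotv b x.
Proof.
rewrite /qform /dotv mulmxA -mulmxA mxE big_ord1; congr (_ * _).
exact: dotvC.
Qed.

Lemma outer_sym bs : (outer bs)^T = outer bs.
Proof.
elim: bs => [|b bs IH]; first by rewrite /outer big_nil trmx0.
by rewrite outer_cons linearD /= IH trmx_mul trmxK.
Qed.

Lemma qform_outer bs a : qform (outer bs) a a = \sum_(b <- bs) dotv b a ^+ 2.
Proof.
elim: bs => [|b bs IH].
  by rewrite /outer !big_nil /qform mulmx0 mul0mx mxE.
by rewrite outer_cons qform_addM IH qform_rank1 big_cons expr2.
Qed.

Lemma psd_outer bs : psd (outer bs).
Proof.
split; first exact: outer_sym.
by move=> a; rewrite qform_outer sumr_ge0 // => b _; rewrite sqr_ge0.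
Qed.

Lemma tr_outerM bs S : \tr (outer bs *m S) = \sum_(b <- bs) qform S b b.
Proof.
elim: bs => [|b bs IH].
  by rewrite /outer !big_nil mul0mx mxtrace0.
rewrite outer_cons mulmxDl linearD /= IH big_cons; congr (_ + _).
by rewrite -mulmxA mxtrace_mulC /mxtrace big_ord1 /qform.
Qed.

(** The fixpoint equation expresses [S = (S0^-1 - B0)^-1] without inverting [S0]. With
    [y = a + B0 S a] one has [S a = S0 y] and [(1 - k) <y, S0 y> <= <a, S a>]; positivity of [S0] at
    [a - (1 - k) y] concludes. *)
Lemma tilt_up_bound S0 B0 S k a : psd S0 -> B0^T = B0 -> k < 1 ->
  (forall y, qform B0 (S0 *m y) (S0 *m y) <= k * qform S0 y y) ->
  S = S0 + S0 *m B0 *m S ->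
  qform S a a <= qform S0 a a / (1 - k).
Proof.
move=> [sS0 pS0] sB0 k1 hk eS.
set y := a + B0 *m S *m a.
have Sa : S *m a = S0 *m y by rewrite {1}eS mulmxDl mulmxDr !mulmxA.
have Z : qform S a a = qform S0 a y by rewrite qformE Sa -qformE.
have Y : qform S0 y y = qform S0 a y + qform B0 (S0 *m y) (S0 *m y).
  rewrite {1}/y qformDl; congr (_ + _).
  rewrite -mulmxA Sa [LHS]qformC // [RHS]qformE [LHS]qformE.
  by rewrite /dotv trmx_mul sS0 !mulmxA.
clearbody y; have hY := hk y.
have k10 : 0 < 1 - k by rewrite subr_gt0.
have := pS0 (a - (1 - k) *: y).
rewrite !(qformDl, qformDr, qformNl, qformNr, qformZl, qformZr) (qformC S0 y a) // => Q.
rewrite Z ler_pdivlMr //.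
nra.
Qed.

(** Same device for [S = (S0^-1 + B0)^-1]. The lower bound tests [S0] at [y - a / (1 + k)] and [B0]
    at the image of that vector under [S0]. *)
Lemma tilt_low_bound S0 B0 S k a : psd S0 -> psd B0 -> 0 <= k ->
  (forall y, qform B0 (S0 *m y) (S0 *m y) <= k * qform S0 y y) ->
  S = S0 - S0 *m B0 *m S ->
  qform S0 a a / (1 + k) <= qform S a a <= qform S0 a a.
Proof.
move=> [sS0 pS0] [sB0 pB0] k0 hk eS.
set y := a - B0 *m S *m a.
have Sa : S *m a = S0 *m y.
  by rewrite {1}eS mulmxDl mulNmx /y mulmxDr mulmxN !mulmxA.
have aE : a = y + B0 *m (S0 *m y) by rewrite -Sa /y mulmxA subrK.
have Z : qform S a a = qform S0 a y by rewrite qformE Sa -qformE.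
have QB u z : qform S0 u (B0 *m (S0 *m z)) = qform B0 (S0 *m u) (S0 *m z).
  by rewrite [LHS]qformE [RHS]qformE /dotv trmx_mul sS0 !mulmxA.
have Y : qform S0 a y = qform S0 y y + qform B0 (S0 *m y) (S0 *m y).
  by rewrite {1}aE qformDl (qformC _ (B0 *m _)) // QB.
have A : qform S0 a a = qform S0 a y + qform B0 (S0 *m a) (S0 *m y).
  by rewrite {2}aE qformDr QB.
clearbody y; have k10 : 0 < 1 + k by rewrite ltr_pwDl.
apply/andP; split; last first.
  have E : qform B0 (S0 *m a) (S0 *m y) =
      qform B0 (S0 *m y) (S0 *m y) + qform S0 (B0 *m (S0 *m y)) (B0 *m (S0 *m y)).
    by rewrite QB {1}aE mulmxDr qformDl.
  by rewrite Z A lerDl E addr_ge0.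
have := pS0 (y - (1 + k)^-1 *: a); have := pB0 (S0 *m (y - (1 + k)^-1 *: a)).
rewrite mulmxDr mulmxN -scalemxAr.
rewrite !(qformDl, qformDr, qformNl, qformNr, qformZl, qformZr) (qformC S0 y a) // (qformC B0 (S0 *m y) (S0 *m a)) // => Q1 Q2.
have := hk a => ha.
rewrite Z.
set th := (1 + k)^-1 in Q1 Q2 *.
have thE : th * (1 + k) = 1 by rewrite /th mulVf // gt_eqF.
have th0 : 0 < th by rewrite invr_gt0.
have : th ^+ 2 * qform B0 (S0 *m a) (S0 *m a) <= th ^+ 2 * (k * qform S0 a a).
  by rewrite ler_wpM2l // sqr_ge0.
have : th * (th * (1 + k)) * qform S0 a a = th * qform S0 a a by rewrite thE mulr1.
move: Q1 Q2 A Y.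
rewrite -/th.
set Aa := qform S0 a a; set Zz := qform S0 a y; set BB := qform B0 (S0 *m a) (S0 *m y).
move=> Q1 Q2 A Y e1 e2.
have e3 : th * Aa = th * Zz + th * BB by rewrite {1}A mulrDr.
nra.
Qed.

(** At [y = b] the hypotheses give [t^2 <= k t] for [t = <b, S0 b>]. *)
Lemma qform_le_rank1 B S0 k b : psd S0 ->
  (forall y, qform B (S0 *m y) (S0 *m y) <= k * qform S0 y y) ->
  (forall x, dotv b x ^+ 2 <= qform B x x) -> 0 <= k ->
  qform S0 b b <= k.
Proof.
move=> [sS0 pS0] hk hb k0.
have := le_trans (hb _) (hk b); rewrite -qformE => h.
have := pS0 b; rewrite le_eqVlt => /orP[/eqP<- //|p].
by rewrite expr2 ler_pM2r in h.
Qed.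

(** Converts norm bounds into the relative bound on which tilting relies. The point is
    [S0^2 <= si S0], obtained without a square root from positivity of [S0] at [S0 y - si y]. *)
Lemma qform_image_le S0 B be si y : psd S0 -> 0 < si -> 0 <= be ->
  (forall x, qform B x x <= be * dotv x x) ->
  (forall x, qform S0 x x <= si * dotv x x) ->
  qform B (S0 *m y) (S0 *m y) <= be * si * qform S0 y y.
Proof.
move=> [sS0 pS0] si0 be0 hB hS.
rewrite (le_trans (hB _)) // -mulrA ler_wpM2l //.
set x := S0 *m y.
have xx : dotv x x = qform S0 x y by rewrite qformE.
have := pS0 (x - si *: y); have := hS x.
rewrite !(qformDl, qformDr, qformNl, qformNr, qformZl, qformZr) (qformC S0 y x) // -xx => h1 h2.
nra.
Qed.

End QuadraticForms.

(** * Exponential tilting of a Gaussian law by rank-one squares *)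

Section GaussianTilting.
Context {R : realType} {d : measure_display} {T : measurableType d} (P : probability T R).
Notation mu := (@lebesgue_measure R).
Variables (n : nat) (xi : T -> 'cV[R]_n).
Hypothesis mxi : forall i, measurable_fun setT (fun w => xi w i ord0).
Implicit Types (S : 'M[R]_n) (a b : 'cV[R]_n) (W : T -> R) (D : R).

Lemma measurable_dotv a : measurable_fun setT (fun w => dotv a (xi w)).
Proof.
under eq_fun do rewrite dotvE.
by apply: measurable_sum => j; apply: measurable_funM.
Qed.

(* Covariance after reweighting a Gaussian law of covariance [S] by [expR (<b, xi>^2 / 2)]. *)
Definition tilt_up S b := S + (1 - qform S b b)^-1 *: (S *m b *m b^T *m S).

(** Linearizes a square in the exponent: a quadratic weight becomes an average, over a standard
    normal [z], of linear weights, which merge with the argument of the moment generating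
    function. *)
Lemma gauss_exp_sqr (x : R) :
  (\int[mu]_z (normal_pdf 0 1 z * expR (x * z))%:E = (expR (x ^+ 2 / 2))%:E)%E.
Proof. by rewrite normal_mgf ?oner_neq0 // expr1n mulr1. Qed.

(** Linearize the square of [<b, xi>] by [gauss_exp_sqr] and exchange the integrals. The remaining
    integral over the auxiliary variable converges because [qform S b b < 1]; its normalization is
    the new factor of [D]. *)
Lemma exp_tilt_step W D S b : measurable_fun setT W -> (forall w, 0 <= W w) -> 0 <= D ->
  S^T = S -> qform S b b < 1 ->
  (forall a, \int[P]_w (W w * expR (dotv a (xi w)))%:E = (D * expR (qform S a a / 2))%:E)%E ->
  forall a, (\int[P]_w (W w * expR (dotv b (xi w) ^+ 2 / 2) * expR (dotv a (xi w)))%:E =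
    (D * (Num.sqrt (1 - qform S b b))^-1 * expR (qform (tilt_up S b) a a / 2))%:E)%E.
Proof.
move=> mW W0 D0 sS v1 H a.
set v := qform S b b in v1 *.
have v10 : 0 < 1 - v by rewrite subr_gt0.
pose s := (Num.sqrt (1 - v))^-1.
have s2 : s ^+ 2 = (1 - v)^-1 by rewrite exprVn sqr_sqrtr // ltW.
have sn0 : s != 0 by rewrite invr_eq0 gt_eqF // sqrtr_gt0.
pose f (q : T * R) := (normal_pdf 0 1 q.2 * (W q.1 * expR (dotv (q.2 *: b + a) (xi q.1))))%:E.
have f0 q : (0 <= f q)%E by rewrite lee_fin !mulr_ge0 ?expR_ge0 ?normal_pdf_ge0.
have mf : measurable_fun setT f.
  apply/measurable_EFinP/measurable_funM.
    by apply: (measurableT_comp (measurable_normal_pdf 0 1)); exact: measurable_snd.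
  apply: measurable_funM; first by apply: (measurableT_comp mW); exact: measurable_fst.
  apply: measurableT_comp => //.
  under eq_fun do rewrite dotvDl dotvZl.
  apply: measurable_funD.
    apply: measurable_funM; first exact: measurable_snd.
    by apply: (measurableT_comp (measurable_dotv b)); exact: measurable_fst.
  by apply: (measurableT_comp (measurable_dotv a)); exact: measurable_fst.
have mWe c : measurable_fun setT (fun w => W w * expR (dotv c (xi w))).
  by apply: measurable_funM => //; apply: measurableT_comp => //; exact: measurable_dotv.
have fx w : (\int[mu]_y f (w, y) = (W w * expR (dotv b (xi w) ^+ 2 / 2) * expR (dotv a (xi w)))%:E)%E.
  transitivity (\int[mu]_y ((W w * expR (dotv a (xi w)))%:E * (normal_pdf 0 1 y * expR (dotv b (xi w) * y))%:E))%E.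
    apply: eq_integral => y _; rewrite -EFinM /f /=; congr EFin.
    by rewrite dotvDl dotvZl expRD (mulrC y); ring.
  rewrite ge0_integralZl //.
  - by rewrite gauss_exp_sqr -EFinM; congr EFin; ring.
  - apply/measurable_EFinP/measurable_funM; first exact: measurable_normal_pdf.
    by apply: measurableT_comp => //; exact: mulrl_measurable.
  - by move=> z _; rewrite lee_fin mulr_ge0 ?expR_ge0 ?normal_pdf_ge0.
  - by rewrite lee_fin mulr_ge0 ?expR_ge0.
have fy (y : R) : (\int[P]_w f (w, y) =
   (D * s * expR (qform S a a / 2))%:E * (normal_pdf 0 s y * expR (qform S b a * y))%:E)%E.
  transitivity ((normal_pdf 0 1 y)%:E * \int[P]_w (W w * expR (dotv (y *: b + a) (xi w)))%:E)%E.
    rewrite -ge0_integralZl //.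
    - exact/measurable_EFinP.
    - by move=> w _; rewrite lee_fin mulr_ge0 ?expR_ge0.
    - by rewrite lee_fin normal_pdf_ge0.
  rewrite H -!EFinM; congr EFin.
  have -> : qform S (y *: b + a) (y *: b + a) / 2 =
      y ^+ 2 * v / 2 + qform S a a / 2 + qform S b a * y.
    by rewrite !(qformDl, qformDr, qformZl, qformZr) (qformC S a b) // -/v; field.
  have := normal_pdf_tilt v y v1; rewrite -/s => e.
  by rewrite !expRD (mulrC D) !mulrA e; ring.
under eq_integral do rewrite -fx.
rewrite (@fubini_tonelli _ _ _ _ _ P mu f mf f0).
under eq_integral do rewrite fy.
rewrite ge0_integralZl //.
- rewrite normal_mgf // -EFinM -/s; congr EFin.
  rewrite -[LHS]mulrA -expRD; congr (_ * expR _).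
  rewrite /tilt_up qform_addM qform_scaleM qform_mulM (qformC S a b) // -/v s2.
  by field; rewrite gt_eqF.
- apply/measurable_EFinP/measurable_funM; first exact: measurable_normal_pdf.
  by apply: measurableT_comp => //; exact: mulrl_measurable.
- by move=> z _; rewrite lee_fin mulr_ge0 ?expR_ge0 ?normal_pdf_ge0.
- by rewrite lee_fin !mulr_ge0 ?expR_ge0 // invr_ge0 sqrtr_ge0.
Qed.

(* Covariance after reweighting a Gaussian law of covariance [S] by [expR (- <b, xi>^2 / 2)]. *)
Definition tilt_low S b := S - (1 + qform S b b)^-1 *: (S *m b *m b^T *m S).

(** Here [expR (- x^2 / 2)] is the average of [cos (x z)] over a standard normal [z], and the
    product of cosines splits into the cosines at [z b + a] and [z b - a]. *)
Lemma cos_tilt_step W D S b : measurable_fun setT W -> (forall w, 0 <= W w <= 1) ->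
  S^T = S -> 0 <= qform S b b ->
  (forall a, \int[P]_w (W w * cos (dotv a (xi w))) = D * expR (- (qform S a a / 2))) ->
  forall a, \int[P]_w (W w * expR (- (dotv b (xi w) ^+ 2 / 2)) * cos (dotv a (xi w))) =
    D * (Num.sqrt (1 + qform S b b))^-1 * expR (- (qform (tilt_low S b) a a / 2)).
Proof.
move=> mW W01 sS v0 H a.
set v := qform S b b in v0 *.
have v10 : 0 < 1 + v by rewrite ltr_pwDl.
pose s := (Num.sqrt (1 + v))^-1.
have s2 : s ^+ 2 = (1 + v)^-1 by rewrite exprVn sqr_sqrtr // ltW.
have sn0 : s != 0 by rewrite invr_eq0 gt_eqF // sqrtr_gt0.
have mcosd c : measurable_fun setT (fun w => cos (dotv c (xi w))).
  by apply: (measurableT_comp (continuous_measurable_fun (@continuous_cos R))); exact: measurable_dotv.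
have Wc1 w x : `|W w * cos x| <= 1.
  have /andP[w0 w1] := W01 w.
  by rewrite normrM ger0_norm // mulr_ile1 // cos_max.
have iW c : P.-integrable setT (EFin \o (fun w => W w * cos (dotv c (xi w)))).
  apply: measurable_bounded_integrable => //.
  - exact: le_lt_trans (probability_le1 P measurableT) (ltry 1).
  - exact: measurable_funM.
  - by exists 1; split; [exact: num_real|move=> x x1 w _ /=; rewrite (le_trans (Wc1 _ _)) // ltW].
pose h (q : T * R) := W q.1 * cos (dotv a (xi q.1)) * cos (dotv b (xi q.1) * q.2).
have mh : measurable_fun setT h.
  apply: measurable_funM.
    apply: measurable_funM; first by apply: (measurableT_comp mW); exact: measurable_fst.
    by apply: (measurableT_comp (mcosd a)); exact: measurable_fst.
  apply: (measurableT_comp (continuous_measurable_fun (@continuous_cos R))).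
  apply: measurable_funM; last exact: measurable_snd.
  by apply: (measurableT_comp (measurable_dotv b)); exact: measurable_fst.
have h1 q : `|h q| <= 1 by rewrite /h normrM mulr_ile1 // cos_max.
transitivity (\int[P]_w (\int[mu]_z (normal_pdf 0 1 z * h (w, z)))).
  apply: eq_Rintegral => w _.
  under [RHS]eq_Rintegral do rewrite /h /= mulrCA.
  rewrite RintegralZl //; last first.
    apply: integrable_normal_pdfM; [exact: oner_neq0|exact: measurable_cos_mul|].
    by exists 1 => z; exact: cos_max.
  by rewrite normal_cf ?oner_neq0 // expr1n mulr1; ring.
rewrite (fubini_normal P 1 h 1 (oner_neq0 _) mh h1).
have E z : \int[P]_w h (w, z) = D * expR (- (qform S a a / 2)) * expR (z ^+ 2 * - v / 2) *
     (2^-1 * (expR (qform S b a * z) + expR (- qform S b a * z))).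
  transitivity (\int[P]_w (2^-1 * (W w * cos (dotv (z *: b + a) (xi w)) + W w * cos (dotv (z *: b - a) (xi w))))).
    apply: eq_Rintegral => w _.
    rewrite !dotvDl dotvNl dotvZl cosB cosD /h /= (mulrC z).
    by field.
  rewrite RintegralZl //; last first.
    exact: (integrableD measurableT (iW _) (iW _)).
  rewrite RintegralD // !H.
  have -> : - (qform S (z *: b + a) (z *: b + a) / 2) =
      - (qform S a a / 2) + z ^+ 2 * - v / 2 + - qform S b a * z.
    by rewrite !(qformDl, qformDr, qformZl, qformZr) (qformC S a b) // -/v; field.
  have -> : - (qform S (z *: b - a) (z *: b - a) / 2) =
      - (qform S a a / 2) + z ^+ 2 * - v / 2 + qform S b a * z.
    by rewrite !(qformDl, qformDr, qformNl, qformNr, qformZl, qformZr) (qformC S a b) // -/v; field.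
  by rewrite !expRD; ring.
have v1 : - v < 1 by rewrite (le_lt_trans _ ltr01) // oppr_le0.
have TT z : normal_pdf 0 1 z * expR (z ^+ 2 * - v / 2) = s * normal_pdf 0 s z.
  by have := normal_pdf_tilt (- v) z v1; rewrite opprK.
transitivity (\int[mu]_z (D * expR (- (qform S a a / 2)) * s * 2^-1 *
   (normal_pdf 0 s z * expR (qform S b a * z) + normal_pdf 0 s z * expR (- qform S b a * z)))).
  apply: eq_Rintegral => z _; rewrite E.
  transitivity (D * expR (- (qform S a a / 2)) * (normal_pdf 0 1 z * expR (z ^+ 2 * - v / 2)) *
     (2^-1 * (expR (qform S b a * z) + expR (- qform S b a * z)))); first by ring.
  by rewrite TT; ring.
have ie c : mu.-integrable setT (EFin \o (fun z => normal_pdf 0 s z * expR (c * z))).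
  exact: integrable_normal_pdf_exp.
rewrite RintegralZl //; last exact: (integrableD measurableT (ie _) (ie _)).
rewrite RintegralD // /Rintegral !normal_mgf //= sqrrN.
have -> : - (qform (tilt_low S b) a a / 2) = - (qform S a a / 2) + qform S b a ^+ 2 * s ^+ 2 / 2.
  rewrite /tilt_low qform_addM qform_oppM qform_scaleM qform_mulM (qformC S a b) // -/v s2.
  by field; rewrite gt_eqF.
by rewrite expRD -/s; field.
Qed.

Lemma rank1_sym S b : S^T = S -> (S *m b *m b^T *m S)^T = S *m b *m b^T *m S.
Proof. by move=> sS; rewrite !trmx_mul trmxK sS !mulmxA. Qed.

(** Sherman-Morrison in inverse-free form: the tilt subtracts [b b^T] from the precision matrix.
    Everything reduces to [1 + c v = c] for [c = 1 / (1 - v)]. *)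
Lemma tilt_up_fixpoint S0 B0 S b : S = S0 + S0 *m B0 *m S -> qform S b b != 1 ->
  tilt_up S b = S0 + S0 *m (B0 + b *m b^T) *m tilt_up S b.
Proof.
rewrite /tilt_up; set v := qform S b b => eS v1; set c := (1 - v)^-1.
have e1 : S0 *m B0 *m S = S - S0 by rewrite {2}eS addrC addKr.
have e2 : b^T *m S *m b = v%:M by rewrite [LHS]mx11_scalar.
have e3 : S0 *m B0 *m (S *m b *m b^T *m S) = S *m b *m b^T *m S - S0 *m b *m b^T *m S.
  by rewrite !mulmxA e1 !mulmxBl.
have e4 : S0 *m (b *m b^T) *m (S *m b *m b^T *m S) = v *: (S0 *m b *m b^T *m S).
  have -> : S0 *m (b *m b^T) *m (S *m b *m b^T *m S) = (S0 *m b) *m (b^T *m S *m b) *m (b^T *m S).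
    by rewrite !mulmxA.
  by rewrite e2 mul_mx_scalar -scalemxAl !mulmxA.
have e5 : S0 *m (b *m b^T) *m S = S0 *m b *m b^T *m S by rewrite !mulmxA.
rewrite mulmxDr mulmxDl !(mulmxDr _ S) -!scalemxAr e1 e3 e4 e5.
move: (S *m b *m b^T *m S) (S0 *m b *m b^T *m S) => M X.
have c1 : 1 + c * v = c by rewrite /c; field; rewrite subr_eq0 eq_sym.
apply/matrixP => i j; rewrite !mxE.
have : X i j * (1 + c * v - c) = 0 by rewrite {1}c1 subrr mulr0.
move: (X i j) (M i j) (S i j) (S0 i j) => x m s s0 E.
have -> : s0 + (s - s0 + c * (m - x) + (x + c * (v * x))) = s + c * m + x * (1 + c * v - c) by ring.
by rewrite E addr0.
Qed.

Lemma tilt_low_fixpoint S0 B0 S b : S = S0 - S0 *m B0 *m S -> qform S b b != -1 ->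
  tilt_low S b = S0 - S0 *m (B0 + b *m b^T) *m tilt_low S b.
Proof.
rewrite /tilt_low; set v := qform S b b => eS v1; set c := (1 + v)^-1.
have e1 : S0 *m B0 *m S = S0 - S by rewrite {2}eS opprB addrC subrK.
have e2 : b^T *m S *m b = v%:M by rewrite [LHS]mx11_scalar.
have e3 : S0 *m B0 *m (S *m b *m b^T *m S) = S0 *m b *m b^T *m S - S *m b *m b^T *m S.
  by rewrite !mulmxA e1 !mulmxBl.
have e4 : S0 *m (b *m b^T) *m (S *m b *m b^T *m S) = v *: (S0 *m b *m b^T *m S).
  have -> : S0 *m (b *m b^T) *m (S *m b *m b^T *m S) = (S0 *m b) *m (b^T *m S *m b) *m (b^T *m S).
    by rewrite !mulmxA.
  by rewrite e2 mul_mx_scalar -scalemxAl !mulmxA.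
have e5 : S0 *m (b *m b^T) *m S = S0 *m b *m b^T *m S by rewrite !mulmxA.
rewrite mulmxDr mulmxDl !(mulmxDr _ S) !mulmxN -!scalemxAr e1 e3 e4 e5.
move: (S *m b *m b^T *m S) (S0 *m b *m b^T *m S) => M X.
have c1 : 1 - c * v = c by rewrite /c; field; rewrite addrC -[1]opprK subr_eq0.
apply/matrixP => i j; rewrite !mxE.
have : X i j * (1 - c * v - c) = 0 by rewrite {1}c1 subrr mulr0.
move: (X i j) (M i j) (S i j) (S0 i j) => x m s s0 E.
have -> : s0 - (s0 - s - c * (x - m) + (x - c * (v * x))) = s - c * m - x * (1 - c * v - c) by ring.
by rewrite E subr0.
Qed.

(** [1 / (1 - v) = 1 + v / (1 - v) <= expR (v / (1 - v))], for either sign of [v]. It turns the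
    product of the normalizing factors into the exponential of a trace. *)
Lemma invsqrt_le_exp (v : R) : v < 1 -> (Num.sqrt (1 - v))^-1 <= expR (v / (1 - v) / 2).
Proof.
move=> v1; have v10 : 0 < 1 - v by rewrite subr_gt0.
rewrite -sqrtrV ?(ltW v10) // -(@ger0_norm _ (expR _)) ?expR_ge0 // -sqrtr_sqr.
rewrite ler_wsqrtr // -expRM_natr.
have -> : v / (1 - v) / 2 * 2 = v / (1 - v) by field; rewrite gt_eqF.
have e : (1 - v)^-1 = 1 + v / (1 - v) by field; rewrite gt_eqF.
rewrite {1}e; exact: expR_ge1Dx.
Qed.

(* [B0] is the part of [Bt] already absorbed in the weight [W]; the current covariance [S] solves
   [S = S0 + S0 B0 S], whence [S <= S0 / (1 - k)] at every step. *)
Lemma exp_tilt_list S0 k Bt : psd S0 -> 0 <= k -> k < 2^-1 ->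
  (forall y, qform Bt (S0 *m y) (S0 *m y) <= k * qform S0 y y) ->
  forall bs B0 W D S, measurable_fun setT W -> (forall w, 0 <= W w) -> 0 <= D ->
  psd B0 -> B0 + outer bs = Bt -> S^T = S -> S = S0 + S0 *m B0 *m S ->
  (forall a, \int[P]_w (W w * expR (dotv a (xi w)))%:E = (D * expR (qform S a a / 2))%:E)%E ->
  (\int[P]_w (W w * expR (qform (outer bs) (xi w) (xi w) / 2))%:E <=
     (D * expR (\tr (outer bs *m S0) / (1 - 2 * k) / 2))%:E)%E.
Proof.
move=> pS0 k0 k2 hk; elim=> [|b bs IH] B0 W D S mW W0 D0 pB0 eB sS eS H.
  rewrite tr_outerM big_nil !mul0r.
  have q0 : qform S 0 0 = 0 by rewrite -{1}(scale0r 0) qformZl mul0r.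
  have := H 0; rewrite q0 mul0r => <-.
  rewrite le_eqVlt; apply/orP; left; apply/eqP; apply: eq_integral => w _.
  by rewrite qform_outer big_nil mul0r dotv0l.
have kk : k < 1 by lra.
have le_B (B : 'M[R]_n) C y : B + C = Bt -> psd C ->
    qform B (S0 *m y) (S0 *m y) <= k * qform S0 y y.
  move=> e [_ pC]; apply: le_trans (hk y); rewrite -e qform_addM lerDl; exact: pC.
set t := qform S0 b b; set v := qform S b b.
have t0 : 0 <= t by apply: pS0.2.
have tk : t <= k.
  apply: (qform_le_rank1 Bt) => // x; rewrite -eB outer_cons !qform_addM qform_rank1.
  rewrite -expr2 addrCA lerDl addr_ge0 //; first exact: pB0.2.
  exact: (psd_outer _).2.
have vt : v * (1 - k) <= t.
  rewrite -ler_pdivlMr ?subr_gt0 //.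
  apply: (tilt_up_bound S0 B0) => //; first exact: pB0.1.
  by move=> y; apply: le_B eB _; exact: psd_outer.
have v1 : v < 1 by nra.
have step := exp_tilt_step _ _ _ _ mW W0 D0 sS v1 H.
have D'0 : 0 <= D * (Num.sqrt (1 - v))^-1 by rewrite mulr_ge0 // invr_ge0 sqrtr_ge0.
have pB0' : psd (B0 + b *m b^T).
  split; first by rewrite linearD /= pB0.1 trmx_mul trmxK.
  by move=> a; rewrite qform_addM qform_rank1 -expr2 addr_ge0 ?sqr_ge0 //; exact: pB0.2.
have mW' : measurable_fun setT (fun w => W w * expR (dotv b (xi w) ^+ 2 / 2)).
  apply: measurable_funM => //; apply: measurableT_comp => //; apply: measurable_funM => //.
  by apply: measurable_funX; exact: measurable_dotv.
have W'0 w : 0 <= W w * expR (dotv b (xi w) ^+ 2 / 2) by rewrite mulr_ge0 ?expR_ge0.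
have sS' : (tilt_up S b)^T = tilt_up S b.
  by rewrite /tilt_up linearD /= linearZ /= rank1_sym // sS.
have eB' : B0 + b *m b^T + outer bs = Bt by rewrite -addrA -outer_cons.
have eS' : tilt_up S b = S0 + S0 *m (B0 + b *m b^T) *m tilt_up S b.
  by apply: tilt_up_fixpoint => //; rewrite lt_eqF.
have := IH _ _ _ _ mW' W'0 D'0 pB0' eB' sS' eS' step.
under eq_integral => w _.
  rewrite -mulrA -expRD -mulrDl expr2 -qform_rank1 -qform_addM -outer_cons.
  over.
move=> /le_trans; apply; rewrite lee_fin -mulrA ler_wpM2l //.
rewrite !tr_outerM big_cons -/t (mulrDl t) (mulrDl (t / _)) expRD ler_wpM2r ?expR_ge0 //.
apply: (le_trans (invsqrt_le_exp v v1)); rewrite ler_expR ler_wpM2r //.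
(* [v <= t / (1 - k)] and [t <= k] give [v / (1 - v) <= t / (1 - k - t) <= t / (1 - 2 k)]. *)
have k20 : 0 < 1 - 2 * k by lra.
have v10 : 0 < 1 - v by rewrite subr_gt0.
rewrite ler_pdivrMr // mulrAC ler_pdivlMr //.
nra.
Qed.

(* The weights now decrease, so the law is tracked by its bounded characteristic function. *)
Lemma cos_tilt_list S0 k Bt : psd S0 -> 0 <= k ->
  (forall y, qform Bt (S0 *m y) (S0 *m y) <= k * qform S0 y y) ->
  forall bs B0 W D S, measurable_fun setT W -> (forall w, 0 <= W w <= 1) -> 0 <= D ->
  psd B0 -> B0 + outer bs = Bt -> S^T = S -> S = S0 - S0 *m B0 *m S ->
  (forall a, \int[P]_w (W w * cos (dotv a (xi w))) = D * expR (- (qform S a a / 2))) ->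
  \int[P]_w (W w * expR (- (qform (outer bs) (xi w) (xi w) / 2))) <=
     D * expR (- (\tr (outer bs *m S0) / (1 + k) ^+ 2 / 2)).
Proof.
move=> pS0 k0 hk; elim=> [|b bs IH] B0 W D S mW W0 D0 pB0 eB sS eS H.
  rewrite tr_outerM big_nil !mul0r oppr0 expR0.
  have q0 : qform S 0 0 = 0 by rewrite -{1}(scale0r 0) qformZl mul0r.
  have := H 0; rewrite q0 mul0r oppr0 expR0 => <-.
  rewrite le_eqVlt; apply/orP; left; apply/eqP; apply: eq_Rintegral => w _.
  by rewrite qform_outer big_nil mul0r oppr0 expR0 dotv0l cos0.
have le_B (B : 'M[R]_n) C y : B + C = Bt -> psd C ->
    qform B (S0 *m y) (S0 *m y) <= k * qform S0 y y.
  move=> e [_ pC]; apply: le_trans (hk y); rewrite -e qform_addM lerDl; exact: pC.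
set t := qform S0 b b; set v := qform S b b.
have t0 : 0 <= t by apply: pS0.2.
have k10 : 0 < 1 + k by rewrite ltr_pwDl.
have tk : t <= k.
  apply: (qform_le_rank1 Bt) => // x; rewrite -eB outer_cons !qform_addM qform_rank1.
  rewrite -expr2 addrCA lerDl addr_ge0 //; first exact: pB0.2.
  exact: (psd_outer _).2.
have /andP[tv vt] : t / (1 + k) <= v <= t.
  apply: (tilt_low_bound S0 B0) => //.
  by move=> y; apply: le_B eB _; exact: psd_outer.
have v0 : 0 <= v by apply: le_trans tv; rewrite divr_ge0 // ltW.
have step := cos_tilt_step _ _ _ _ mW W0 sS v0 H.
have D'0 : 0 <= D * (Num.sqrt (1 + v))^-1 by rewrite mulr_ge0 // invr_ge0 sqrtr_ge0.
have pB0' : psd (B0 + b *m b^T).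
  split; first by rewrite linearD /= pB0.1 trmx_mul trmxK.
  by move=> a; rewrite qform_addM qform_rank1 -expr2 addr_ge0 ?sqr_ge0 //; exact: pB0.2.
have mW' : measurable_fun setT (fun w => W w * expR (- (dotv b (xi w) ^+ 2 / 2))).
  apply: measurable_funM => //; apply: measurableT_comp => //; apply: measurableT_comp => //.
  apply: measurable_funM => //.
  by apply: measurable_funX; exact: measurable_dotv.
have W'0 w : 0 <= W w * expR (- (dotv b (xi w) ^+ 2 / 2)) <= 1.
  have /andP[w0 w1] := W0 w.
  rewrite mulr_ge0 ?expR_ge0 //= mulr_ile1 ?expR_ge0 // -[leRHS]expR0 ler_expR oppr_le0.
  by rewrite divr_ge0 // sqr_ge0.
have sS' : (tilt_low S b)^T = tilt_low S b.
  by rewrite /tilt_low linearB /= linearZ /= rank1_sym // sS.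
have eB' : B0 + b *m b^T + outer bs = Bt by rewrite -addrA -outer_cons.
have eS' : tilt_low S b = S0 - S0 *m (B0 + b *m b^T) *m tilt_low S b.
  by apply: tilt_low_fixpoint => //; rewrite gt_eqF // (lt_le_trans _ v0) // ltrN10.
have := IH _ _ _ _ mW' W'0 D'0 pB0' eB' sS' eS' step.
under eq_Rintegral => w _.
  rewrite -mulrA -expRD -opprD -mulrDl expr2 -qform_rank1 -qform_addM -outer_cons.
  over.
move=> /le_trans; apply; rewrite -mulrA ler_wpM2l //.
rewrite !tr_outerM big_cons -/t mulrDl mulrDl opprD expRD ler_wpM2r ?expR_ge0 //.
have v1 : - v < 1 by rewrite (le_lt_trans _ ltr01) // oppr_le0.
have := invsqrt_le_exp (- v) v1; rewrite opprK => /le_trans; apply; rewrite ler_expR.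
(* [v >= t / (1 + k)] and [v <= t <= k] give [v / (1 + v) >= t / (1 + k)^2]. *)
rewrite !mulNr lerN2 ler_wpM2r //.
have v10 : 0 < 1 + v by rewrite ltr_pwDl.
rewrite ler_pdivlMr // mulrAC ler_pdivrMr ?exprn_gt0 //.
rewrite ler_pdivrMr // in tv.
nra.
Qed.

End GaussianTilting.

(** * Positive forms as sums of rank-one squares *)

Section RankOneDecomposition.
Context {R : realType} {n : nat}.
Implicit Types (S A B C : 'M[R]_n) (a b x y : 'cV[R]_n) (bs : seq 'cV[R]_n).

Lemma qform_delta C i j : qform C (delta_mx i ord0) (delta_mx j ord0) = C i j.
Proof.
by rewrite /qform trmx_delta -rowE -colE mxE mxE.
Qed.

(** One step of Cholesky elimination: the remainder is a Schur complement, whose form at [x] is that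
    of [C] at [x] minus the multiple [(C x)_i / C_ii] of the [i]-th basis vector. *)
Lemma psd_sub_rank1 C i : psd C -> 0 < C i i ->
  psd (C - (C i i)^-1 *: (C *m delta_mx i ord0 *m (C *m delta_mx i ord0 : 'cV_n)^T)).
Proof.
move=> [sC pC] c0; set e := delta_mx i ord0; set c := C i i in c0 *.
split.
  by rewrite linearB /= linearZ /= trmx_mul trmxK sC.
move=> x; rewrite qform_addM qform_oppM qform_scaleM qform_rank1.
have -> : dotv (C *m e) x = qform C x e by rewrite dotvC -qformE.
have := pC (x - (c^-1 * qform C x e) *: e).
rewrite !(qformDl, qformDr, qformNl, qformNr, qformZl, qformZr) (qformC C e x) // qform_delta -/c.
set q := qform C x e; congr (_ <= _).
by field; rewrite gt_eqF.
Qed.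

Lemma psd_diag0 C i j : psd C -> C i i = 0 -> C i j = 0.
Proof.
move=> [sC pC] c0.
(* The minimizing multiple would be [- C i j / C j j]; the added 1 also covers [C j j = 0] and still
   makes the form negative unless [C i j = 0]. *)
pose s := - (C j j + 1)^-1 * C i j.
have cj0 : 0 <= C j j by rewrite -qform_delta.
have := pC (delta_mx i ord0 + s *: delta_mx j ord0).
have Cji : C j i = C i j by rewrite -[in LHS]sC mxE.
rewrite !(qformDl, qformDr, qformZl, qformZr) !qform_delta c0 Cji /s.
have d0 : 0 < C j j + 1 by rewrite ltr_wpDl.
set c := C i j; set m := C j j in cj0 d0 *.
have -> : 0 + - (m + 1)^-1 * c * c + (- (m + 1)^-1 * c * c + - (m + 1)^-1 * c * (- (m + 1)^-1 * c * m)) =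
   - (c ^+ 2 * (m + 2) / (m + 1) ^+ 2) by field; rewrite gt_eqF.
rewrite oppr_ge0 => h; apply/eqP; rewrite -sqrf_eq0 eq_le sqr_ge0 andbT.
rewrite pmulr_lle0 ?invr_gt0 ?exprn_gt0 // in h.
have m2 : 0 < m + 2 by rewrite ltr_wpDl.
by rewrite pmulr_lle0 in h.
Qed.

(** Gaussian elimination: after [k] steps the first [k] rows of the remainder vanish. A zero pivot
    calls for no subtraction, its row being already zero by [psd_diag0]. *)
Lemma psd_outer_ex B : psd B -> exists bs, B = outer bs.
Proof.
move=> pB.
suff H k : (k <= n)%N -> exists bs, psd (B - outer bs) /\
    forall (i j : 'I_n), (i < k)%N -> (B - outer bs) i j = 0.
  have [bs [_ h]] := H n (leqnn n).
  exists bs; apply/eqP; rewrite -subr_eq0; apply/eqP/matrixP => i j.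
  by rewrite h // mxE.
elim: k => [_|k IH kn].
  by exists [::]; rewrite /outer big_nil subr0.
have [bs [pC h]] := IH (ltnW kn).
set C := B - outer bs in pC h *.
pose i0 := Ordinal kn.
have [c0|c0] := eqVneq (C i0 i0) 0.
  exists bs; split => // i j; rewrite ltnS leq_eqVlt => /orP[/eqP ik|]; last exact: h.
  have -> : i = i0 by exact: val_inj.
  exact: psd_diag0.
have cp : 0 < C i0 i0.
  by rewrite lt_neqAle eq_sym c0 -qform_delta pC.2.
pose b : 'cV[R]_n := (Num.sqrt (C i0 i0))^-1 *: (C *m delta_mx i0 ord0).
have bb : b *m b^T = (C i0 i0)^-1 *: (C *m delta_mx i0 ord0 *m (C *m delta_mx i0 ord0 : 'cV_n)^T).
  rewrite /b linearZ /= -scalemxAl -scalemxAr scalerA -expr2 exprVn sqr_sqrtr // ltW //.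
exists (b :: bs).
have -> : B - outer (b :: bs) = C - (C i0 i0)^-1 *: (C *m delta_mx i0 ord0 *m (C *m delta_mx i0 ord0 : 'cV_n)^T).
  by rewrite outer_cons -bb opprD addrCA addrC addrAC.
split; first exact: psd_sub_rank1.
clearbody C; move=> i j ik; rewrite !mxE big_ord1 -!colE !mxE.
move: ik; rewrite ltnS leq_eqVlt => /orP[/eqP ik|ik].
  have -> : i = i0 by exact: val_inj.
  have -> : C j i0 = C i0 j by rewrite -[in LHS]pC.1 mxE.
  by field.
by rewrite (h i j) // (h i i0) // mul0r mulr0 subrr.
Qed.

End RankOneDecomposition.

(** * Chernoff bounds for Gaussian quadratic forms *)

Section QuadraticConcentration.
Context {R : realType} {d : measure_display} {T : measurableType d} (P : probability T R).
Variables (n : nat) (xi : T -> 'cV[R]_n) (S : 'M[R]_n).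
Hypothesis pS : psd S.
Hypothesis gxi : centered_gaussian_vector P xi S.

Let mxi i : measurable_fun setT (fun w => xi w i ord0) := gxi.1 i.

(** The literal factors [1] are the weight and the constant with which the tilting induction
    starts. *)
Lemma gauss_cos a : \int[P]_w (1 * cos (dotv a (xi w))) = 1 * expR (- (qform S a a / 2)).
Proof.
have [+ _] := gxi.2 a; rewrite unlock /Rintegral => E.
under eq_integral do rewrite mul1r.
by rewrite /dotv E /= mul1r mulNr.
Qed.

Lemma gauss_exp a : (\int[P]_w (1 * expR (dotv a (xi w)))%:E = (1 * expR (qform S a a / 2))%:E)%E.
Proof.
under eq_integral do rewrite mul1r.
rewrite mul1r; apply: (mgf_of_cf P).
- exact: measurable_dotv.
- exact: pS.2.
- move=> z; have [+ _] := gxi.2 (z *: a); rewrite unlock => E.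
  under eq_integral do rewrite -dotvZl.
  rewrite /dotv E -/(qform S (z *: a) (z *: a)) qformZl qformZr mulNr.
  by congr (expR (- (_ / 2)))%:E; ring.
- move=> z; have [_] := gxi.2 (z *: a); rewrite unlock => E.
  by under eq_integral do rewrite -dotvZl; exact: E.
Qed.

Lemma measurable_qform (B : 'M[R]_n) : measurable_fun setT (fun w => qform B (xi w) (xi w)).
Proof.
under eq_fun do rewrite qformE dotvE.
apply: measurable_sum => j; apply: measurable_funM => //.
under eq_fun do rewrite mxE.
by apply: measurable_sum => i; apply: measurable_funM.
Qed.

Lemma qform_exp_up B k s : psd B -> 0 <= s -> 0 <= k -> k < 2^-1 ->
  (forall y, s * qform B (S *m y) (S *m y) <= k * qform S y y) ->
  (\int[P]_w (expR (s * qform B (xi w) (xi w) / 2))%:E <=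
     (expR (s * \tr (B *m S) / (1 - 2 * k) / 2))%:E)%E.
Proof.
move=> [sB pB] s0 k0 k2 hk.
have [bs bsE] : exists bs, s *: B = outer bs.
  apply: psd_outer_ex; split; first by rewrite linearZ /= sB.
  by move=> a; rewrite qform_scaleM mulr_ge0.
have hk' y : qform (s *: B) (S *m y) (S *m y) <= k * qform S y y by rewrite qform_scaleM.
have p0 : psd (0 : 'M[R]_n).
  by split; [rewrite trmx0|move=> a; rewrite /qform mulmx0 mul0mx mxE].
have := exp_tilt_list P n xi mxi S k (s *: B) pS k0 k2 hk' bs 0 (cst 1) 1 S.
rewrite -bsE add0r mulmx0 mul0mx addr0 mul1r -scalemxAl mxtraceZ => /(_ _ _ _ p0 erefl pS.1 erefl gauss_exp) H.
under eq_integral do rewrite -qform_scaleM -[expR _]mul1r.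
by apply: H => // w; rewrite ler01.
Qed.

Lemma qform_exp_low B k s : psd B -> 0 <= s -> 0 <= k ->
  (forall y, s * qform B (S *m y) (S *m y) <= k * qform S y y) ->
  (\int[P]_w (expR (- (s * qform B (xi w) (xi w) / 2)))%:E <=
     (expR (- (s * \tr (B *m S) / (1 + k) ^+ 2 / 2)))%:E)%E.
Proof.
move=> [sB pB] s0 k0 hk.
have [bs bsE] : exists bs, s *: B = outer bs.
  apply: psd_outer_ex; split; first by rewrite linearZ /= sB.
  by move=> a; rewrite qform_scaleM mulr_ge0.
have hk' y : qform (s *: B) (S *m y) (S *m y) <= k * qform S y y by rewrite qform_scaleM.
have p0 : psd (0 : 'M[R]_n).
  by split; [rewrite trmx0|move=> a; rewrite /qform mulmx0 mul0mx mxE].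
have := cos_tilt_list P n xi mxi S k (s *: B) pS k0 hk' bs 0 (cst 1) 1 S.
rewrite -bsE add0r mulmx0 mul0mx subr0 mul1r -scalemxAl mxtraceZ => /(_ _ _ _ p0 erefl pS.1 erefl gauss_cos) H.
have ie : P.-integrable setT (EFin \o (fun w => 1 * expR (- (qform (s *: B) (xi w) (xi w) / 2)))).
  apply: measurable_bounded_integrable => //.
  - exact: le_lt_trans (probability_le1 P measurableT) (ltry 1).
  - apply: measurable_funM => //; apply: measurableT_comp => //; apply: measurableT_comp => //.
    by apply: measurable_funM => //; exact: measurable_qform.
  - exists 1; split; [exact: num_real|move=> x x1 w _ /=].
    rewrite (le_trans _ (ltW x1)) // mul1r ger0_norm ?expR_ge0 // -[leRHS]expR0 ler_expR oppr_le0.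
    by rewrite divr_ge0 // qform_scaleM mulr_ge0.
under eq_integral do rewrite -qform_scaleM -[expR _]mul1r.
rewrite -[leLHS]fineK; last exact: integrable_fin_num ie.
by rewrite lee_fin; apply: H => // w; rewrite ler01 lexx.
Qed.

Lemma markov_ge (Y : T -> R) (c : R) : measurable_fun setT Y -> (forall w, 0 <= Y w) -> 0 <= c ->
  (c%:E * P [set w | (c <= Y w)%R] <= \int[P]_w (Y w)%:E)%E.
Proof.
move=> mY Y0 c0.
have mA : measurable [set w | c <= Y w].
  by rewrite -[X in measurable X]setTI; exact: measurable_fun_ler.
rewrite -integral_cst //.
apply: (@le_trans _ _ (\int[P]_(w in [set w | (c <= Y w)%R]) (Y w)%:E)%E).
  apply: ge0_le_integral => //.
  by apply/measurable_EFinP; exact: measurable_funTS.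
by apply: ge0_subset_integral => //; [apply/measurable_EFinP|move=> w _; rewrite lee_fin].
Qed.

Lemma chernoff (Q X : T -> R) (c u : R) : measurable_fun setT Q -> X = (fun w => expR (Q w)) ->
  (\int[P]_w (X w)%:E <= (expR u)%:E)%E ->
  (P [set w | (c <= Q w)%R] <= (expR (u - c))%:E)%E.
Proof.
move=> mQ -> H.
have mX : measurable_fun setT (fun w => expR (Q w)) by exact: measurableT_comp.
have := markov_ge _ _ mX (fun w => expR_ge0 _) (expR_ge0 c).
move=> /le_trans /(_ H).
have -> : [set w | expR c <= expR (Q w)] = [set w | c <= Q w].
  by apply/seteqP; split => w /=; rewrite ler_expR.
move=> H'.
have -> : (expR (u - c))%:E = ((expR (- c))%:E * (expR u)%:E)%E by rewrite -EFinM -expRD addrC.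
rewrite -[leLHS]mul1e -[in leLHS](_ : (expR (- c))%:E * (expR c)%:E = 1)%E; last first.
  by rewrite -EFinM -expRD addNr expR0.
by rewrite -muleA lee_wpmul2l // lee_fin expR_ge0.
Qed.

Lemma tr_psdM_ge0 (B : 'M[R]_n) : psd B -> 0 <= \tr (B *m S).
Proof.
by move=> /psd_outer_ex[bs ->]; rewrite tr_outerM sumr_ge0 // => b _; exact: pS.2.
Qed.

(** Chernoff with parameter [s = k / (be si)]. For [k <= 1/4] one has [1 / (1 - 2 k) <= 1 + 4 k] and
    [1 / (1 + k)^2 >= 1 - 2 k], so the bias of either exponential bound is at most
    [2 k s tr <= s e / 4]; of the ideal exponent [- s e / 2] each tail keeps [- s e / 4]. *)
Lemma qform_concentration B (k be si M e : R) : psd B -> 0 < be -> 0 < si -> 0 < k -> k <= 4^-1 ->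
  (forall x, qform B x x <= be * dotv x x) -> (forall x, qform S x x <= si * dotv x x) ->
  8 * k * \tr (B *m S) <= e ->
  (P [set w | (e <= `|qform B (xi w) (xi w) - \tr (B *m S)|)%R] <=
    (2 * expR (- (k * e / (4 * be * si))))%:E)%E.
Proof.
move=> pB be0 si0 k0 k4 hB hS htr.
pose s := k / (be * si).
have s0 : 0 < s by rewrite divr_gt0 // mulr_gt0.
have hk y : s * qform B (S *m y) (S *m y) <= k * qform S y y.
  have := qform_image_le S B be si y pS si0 (ltW be0) hB hS.
  move=> /(ler_wpM2l (ltW s0)) /le_trans; apply.
  by rewrite mulrA /s mulfVK // gt_eqF // mulr_gt0.
set tr := \tr (B *m S) in htr *.
have tr0 : 0 <= tr by exact: tr_psdM_ge0.
have k2 : k < 2^-1 by rewrite (le_lt_trans k4) // ltf_pV2 ?posrE // ltr_nat.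
have mq := measurable_qform B.
have U : (P [set w | (s * (tr + e) / 2 <= s * qform B (xi w) (xi w) / 2)%R] <=
   (expR (s * tr / (1 - 2 * k) / 2 - s * (tr + e) / 2))%:E)%E.
  apply: (chernoff (fun w => s * qform B (xi w) (xi w) / 2)); last 2 first.
  - by [].
  - by apply: qform_exp_up => //; exact: ltW.
  by apply: measurable_funM => //; exact: measurable_funM.
have Lw : (P [set w | (- (s * (tr - e) / 2) <= - (s * qform B (xi w) (xi w) / 2))%R] <=
   (expR (- (s * tr / (1 + k) ^+ 2 / 2) - - (s * (tr - e) / 2)))%:E)%E.
  apply: (chernoff (fun w => - (s * qform B (xi w) (xi w) / 2))); last 2 first.
  - by [].
  - by apply: qform_exp_low => //; exact: ltW.
  by apply: measurableT_comp => //; apply: measurable_funM => //; exact: measurable_funM.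
have -> : [set w | e <= `|qform B (xi w) (xi w) - tr|] =
   [set w | s * (tr + e) / 2 <= s * qform B (xi w) (xi w) / 2] `|`
   [set w | - (s * (tr - e) / 2) <= - (s * qform B (xi w) (xi w) / 2)].
  apply/seteqP; split => w /=.
    rewrite ler_normr => /orP[h|h]; [left|right]; last rewrite lerN2.
      by rewrite ler_pM2r // ler_pM2l // -lerBrDl.
    by rewrite ler_pM2r // ler_pM2l // lerBrDl -lerBrDr -opprB.
  rewrite lerN2 ler_normr => -[]; rewrite ler_pM2r // ler_pM2l // => h; apply/orP; [left|right].
    by rewrite lerBrDl.
  by rewrite opprB lerBrDl -lerBrDr.
have sn : (k * e / (4 * be * si)) = s * e / 4 by rewrite /s; field; rewrite !gt_eqF.
rewrite mulr_natl mulr2n EFinD.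
have mle (f g : T -> R) : measurable_fun setT f -> measurable_fun setT g -> measurable [set w | f w <= g w].
  by move=> mf mg; rewrite -[X in measurable X]setTI; exact: measurable_fun_ler.
apply: (le_trans (measureU2 _ _ _)).
- by apply: mle => //; apply: measurable_funM => //; exact: measurable_funM.
- by apply: mle => //; apply: measurableT_comp => //; apply: measurable_funM => //; exact: measurable_funM.
have st0 : 0 <= s * tr by rewrite mulr_ge0 // ltW.
have skt : 8 * k * (s * tr) <= s * e
  by rewrite (_ : 8 * k * (s * tr) = s * (8 * k * tr)) ?ler_wpM2l ?(ltW s0) //; ring.
rewrite sn; apply: leeD; [apply: (le_trans U)|apply: (le_trans Lw)]; rewrite lee_fin ler_expR.
  have k10 : 0 < 1 - 2 * k by lra.
  have : s * tr / (1 - 2 * k) <= s * tr * (1 + 4 * k).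
    by rewrite ler_pdivrMr // -[leRHS]mulrA ler_peMr //; nra.
  by rewrite mulrDr; nra.
have k10 : 0 < (1 + k) ^+ 2 by rewrite exprn_gt0 // addr_gt0.
have : s * tr * (1 - 2 * k) <= s * tr / (1 + k) ^+ 2.
  rewrite ler_pdivlMr // -[leLHS]mulrA ler_piMr //; nra.
by rewrite mulrBr; nra.
Qed.

End QuadraticConcentration.

(** * Borel-Cantelli and almost sure convergence *)

Section AlmostSure.
Context {R : realType} {d : measure_display} {T : measurableType d} (P : probability T R).

Lemma sum_inv_sqr_le (N : nat) : \sum_(k < N.+1) (k.+1%:R ^- 2 : R) <= 2 - N.+1%:R^-1.
Proof.
elim: N => [|N IH]; first by rewrite big_ord1 expr1n !invr1; lra.
rewrite big_ord_recr /= (le_trans (lerD IH (lexx _))) //.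
have n0 : 0 < (N.+1%:R : R) by rewrite ltr0n.
rewrite -(natr1 N.+1); set x := (N.+1%:R : R) in n0 *.
have x1 : 0 < x + 1 by rewrite addr_gt0.
rewrite -subr_ge0.
have -> : 2 - (x + 1)^-1 - (2 - x^-1 + (x + 1) ^- 2) = (x * (x + 1) ^+ 2)^-1.
  by field; rewrite !gt_eqF.
by rewrite invr_ge0 mulr_ge0 ?ltW // exprn_gt0.
Qed.

(** First Borel-Cantelli lemma, which asks nothing of the joint law over [n]. The sum runs over
    [F n.+1] because the bound starts at [n = 1]. *)
Lemma ae_eventually_notin (F : nat -> set T) (K : R) : (forall n, measurable (F n)) ->
  (forall n, (1 <= n)%N -> (P (F n) <= (K * n%:R ^- 2)%:E)%E) ->
  \forall w \ae P, \forall n \near \oo, ~ F n w.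
Proof.
move=> mF hF.
have K0 : 0 <= K.
  have := le_trans (measure_ge0 _ _) (hF 1%N (leqnn _)).
  by rewrite expr1n invr1 mulr1 lee_fin.
have S : (\sum_(n <oo) P (F n.+1) < +oo)%E.
  apply: (@le_lt_trans _ _ (K * 2)%:E); last exact: ltry.
  apply: lime_le; first by apply: is_cvg_nneseries.
  near=> N; rewrite big_mkord.
  apply: (@le_trans _ _ (\sum_(n < N) (K * n.+1%:R ^- 2)%:E)%E).
    by apply: lee_sum => n _; exact: hF.
  rewrite sumEFin lee_fin -mulr_sumr ler_wpM2l //.
  suff h m : \sum_(k < m) (k.+1%:R ^- 2 : R) <= 2 by exact: h.
  case: m => [|m]; first by rewrite big_ord0.
  by rewrite (le_trans (sum_inv_sqr_le m)) // gerBl invr_ge0.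
have L0 := lim_sup_set_cvg0 (fun n => mF n.+1) S.
exists (lim_sup_set (fun n => F n.+1)); split => //.
  by apply: bigcap_measurable => // k _; apply: bigcup_measurable.
move=> w /= nw N _.
apply: contrapT => h; apply: nw.
exists N.+1 => // n /= Nn Fnw; apply: h.
case: n Nn Fnw => // n Nn Fnw; by exists n.
Unshelve. all: by end_near. Qed.

(** [expR y >= y^(p+1) / (p+1)!], with [p] so large that [g (p + 1) >= 2]: this makes stretched
    exponentials summable. *)
Lemma exp_powR_le (c g : R) : 0 < c -> 0 < g -> exists K, forall n, (1 <= n)%N ->
  expR (- (c * n%:R `^ g)) <= K * (n%:R ^- 2 : R).
Proof.
move=> c0 g0.
have [p pg] : exists p : nat, 2 <= g * p.+1%:R.
  exists (Num.truncn (2 / g)); rewrite mulrC -ler_pdivrMr //.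
  by rewrite ltW // truncnS_gt.
exists (p.+1`!%:R / c ^+ p.+1) => n n1.
have n0 : 0 < (n%:R : R) by rewrite ltr0n.
have y0 : 0 <= c * n%:R `^ g by rewrite mulr_ge0 ?powR_ge0 // ltW.
have := expR_ge1Dxn p y0 => h.
have ngp : n%:R ^+ 2 <= (n%:R `^ g) ^+ p.+1.
  rewrite -[leRHS]powR_mulrn ?powR_ge0 // -powRrM -[leLHS]powR_mulrn ?ler0n //.
  by rewrite ler_powR // ler1n.
rewrite expRN -[leRHS]invrK lef_pV2 ?posrE ?expR_gt0 //; last first.
  by rewrite invr_gt0 !divr_gt0 ?mulr_gt0 ?exprn_gt0 ?ltr0n ?fact_gt0.
apply: le_trans h; rewrite ler_wpDl // exprMn.
rewrite !invfM !invrK [leLHS](_ : _ = c ^+ p.+1 * n%:R ^+ 2 / p.+1`!%:R); last by ring.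
by rewrite ler_wpM2r ?invr_ge0 ?ler0n // ler_wpM2l // exprn_ge0 // ltW.
Qed.

(** For a deviation [n / (m + 1)] the concentration exponent is at least a constant times
    [n^(1 - r)], hence summable for each [m]; countably many [m] then give convergence. *)
Lemma quadratic_form_ae_cvg (xi : forall n, T -> 'cV[R]_n) (S B : forall n, 'M[R]_n) (L M r : R) :
  0 < L -> 0 < M -> r < 1 ->
  (forall n, (1 <= n)%N -> [/\ psd (S n), psd (B n), centered_gaussian_vector P (xi n) (S n),
     \tr (B n *m S n) <= M * n%:R & exists be si, [/\ 0 < be, 0 < si, be * si <= L * n%:R `^ r,
      forall x, qform (B n) x x <= be * dotv x x & forall x, qform (S n) x x <= si * dotv x x]]) ->
  \forall w \ae P, (qform (B n) (xi n w) (xi n w) - \tr (B n *m S n)) / n%:R @[n --> \oo] --> (0 : R).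
Proof.
move=> L0 M0 r1 H.
(* Requiring [1 <= n] inside the event makes [F m 0] empty, hence measurable. *)
pose F m n := [set w | (1 <= n)%N /\ m.+1%:R^-1 * n%:R <= `|qform (B n) (xi n w) (xi n w) - \tr (B n *m S n)|].
have mF m n : measurable (F m n).
  case: n => [|n].
    by rewrite [F m 0%N](_ : _ = set0) //; apply/seteqP; split => // w [].
  have [pS pB G _ _] := H n.+1 isT.
  rewrite [F m _](_ : _ = [set w | m.+1%:R^-1 * n.+1%:R <= `|qform (B n.+1) (xi n.+1 w) (xi n.+1 w) - \tr (B n.+1 *m S n.+1)|]).
    rewrite -[X in measurable X]setTI; apply: measurable_fun_ler => //.
    apply: measurableT_comp => //; apply: measurable_funB => //.
    exact: (measurable_qform P _ _ _ G).
  by apply/seteqP; split => w /=; [case|].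
have ae m : \forall w \ae P, \forall n \near \oo, ~ F m n w.
  (* This [k] turns [tr <= M n] into the bias condition [8 k tr <= n / (m + 1)] of the concentration
     bound. *)
  pose k := Num.min 4^-1 (m.+1%:R^-1 / (8 * M)) : R.
  have k0 : 0 < k by rewrite lt_min !divr_gt0 ?mulr_gt0 ?invr_gt0 ?ltr0n.
  have k4 : k <= 4^-1 by rewrite ge_min lexx.
  have kM : 8 * k * M <= m.+1%:R^-1.
    rewrite mulrAC -ler_pdivlMl ?mulr_gt0 // mulrC.
    by rewrite ge_min lexx orbT.
  have c0 : 0 < k * m.+1%:R^-1 / (4 * L) by rewrite !(divr_gt0, mulr_gt0) ?invr_gt0 ?ltr0n.
  have g0 : 0 < 1 - r by rewrite subr_gt0.
  have [K hK] := exp_powR_le _ _ c0 g0.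
  apply: (ae_eventually_notin (F m) (2 * K)) => // n n1.
  have [pS pB G tM [be [si [be0 si0 bsL hB hS]]]] := H n n1.
  have n0 : 0 < (n%:R : R) by rewrite ltr0n.
  rewrite [F m n](_ : _ = [set w | m.+1%:R^-1 * n%:R <= `|qform (B n) (xi n w) (xi n w) - \tr (B n *m S n)|]); last first.
    by apply/seteqP; split => w /=; [case|].
  have htr : 8 * k * \tr (B n *m S n) <= m.+1%:R^-1 * n%:R.
    apply: (le_trans (ler_wpM2l _ tM)); first by rewrite mulr_ge0 // ltW.
    by rewrite mulrA ler_wpM2r // ltW.
  apply: (le_trans (qform_concentration P n (xi n) (S n) pS G (B n) k be si M _ pB be0 si0 k0 k4 hB hS htr)).
  rewrite lee_fin -[leRHS]mulrA ler_wpM2l // (le_trans _ (hK n n1)) // ler_expR lerN2.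
  rewrite -[4 * be * si]mulrA ler_pdivlMr ?mulr_gt0 //.
  have nr0 : 0 < n%:R `^ r :> R by rewrite powR_gt0.
  have -> : n%:R `^ (1 - r) = n%:R / n%:R `^ r :> R.
    by rewrite powRB ?powRr1 ?ltW //; apply/implyP => _; rewrite gt_eqF.
  rewrite [leRHS](_ : _ = (k * m.+1%:R^-1 / (4 * L) * (n%:R / n%:R `^ r)) * (4 * (L * n%:R `^ r))).
    rewrite ler_wpM2l //; first by rewrite mulr_ge0 ?(ltW c0) // divr_ge0 // ltW.
    by rewrite ler_wpM2l.
  by field; rewrite !gt_eqF.
have := ae_foralln ae.
apply: filterS => w hw.
apply/cvgr0Pnorm_lt => e e0.
have [m me] : exists m : nat, m.+1%:R^-1 < e.
  exists (Num.truncn e^-1); rewrite -[ltRHS]invrK ltf_pV2 ?posrE ?invr_gt0 ?ltr0n //.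
  exact: truncnS_gt.
near=> n.
have n1 : (1 <= n)%N by near: n; exact: nbhs_infty_ge.
have n0 : 0 < (n%:R : R) by rewrite ltr0n.
have : ~ F m n w by near: n; exact: hw.
rewrite /F /= => /not_andP[//|/negP]; rewrite -ltNge => h.
rewrite normrM normfV (gtr0_norm n0) ltr_pdivrMr // (lt_le_trans h) // ler_wpM2r // ltW //.
Unshelve. all: by end_near. Qed.

End AlmostSure.

(** * Toeplitz forms *)

Definition torus {R : realType} : set R := `[- pi, pi[%classic.
Definition tint {R : realType} (g : R -> R) : R := \int[lebesgue_measure]_(t in torus) g t.
Definition tintegrable {R : realType} (g : R -> R) : Prop :=
  lebesgue_measure.-integrable torus (EFin \o g).

Section TorusIntegral.
Context {R : realType}.
Notation mu := (@lebesgue_measure R).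
Implicit Types (f g h : R -> R) (c t : R).

Lemma measurable_torus : measurable (torus : set R).
Proof. exact: measurable_itv. Qed.
Hint Resolve measurable_torus : core.

Lemma measurable_torusD1 : measurable ((torus : set R) `\ 0).
Proof. by apply: measurableD => //; exact: measurable_set1. Qed.
Hint Resolve measurable_torusD1 : core.

Lemma torus_sub_D1 : (torus : set R) `\ 0 `<=` torus.
Proof. by move=> t []. Qed.

Lemma mu_torus : mu torus = (2 * pi : R)%:E.
Proof.
rewrite /torus lebesgue_measure_itv /= lte_fin gtrN ?pi_gt0 // -EFinD opprK.
by rewrite -mulr2n mulr_natl.
Qed.

Lemma tintegrable_measurable g : tintegrable g -> measurable_fun torus g.
Proof. by move=> ig; apply/measurable_EFinP; exact: measurable_int ig. Qed.

Lemma tintegrableD f g : tintegrable f -> tintegrable g -> tintegrable (fun t => f t + g t).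
Proof. by move=> hf hg; apply: (integrableD _ hf hg); exact: measurable_torus. Qed.

Lemma tintegrableZ c f : tintegrable f -> tintegrable (fun t => c * f t).
Proof. by move=> hf; apply: (integrableZl _ c hf); exact: measurable_torus. Qed.

Lemma tintegrableB f g : tintegrable f -> tintegrable g -> tintegrable (fun t => f t - g t).
Proof. by move=> hf hg; apply: (integrableB _ hf hg); exact: measurable_torus. Qed.

Lemma tintegrable_bounded h (M : R) : measurable_fun torus h -> (forall t, torus t -> `|h t| <= M) ->
  tintegrable h.
Proof.
move=> mh hM; apply: measurable_bounded_integrable => //.
  by rewrite /= mu_torus ltry.
exists M; split; [exact: num_real|move=> x Mx t Dt /=].
by rewrite (le_trans (hM _ Dt)) // ltW.
Qed.

Lemma tintegrable_cst c : tintegrable (fun=> c).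
Proof. by apply: (tintegrable_bounded _ `|c|). Qed.

(** At 0 the symbols and their inverses take conventional values, so comparisons of symbols are
    stated off 0; this discards that null set. *)
Lemma tint_setD1 g : measurable_fun torus g -> tint g = \int[mu]_(t in torus `\ 0) g t.
Proof.
move=> mg; rewrite /tint /Rintegral integral_setD1 //.
by apply/measurable_EFinP; apply: measurable_funS mg => //; exact: torus_sub_D1.
Qed.

Lemma tintegrable_setD1 g : tintegrable g -> mu.-integrable (torus `\ 0) (EFin \o g).
Proof. by move=> ig; apply: integrableS ig. Qed.

Lemma tintegrable_D1 g : measurable_fun torus g -> mu.-integrable (torus `\ 0) (EFin \o g) -> tintegrable g.
Proof.
move=> mg /integrableP[mg' ig]; apply/integrableP; split; first exact/measurable_EFinP.
rewrite -(@integral_setD1 _ _ 0) //.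
apply: measurableT_comp => //.
Qed.

Lemma tintegrable_le h g : measurable_fun torus h -> tintegrable g ->
  (forall t, torus t -> t != 0 -> `|h t| <= g t) -> tintegrable h.
Proof.
move=> mh ig hg; apply: tintegrable_D1 => //.
have ig' := tintegrable_setD1 _ ig.
apply: le_integrable ig' => //.
  by apply/measurable_EFinP; apply: measurable_funS mh => //; exact: torus_sub_D1.
move=> t [Dt t0] /=; rewrite lee_fin.
have := hg t Dt; move/eqP : t0 => t0 /(_ t0) h1.
by rewrite (ger0_norm (le_trans (normr_ge0 _) h1)).
Qed.

Lemma tintegrableMb g h (M : R) : tintegrable g -> measurable_fun torus h ->
  (forall t, torus t -> `|h t| <= M) -> tintegrable (fun t => g t * h t).
Proof.
move=> ig mh hM.
apply: (tintegrable_le _ (fun t => M * `|g t|)).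
- by apply: measurable_funM => //; exact: tintegrable_measurable.
- by apply: tintegrableZ; exact: integrable_abse ig.
- by move=> t Dt _; rewrite normrM mulrC ler_wpM2r // hM.
Qed.

Lemma le_tint f g : tintegrable f -> tintegrable g ->
  (forall t, torus t -> t != 0 -> f t <= g t) -> tint f <= tint g.
Proof.
move=> hf hg fg; rewrite !tint_setD1; [|exact: tintegrable_measurable..].
apply: le_Rintegral => //.
- exact: integrableS hf.
- exact: integrableS hg.
- by move=> t [Dt /eqP t0]; exact: fg.
Qed.

Lemma tintD f g : tintegrable f -> tintegrable g ->
  tint (fun t => f t + g t) = tint f + tint g.
Proof. by move=> hf hg; exact: RintegralD. Qed.

Lemma tintB f g : tintegrable f -> tintegrable g ->
  tint (fun t => f t - g t) = tint f - tint g.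
Proof. by move=> hf hg; exact: RintegralB. Qed.

Lemma tintZ c f : tintegrable f -> tint (fun t => c * f t) = c * tint f.
Proof. by move=> hf; exact: RintegralZl. Qed.

Lemma tint_cst c : tint (fun=> c) = c * (2 * pi).
Proof. by rewrite /tint Rintegral_cst //; congr (_ * _); rewrite [X in fine X]mu_torus. Qed.

Lemma tint_ge0 f : (forall t, torus t -> 0 <= f t) -> 0 <= tint f.
Proof. by move=> f0; apply: Rintegral_ge0 => t Dt; exact: f0. Qed.

Lemma tintegrable_sum {I : Type} (s : seq I) (F : I -> R -> R) : (forall i, tintegrable (F i)) ->
  tintegrable (fun t => \sum_(i <- s) F i t).
Proof.
move=> hF; elim: s => [|i s IH].
  by under eq_fun do rewrite big_nil; exact: tintegrable_cst.
by under eq_fun do rewrite big_cons; exact: tintegrableD.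
Qed.

Lemma tint_sum {I : Type} (s : seq I) (F : I -> R -> R) : (forall i, tintegrable (F i)) ->
  tint (fun t => \sum_(i <- s) F i t) = \sum_(i <- s) tint (F i).
Proof.
move=> hF; elim: s => [|i s IH].
  by rewrite big_nil; under eq_fun do rewrite big_nil; rewrite tint_cst mul0r.
rewrite big_cons; under eq_fun do rewrite big_cons.
by rewrite tintD ?IH //; exact: tintegrable_sum.
Qed.

Lemma measurable_torus_cont h : continuous h -> measurable_fun torus h.
Proof. by move=> ch; apply: measurable_funTS; exact: continuous_measurable_fun. Qed.

Lemma tint_cos (m : int) : tint (fun t => cos (m%:~R * t)) = if m == 0 then 2 * pi else 0.
Proof.
case: eqP => [->|/eqP m0].
  under eq_fun do rewrite mul0r cos0.
  by rewrite tint_cst mul1r.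
have mR0 : m%:~R != 0 :> R by rewrite intr_eq0.
pose H (t : R) : R := (m%:~R)^-1 * sin (m%:~R * t).
have dH t : is_derive t 1 H (cos (m%:~R * t)).
  by rewrite /H; apply: is_derive_eq; rewrite /GRing.scale /=; field; rewrite ?intr_eq0.
have cH : continuous H.
  by move=> z; apply/differentiable_continuous/derivable1_diffP; exact: ex_derive.
have cc : continuous (fun t : R => cos (m%:~R * t)).
  by move=> z; apply: continuous_comp; [exact: mulrl_continuous|exact: continuous_cos].
rewrite /tint /torus /Rintegral integral_itv_bndo_bndc; last first.
  by apply/measurable_EFinP; exact: measurable_torus_cont.
rewrite (@continuous_FTC2 _ _ H) //.
- have sinpi k : sin (k%:R * pi) = 0 :> R.
    elim: k => [|k IH]; first by rewrite mul0r sin0.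
    by rewrite -natr1 mulrDl mul1r sinDpi IH oppr0.
  have sinm : sin (m%:~R * pi) = 0 :> R.
    case: m {m0 mR0 H dH cH cc} => k; first exact: sinpi.
    by rewrite NegzE mulrNz mulNr sinN -[(k.+1)%:~R]/(k.+1%:R) sinpi oppr0.
  by rewrite /H mulrN sinN sinm oppr0 mulr0 /= subrr.
- by rewrite gtrN ?pi_gt0.
- exact: continuous_subspaceT.
- split.
  + by move=> z _; exact: ex_derive.
  + by apply: cvg_at_right_filter; exact: cH.
  + by apply: cvg_at_left_filter; exact: cH.
- by move=> z _; rewrite derive1E; exact: derive_val.
Qed.

End TorusIntegral.
#[export] Hint Resolve measurable_torus measurable_torusD1 : core.

(** * Toeplitz quadratic forms as integrals against the symbol *)

Section ToeplitzForms.
Context {R : realType} {n : nat}.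
Notation mu := (@lebesgue_measure R).
Implicit Types (f g h : R -> R) (c t : R) (x y : 'cV[R]_n).

(** [ctr x] and [str x] are the real and imaginary parts of [sum_j x_j e^(i j t)]. The product of
    the polynomial of [x] with the conjugate of that of [y] has real part [spec x y], against which
    a symbol is integrated in [qform_toeplitz]. *)
Definition ctr x t := \sum_j x j ord0 * cos (j%:R * t).
Definition str x t := \sum_j x j ord0 * sin (j%:R * t).
Definition spec x y t := ctr x t * ctr y t + str x t * str y t.

Lemma continuous_cosm c : continuous (fun t : R => cos (c * t)).
Proof. by move=> z; apply: continuous_comp; [exact: mulrl_continuous|exact: continuous_cos]. Qed.

Lemma specE x y t : spec x y t = \sum_j \sum_k (x j ord0 * y k ord0) * cos ((j%:Z - k%:Z)%:~R * t).
Proof.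
rewrite /spec /ctr /str !big_distrl /= -big_split /=; apply: eq_bigr => j _.
rewrite !big_distrr /= -big_split /=; apply: eq_bigr => k _.
by rewrite rmorphB /= mulrBl cosB -!pmulrn; ring.
Qed.

Lemma measurable_spec x y : measurable_fun torus (spec x y).
Proof.
rewrite (_ : spec x y = fun t => \sum_j \sum_k (x j ord0 * y k ord0) * cos ((j%:Z - k%:Z)%:~R * t)).
  apply: measurable_sum => j; apply: measurable_sum => k; apply: measurable_funM => //.
  exact: (measurable_torus_cont _ (continuous_cosm _)).
by apply/funext => t; exact: specE.
Qed.

Lemma spec_bounded x y : exists M, forall t, `|spec x y t| <= M.
Proof.
exists (\sum_j \sum_k `|x j ord0 * y k ord0|) => t; rewrite specE.
apply: (le_trans (ler_norm_sum _ _ _)); apply: ler_sum => j _.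
apply: (le_trans (ler_norm_sum _ _ _)); apply: ler_sum => k _.
by rewrite normrM ler_piMr // cos_max.
Qed.

Lemma tintegrable_spec g x y : tintegrable g -> tintegrable (fun t => g t * spec x y t).
Proof.
move=> ig; have [M hM] := spec_bounded x y.
by apply: (tintegrableMb _ _ M) => //; exact: measurable_spec.
Qed.

Lemma tintegrable_cosM g (m : int) : tintegrable g -> tintegrable (fun t => cos (m%:~R * t) * g t).
Proof.
move=> ig; under eq_fun do rewrite mulrC.
apply: (tintegrableMb _ _ 1) => //; last by move=> t _; exact: cos_max.
exact: (measurable_torus_cont _ (continuous_cosm _)).
Qed.

Lemma fourier_coefE g m : fourier_coef g m = (2 * pi)^-1 * tint (fun t => cos (m%:~R * t) * g t).
Proof. by []. Qed.

Lemma fourier_coefN g m : fourier_coef g (- m) = fourier_coef g m.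
Proof.
rewrite !fourier_coefE; congr (_ * _); apply: eq_Rintegral => t _.
by rewrite rmorphN /= mulNr cosN.
Qed.

Lemma qform_toeplitz g x y : tintegrable g ->
  qform (toeplitz n g) x y = (2 * pi)^-1 * tint (fun t => g t * spec x y t).
Proof.
move=> ig.
have -> : (fun t => g t * spec x y t) =
    fun t => \sum_j \sum_k (x j ord0 * y k ord0) * (cos ((j%:Z - k%:Z)%:~R * t) * g t).
  apply/funext => t; rewrite specE mulr_sumr; apply: eq_bigr => j _.
  by rewrite mulr_sumr; apply: eq_bigr => k _; ring.
rewrite tint_sum; last first.
  by move=> j; apply: tintegrable_sum => k; apply: tintegrableZ; exact: tintegrable_cosM.
rewrite qformE dotvE mulr_sumr; apply: eq_bigr => j _.
rewrite tint_sum; last by move=> k; apply: tintegrableZ; exact: tintegrable_cosM.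
rewrite mxE !mulr_sumr; apply: eq_bigr => k _.
by rewrite tintZ ?mxE ?fourier_coefE; [ring|exact: tintegrable_cosM].
Qed.

Lemma toeplitz_sym g : (toeplitz n g)^T = toeplitz n g.
Proof. by apply/matrixP => j k; rewrite !mxE -fourier_coefN opprB. Qed.

Lemma spec_ge0 x t : 0 <= spec x x t.
Proof. by rewrite /spec -!expr2 addr_ge0 // sqr_ge0. Qed.

Lemma inv2pi_gt0 : 0 < (2 * pi : R)^-1.
Proof. by rewrite invr_gt0 mulr_gt0 // pi_gt0. Qed.

Lemma le_qform_toeplitz f g x : tintegrable f -> tintegrable g ->
  (forall t, torus t -> t != 0 -> f t <= g t) -> qform (toeplitz n f) x x <= qform (toeplitz n g) x x.
Proof.
move=> hf hg fg; rewrite !qform_toeplitz // ler_pM2l ?inv2pi_gt0 //.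
apply: le_tint; [exact: tintegrable_spec..|move=> t Dt t0].
by rewrite ler_wpM2r ?spec_ge0 // fg.
Qed.

Lemma toeplitz_cst c : toeplitz n (fun=> c) = c%:M.
Proof.
apply/matrixP => j k; rewrite !mxE fourier_coefE.
have i1 : tintegrable (fun t : R => cos ((j%:Z - k%:Z)%:~R * t)).
  have := tintegrable_cosM (fun=> 1) (j%:Z - k%:Z) (tintegrable_cst 1).
  by under eq_fun do rewrite mulr1.
under eq_fun do rewrite mulrC.
rewrite tintZ // tint_cos subr_eq0 eqz_nat (inj_eq val_inj).
case: eqP => _; last by rewrite !mulr0 mulr0n.
by rewrite mulr1n mulrC mulfK // gt_eqF // mulr_gt0 // pi_gt0.
Qed.

Lemma qform_scalar c x y : qform (c%:M) x y = c * dotv x y.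
Proof. by rewrite qformE mul_scalar_mx dotvZr. Qed.

Lemma psd_toeplitz g : tintegrable g -> (forall t, torus t -> t != 0 -> 0 <= g t) -> psd (toeplitz n g).
Proof.
move=> ig g0; split; first exact: toeplitz_sym.
move=> x; have := le_qform_toeplitz (fun=> 0) g x (tintegrable_cst 0) ig g0.
by rewrite toeplitz_cst qform_scalar mul0r.
Qed.

(** Integrate [2 u v <= f v^2 + u^2 / f] for the real and imaginary parts of the two polynomials;
    [dotv] is the Toeplitz form of the symbol 1. At [y = T(f)^-1 x] this yields
    [T(f)^-1 <= T(1/f)]. *)
Lemma dotv_toeplitz_le f a x y : tintegrable f -> tintegrable a ->
  (forall t, torus t -> t != 0 -> 0 < f t /\ a t = (f t)^-1) ->
  2 * dotv x y <= qform (toeplitz n f) y y + qform (toeplitz n a) x x.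
Proof.
move=> hf ha fa.
have -> : dotv x y = qform (toeplitz n (fun=> 1)) x y by rewrite toeplitz_cst qform_scalar mul1r.
rewrite !qform_toeplitz //; last exact: tintegrable_cst.
rewrite -mulrDr mulrCA ler_pM2l ?inv2pi_gt0 //.
have i1 := tintegrable_spec _ x y (tintegrable_cst 1).
rewrite -tintZ // -tintD; [|exact: tintegrable_spec..].
apply: le_tint; [exact: tintegrableZ|by apply: tintegrableD; exact: tintegrable_spec|].
move=> t Dt t0; have [f0 ->] := fa t Dt t0.
rewrite mul1r /spec.
have am (u v : R) : 2 * (u * v) <= f t * (v * v) + (f t)^-1 * (u * u).
  have : 0 <= f t * (v - u / f t) ^+ 2 by rewrite mulr_ge0 ?sqr_ge0 // ltW.
  have -> : f t * (v - u / f t) ^+ 2 = f t * (v * v) + (f t)^-1 * (u * u) - 2 * (u * v).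
    by field; rewrite gt_eqF.
  by rewrite subr_ge0.
have := am (ctr x t) (ctr y t); have := am (str x t) (str y t).
lra.
Qed.

(** A kernel vector [y], paired with [s y] in [dotv_toeplitz_le], would satisfy
    [2 |y|^2 <= s <y, T(a) y>] for all [s > 0]. *)
Lemma toeplitz_unit f a : tintegrable f -> tintegrable a ->
  (forall t, torus t -> t != 0 -> 0 < f t /\ a t = (f t)^-1) -> toeplitz n f \in unitmx.
Proof.
move=> hf ha fa; rewrite unitmxE unitfE; apply/det0P => -[v v0 vT].
pose y := v^T.
have Ty : toeplitz n f *m y = 0.
  by apply: trmx_inj; rewrite trmx_mul toeplitz_sym /y trmxK vT trmx0.
have H (s : R) : 0 < s -> 2 * dotv y y <= s * qform (toeplitz n a) y y.
  move=> s0; have := dotv_toeplitz_le f a (s *: y) y hf ha fa.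
  rewrite (qformE (toeplitz n f)) Ty -(scale0r 0) dotvZr mul0r add0r dotvZl qformZl qformZr.
  by rewrite mulrCA ler_pM2l.
have y0 : dotv y y <= 0.
  rewrite leNgt; apply/negP => yy.
  set q := qform (toeplitz n a) y y in H.
  have q0 : 0 < q.
    by have := H 1 ltr01; rewrite mul1r; apply: lt_le_trans; rewrite mulr_gt0.
  have := H (dotv y y / q) (divr_gt0 yy q0); rewrite divfK ?gt_eqF //.
  by rewrite leNgt => /negP; apply; rewrite mulr_natl mulr2n ltrDl.
case/negP: v0; apply/eqP/matrixP => i j.
rewrite (ord1 i) [RHS]mxE; apply/eqP; rewrite -sqrf_eq0 eq_le sqr_ge0 andbT.
apply: le_trans y0; rewrite dotvE (bigD1 j) //= /y !mxE -expr2 lerDl sumr_ge0 // => k _.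
by rewrite -expr2 sqr_ge0.
Qed.

End ToeplitzForms.

(** * Variational bounds for inverse forms *)

Section InverseForms.
Context {R : realType} {n : nat}.
Implicit Types (A B : 'M[R]_n) (x y : 'cV[R]_n).

Lemma dotv_invmx A x : A \in unitmx -> dotv x (invmx A *m x) = qform (invmx A) x x.
Proof. by rewrite qformE. Qed.

Lemma qform_at_invmx A x : A \in unitmx ->
  qform A (invmx A *m x) (invmx A *m x) = qform (invmx A) x x.
Proof. by move=> uA; rewrite qformE mulmxA mulmxV // mul1mx dotvC -qformE. Qed.

(** The gap is the form of [A] at [A^-1 x - y]; the bound is attained at [y = A^-1 x]. *)
Lemma invmx_qform_ge A x y : psd A -> A \in unitmx ->
  2 * dotv x y - qform A y y <= qform (invmx A) x x.
Proof.
move=> [sA pA] uA; set z := invmx A *m x.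
have Az : A *m z = x by rewrite mulmxA mulmxV // mul1mx.
have zz : qform A z z = qform (invmx A) x x by exact: qform_at_invmx.
have yz : qform A y z = dotv x y by rewrite qformE Az dotvC.
have := pA (z - y); clearbody z.
rewrite !(qformDl, qformDr, qformNl, qformNr) (qformC A z y) // zz yz; lra.
Qed.

(** Order reversal from the variational bound for [A] at [y / c], where [y = B^-1 x]. *)
Lemma invmx_qform_anti A B x c : psd A -> A \in unitmx -> B \in unitmx -> 0 < c ->
  (forall y, qform A y y <= c * qform B y y) ->
  qform (invmx B) x x <= c * qform (invmx A) x x.
Proof.
move=> pA uA uB c0 AB; set y := invmx B *m x.
have yy : qform B y y = qform (invmx B) x x by exact: qform_at_invmx.
have xy : dotv x y = qform (invmx B) x x by exact: dotv_invmx.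
have := invmx_qform_ge A x (c^-1 *: y) pA uA.
rewrite qformZl qformZr dotvZr xy => h.
have := AB y; rewrite yy => h2.
have h3 : c^-1 * (c^-1 * qform A y y) <= c^-1 * qform (invmx B) x x.
  by rewrite ler_pM2l ?invr_gt0 // ler_pdivrMl.
rewrite -ler_pdivrMl //; lra.
Qed.

End InverseForms.

(** * Norms and traces of Toeplitz matrices *)

Section PowerIntegrals.
Context {R : realType}.
Notation mu := (@lebesgue_measure R).
Implicit Types (r e c t : R).

(* [pw r 0 = 0] for [r != 0], also when [r < 0]: bounds by [pw] are only required off [0]. *)
Definition pw r t : R := `|t| `^ r.

Lemma measurable_pw r : measurable_fun setT (pw r).
Proof. by apply: (measurableT_comp (measurable_powR r)); exact: normr_measurable. Qed.

Lemma pw_ge0 r t : 0 <= pw r t. Proof. exact: powR_ge0. Qed.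

Lemma pw_gt0 r t : t != 0 -> 0 < pw r t.
Proof. by move=> t0; rewrite powR_gt0 // normr_gt0. Qed.

Lemma pwD r e t : t != 0 -> pw (r + e) t = pw r t * pw e t.
Proof. by move=> t0; rewrite /pw powRD // normr_eq0 t0 implybT. Qed.

Lemma pwN r t : pw r (- t) = pw r t. Proof. by rewrite /pw normrN. Qed.

Lemma integral_powR_itv r e c : 0 < e -> e < c -> 0 < r + 1 ->
  (\int[mu]_(t in `[e, c]) (pw r t)%:E <= (c `^ (r + 1) / (r + 1))%:E)%E.
Proof.
move=> e0 ec r1.
have cF t : 0 < t -> is_derive t 1 (fun t => (r + 1)^-1 * t `^ (r + 1)) (t `^ r).
  move=> t0; have := is_derive1_powR (r + 1) t0 => ?; apply: is_derive_eq.
  by rewrite /GRing.scale /= addrK mulrA mulVf ?mul1r // gt_eqF.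
have cf t : 0 < t -> {for t, continuous (fun t : R => t `^ r)}.
  move=> t0; have ? := is_derive1_powR r t0.
  by apply/differentiable_continuous/derivable1_diffP; exact: ex_derive.
have cF' t : 0 < t -> {for t, continuous (fun t => (r + 1)^-1 * t `^ (r + 1))}.
  move=> t0; have ? := cF t t0.
  by apply/differentiable_continuous/derivable1_diffP; exact: ex_derive.
have -> : (\int[mu]_(t in `[e, c]) (pw r t)%:E = \int[mu]_(t in `[e, c]) (t `^ r)%:E)%E.
  apply: eq_integral => t; rewrite inE /= in_itv /= => /andP[et _].
  by rewrite /pw ger0_norm // (le_trans (ltW e0)).
rewrite (@continuous_FTC2 _ _ (fun t => (r + 1)^-1 * t `^ (r + 1))) //.
- rewrite -EFinB lee_fin mulrC gerBl mulr_ge0 ?powR_ge0 // invr_ge0 ltW //.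
- apply: continuous_in_subspaceT => t; rewrite inE /= in_itv /= => /andP[et _].
  by apply: cf; exact: lt_le_trans et.
- split.
  + move=> t; rewrite in_itv /= => /andP[et _].
    by have ? := cF t (lt_trans e0 et); exact: ex_derive.
  + by apply: cvg_at_right_filter; exact: cF'.
  + by apply: cvg_at_left_filter; apply: cF'; exact: lt_trans ec.
- move=> t; rewrite in_itv /= => /andP[et _].
  by have ? := cF t (lt_trans e0 et); rewrite derive1E; exact: derive_val.
Qed.

Lemma integral_pw_itvN r e c : 0 < e -> e < c -> 0 < r + 1 ->
  (\int[mu]_(t in `[(- c)%R, (- e)%R]) (pw r t)%:E = \int[mu]_(t in `[e, c]) (pw r t)%:E)%E.
Proof.
move=> e0 ec r1.
rewrite (@integration_by_substitution_oppr R (pw r) e c (ltW ec)).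
  by apply: eq_integral => t _; rewrite /= pwN.
apply: continuous_in_subspaceT => t; rewrite inE /= in_itv /= => /andP[_ te].
have t0 : 0 < `|t| by rewrite normr_gt0 lt_eqF // (le_lt_trans te) // oppr_lt0.
apply: (@continuous_comp _ _ _ (fun t : R => `|t|) (fun t : R => t `^ r)); first exact: norm_continuous.
have ? := is_derive1_powR r t0.
by apply/differentiable_continuous/derivable1_diffP; exact: ex_derive.
Qed.

Lemma integral_pw_near0 r c : -1 < r -> 0 < c ->
  (\int[mu]_(t in `[(- c)%R, c] `\ 0%R) (pw r t)%:E <= (2 * (c `^ (r + 1) / (r + 1)))%:E)%E.
Proof.
move=> r1 c0.
have r10 : 0 < r + 1 by rewrite -ltrBlDr sub0r.
(* Denominators start at 2 so that already [e 0 < c]; the sets [F k] then exhaust the punctured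
   interval. *)
pose e k : R := c / k.+2%:R.
have e0 k : 0 < e k by rewrite divr_gt0.
have ec k : e k < c by rewrite ltr_pdivrMr // ltr_pMr // ltr1n.
pose F k : set R := `[- c, - e k] `|` `[e k, c].
have mF k : measurable (F k) by apply: measurableU; exact: measurable_itv.
have UF : \bigcup_k F k = `[- c, c] `\ (0 : R).
  apply/seteqP; split => t.
    move=> [k _]; rewrite /F /= !in_itv /= => -[/andP[h1 h2]|/andP[h1 h2]]; split.
    - by rewrite h1 (le_trans h2) // (le_trans _ (ltW c0)) // oppr_le0 ltW.
    - by move=> /= t0; move: h2; rewrite t0 oppr_ge0 leNgt e0.
    - by rewrite h2 andbT (le_trans _ h1) // (le_trans (y := 0)) ?oppr_le0 ?ltW.
    - by move=> /= t0; move: h1; rewrite t0 leNgt e0.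
  move=> [] /=; rewrite in_itv /= => /andP[h1 h2] /eqP t0.
  have [k hk] : exists k, e k <= `|t|.
    exists (Num.truncn (c / `|t|)).
    rewrite /e ler_pdivrMr // -ler_pdivrMl ?normr_gt0 // mulrC.
    rewrite (le_trans (ltW (truncnS_gt _))) // ler_nat //.
  exists k => //; rewrite /F /= !in_itv /=.
  case: (ltrgt0P t) hk => t1 hk; last by rewrite t1 eqxx in t0.
    by right; rewrite hk h2.
  by left; rewrite h1 lerNr hk.
have nF : nondecreasing_seq F.
  move=> k l kl; apply/subsetPset => t; rewrite /F /= !in_itv /=.
  have le : e l <= e k by rewrite /e ler_pM2l // lef_pV2 ?posrE // ler_nat !ltnS.
  move=> [/andP[h1 h2]|/andP[h1 h2]]; [left|right].
    by rewrite h1 (le_trans h2) // lerN2.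
  by rewrite h2 (le_trans le).
have mpw (A : set R) : measurable_fun A (EFin \o pw r).
  by apply/measurable_EFinP; apply: measurable_funTS; exact: measurable_pw.
have := ge0_nondecreasing_set_cvg_integral (mu := mu) nF mF (fun k => mpw (F k))
  (fun k t _ => lee_tofin (pw_ge0 r t)).
rewrite UF => cv.
rewrite -(cvg_lim _ cv) //; apply: lime_le; first by apply/cvg_ex; exists (\int[mu]_(x in `[(- c)%R, c] `\ 0%R) (EFin \o pw r) x)%E.
near=> k; rewrite /F ge0_integral_setU //.
- have h := integral_powR_itv r (e k) c (e0 k) (ec k) r10.
  rewrite [X in (X + _)%E]integral_pw_itvN // mulr_natl mulr2n EFinD.
  exact: leeD.
- exact: mpw.
- by move=> t _ /=; rewrite lee_fin pw_ge0.
- rewrite disj_set2E; apply/eqP/seteqP; split => // t [] /=; rewrite !in_itv /= => /andP[_ h1] /andP[h2 _].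
  have := le_trans h2 h1; rewrite leNgt => /negP; apply.
  by rewrite (lt_trans _ (e0 k)) // oppr_lt0.
Unshelve. all: by end_near. Qed.

Lemma tintegrable_pw r : -1 < r -> tintegrable (pw r).
Proof.
move=> r1; have mp (A : set R) : measurable_fun A (pw r) by apply: measurable_funTS; exact: measurable_pw.
apply: tintegrable_D1 => //; apply/integrableP; split; first by apply/measurable_EFinP; exact: mp.
apply: le_lt_trans (ltry (2 * (pi `^ (r + 1) / (r + 1)))).
apply: le_trans (integral_pw_near0 r pi r1 (pi_gt0 R)).
under eq_integral do rewrite gee0_abs ?lee_fin ?pw_ge0 //.
apply: ge0_subset_integral => //.
- by apply: measurableD; [exact: measurable_itv|exact: measurable_set1].
- by apply: measurableD; [exact: measurable_itv|exact: measurable_set1].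
- by apply/measurable_EFinP; exact: mp.
- by move=> t _; rewrite lee_fin pw_ge0.
- move=> t [] /=; rewrite /torus /= !in_itv /= => /andP[h1 h2] h3; split => //.
  by rewrite h1 ltW.
Qed.

(** The part of a power majorant left over by polynomial approximation, confined to [|t| < c]; for
    [-1 < r] its integral is [O(c^(r + 1))]. *)
Definition pw_near r c t : R := if `|t| < c then pw r t else 0.

Lemma measurable_pw_near r c : measurable_fun setT (pw_near r c).
Proof.
apply: measurable_fun_ifT => //; last exact: measurable_pw.
by apply: measurable_fun_ltr => //; exact: normr_measurable.
Qed.

Lemma pw_near_ge0 r c t : 0 <= pw_near r c t.
Proof. by rewrite /pw_near; case: ifP => // _; exact: pw_ge0. Qed.

Lemma tintegrable_pw_near r c : -1 < r -> tintegrable (pw_near r c).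
Proof.
move=> r1; apply: (tintegrable_le _ (pw r)).
- by apply: measurable_funTS; exact: measurable_pw_near.
- exact: tintegrable_pw.
- move=> t _ _; rewrite ger0_norm ?pw_near_ge0 // /pw_near; case: ifP => // _; exact: pw_ge0.
Qed.

Lemma tint_pw_near r c : -1 < r -> 0 < c -> tint (pw_near r c) <= 2 * (c `^ (r + 1) / (r + 1)).
Proof.
move=> r1 c0.
have mn (A : set R) : measurable_fun A (pw_near r c) by apply: measurable_funTS; exact: measurable_pw_near.
rewrite tint_setD1 //.
have ii := tintegrable_pw_near r c r1.
have i' := tintegrable_setD1 _ ii.
have fi : (\int[mu]_(t in torus `\ 0%R) (pw_near r c t)%:E)%E \is a fin_num.
  apply: integrable_fin_num.
  exact: measurable_torusD1.
  exact: i'.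
rewrite /Rintegral -lee_fin fineK //.
apply: le_trans (integral_pw_near0 r c r1 c0).
pose P : set R := [set t | `|t| < c].
have mP : measurable P.
  rewrite (_ : P = `]- c, c[%classic); first exact: measurable_itv.
  by apply/seteqP; split => t; rewrite /P /= in_itv /= ltr_norml.
rewrite (_ : (\int[mu]_(t in torus `\ 0%R) (pw_near r c t)%:E)%E = (\int[mu]_(t in (torus `\ 0%R) `&` P) (pw r t)%:E)%E).
  apply: ge0_subset_integral => //.
  - by apply: measurableI; [exact: measurable_torusD1|exact: mP].
  - by apply: measurableD; [exact: measurable_itv|exact: measurable_set1].
  - by apply/measurable_EFinP; apply: measurable_funTS; exact: measurable_pw.
  - by move=> t _; rewrite lee_fin pw_ge0.
  - move=> t [[_ h3]]; rewrite /P /= in_itv /= => h; split => //.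
    by rewrite -ler_norml ltW.
rewrite [RHS]integral_mkcondr; apply: eq_integral => t _.
rewrite patchE /pw_near; case: ifPn => h; first by rewrite mem_set.
by rewrite memNset // /P /=; apply/negP.
Qed.

End PowerIntegrals.

(** * Operator norm of Toeplitz matrices with a power singularity *)

Section ToeplitzNorm.
Context {R : realType}.
Implicit Types (a b g h : R -> R).

Lemma dotvNr {n} (x y : 'cV[R]_n) : dotv x (- y) = - dotv x y.
Proof. by rewrite dotvC dotvNl dotvC. Qed.

Lemma dotv_CS {n} (x y : 'cV[R]_n) : dotv x y ^+ 2 <= dotv x x * dotv y y.
Proof.
have [y0|y0] := eqVneq (dotv y y) 0.
  have yz j : y j ord0 = 0.
    apply/eqP; rewrite -sqrf_eq0 eq_le sqr_ge0 andbT -y0 dotvE (bigD1 j) //= -expr2 lerDl.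
    by rewrite sumr_ge0 // => k _; rewrite -expr2 sqr_ge0.
  by rewrite y0 mulr0 dotvE big1 ?expr0n // => j _; rewrite yz mulr0.
have yp : 0 < dotv y y by rewrite lt_neqAle eq_sym y0 dotv_ge0.
have := dotv_ge0 (x - (dotv x y / dotv y y) *: y).
rewrite !(dotvDl, dotvDr, dotvNl, dotvNr, dotvZl, dotvZr) (dotvC y x).
set s := dotv x y; set q := dotv y y in y0 yp *; set p := dotv x x.
have -> : p - s / q * s + (- (s / q * s) - s / q * - (s / q * q)) = (p * q - s ^+ 2) / q.
  by field; rewrite gt_eqF.
by rewrite pmulr_lge0 ?invr_gt0 // subr_ge0.
Qed.

(** Cauchy-Schwarz against the vectors of cosines and sines, whose squared norms add up to [n]. *)
Lemma spec_le {n} (x : 'cV[R]_n) t : spec x x t <= n%:R * dotv x x.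
Proof.
pose cv : 'cV[R]_n := \col_j cos (j%:R * t); pose sv : 'cV[R]_n := \col_j sin (j%:R * t).
have -> : spec x x t = dotv x cv ^+ 2 + dotv x sv ^+ 2.
  rewrite /spec -!expr2 /ctr /str !dotvE; congr (_ ^+ 2 + _ ^+ 2);
    by apply: eq_bigr => j _; rewrite mxE.
apply: (le_trans (lerD (dotv_CS _ _) (dotv_CS _ _))).
rewrite -mulrDr mulrC ler_wpM2r ?dotv_ge0 //.
rewrite !dotvE -big_split /= (eq_bigr (fun=> 1)).
  by rewrite sumr_const card_ord.
by move=> j _; rewrite !mxE -!expr2 cos2Dsin2.
Qed.

(* Split at [`|t| = n^-1]: below it use [spec x x <= n |x|^2], above it [a <= C n^al]. *)
Lemma qform_toeplitz_powR a (C al : R) : 0 <= al -> al < 1 -> 0 <= C -> tintegrable a ->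
  (forall t, torus t -> t != 0 -> a t <= C * pw (- al) t) ->
  exists K, 0 < K /\ forall n (x : 'cV[R]_n), (1 <= n)%N ->
    qform (toeplitz n a) x x <= K * n%:R `^ al * dotv x x.
Proof.
move=> al0 al1 C0 ia ha.
have r1 : -1 < - al by rewrite ltrN2.
pose K0 := C / (2 * pi) * (2 / (1 - al)) + C.
have K00 : 0 <= K0.
  by rewrite addr_ge0 // mulr_ge0 // divr_ge0 // ?mulr_ge0 ?pi_ge0 // subr_ge0 ltW.
exists (K0 + 1); split; first by rewrite ltr_wpDl.
move=> n x n1; rewrite qform_toeplitz //.
have n0 : 0 < (n%:R : R) by rewrite ltr0n.
have ipn := tintegrable_pw_near (- al) n%:R^-1 r1.
have i1 := tintegrable_spec _ x x (tintegrable_cst 1).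
have na0 : 0 <= n%:R `^ al :> R by exact: powR_ge0.
have xx := dotv_ge0 x.
apply: (@le_trans _ _ ((2 * pi)^-1 * tint (fun t => (C * n%:R * dotv x x) * pw_near (- al) n%:R^-1 t +
    (C * n%:R `^ al) * (1 * spec x x t)))).
  rewrite ler_pM2l ?inv2pi_gt0 //; apply: le_tint.
  - exact: tintegrable_spec.
  - by apply: tintegrableD; exact: tintegrableZ.
  move=> t Dt t0; rewrite mul1r.
  apply: (le_trans (ler_wpM2r (spec_ge0 _ _) (ha t Dt t0))).
  rewrite /pw_near; case: ifPn => h.
    rewrite -[leLHS]addr0 lerD //; last by rewrite !mulr_ge0 // spec_ge0.
    rewrite -!mulrA ler_wpM2l // mulrC [leRHS]mulrA ler_wpM2r ?pw_ge0 //.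
    exact: spec_le.
  rewrite mulr0 add0r ler_wpM2r ?spec_ge0 // ler_wpM2l //.
  rewrite -leNgt in h.
  have nt : (n%:R^-1) `^ al <= `|t| `^ al by rewrite ge0_ler_powR // nnegrE invr_ge0 ltW.
  have nn : (n%:R^-1) `^ al * n%:R `^ al = 1 :> R.
    by rewrite -powRM ?invr_ge0 ?(ltW n0) // mulVf ?powR1 // gt_eqF.
  have t1 : 0 < `|t| `^ al by rewrite powR_gt0 // normr_gt0.
  rewrite /pw powRN -[leLHS]mul1r ler_pdivrMr //.
  apply: (@le_trans _ _ (n%:R^-1 `^ al * n%:R `^ al)); first by rewrite nn.
  by rewrite mulrC ler_wpM2l.
rewrite tintD; [|exact: tintegrableZ..].
rewrite !tintZ //.
have -> : tint (spec x x) = 2 * pi * dotv x x.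
  have := qform_toeplitz (fun=> 1) x x (tintegrable_cst 1).
  under [in X in tint X]eq_fun do rewrite mul1r.
  by rewrite toeplitz_cst qform_scalar mul1r => ->; rewrite mulrA mulfV ?mul1r // gt_eqF // mulr_gt0 // pi_gt0.
have nal : n%:R^-1 `^ (- al + 1) = n%:R^-1 * n%:R `^ al :> R.
  rewrite -powR_inv1 ?(ltW n0) // -powRrM -powRD; last by apply/implyP => _; rewrite gt_eqF.
  by congr (_ `^ _); ring.
have := tint_pw_near (- al) n%:R^-1 r1; rewrite invr_gt0 => /(_ n0); rewrite nal => h.
have p0 : 0 < 2 * pi :> R by rewrite mulr_gt0 // pi_gt0.
have Cn0 : 0 <= C * n%:R * dotv x x by rewrite !mulr_ge0.
apply: (@le_trans _ _ ((2 * pi)^-1 * (C * n%:R * dotv x x * (2 * (n%:R^-1 * n%:R `^ al / (- al + 1))) +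
    C * n%:R `^ al * (2 * pi * dotv x x)))).
  by rewrite mul1r ler_pM2l ?inv2pi_gt0 // lerD2r ler_wpM2l.
have al10 : 0 < 1 - al by rewrite subr_gt0.
rewrite [leLHS](_ : _ = K0 * n%:R `^ al * dotv x x).
  by rewrite ler_wpM2r // ler_wpM2r // lerDl.
have pn0 : pi != 0 :> R by rewrite gt_eqF ?pi_gt0.
have an0 : 1 - al != 0 by rewrite gt_eqF.
have nn0 : n%:R != 0 :> R by rewrite gt_eqF.
rewrite /K0 (addrC (- al)); move: (pi : R) pn0 => q qn0; field.
  by rewrite qn0 an0 nn0.
by rewrite (_ : spec x x = fun t => 1 * spec x x t) //; apply/funext => t; rewrite mul1r.
Qed.

End ToeplitzNorm.

(** * Traces of products of two Toeplitz matrices *)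

Section ToeplitzTrace.
Context {R : realType}.
Implicit Types (a b g h : R -> R).

Lemma tr_toeplitzM n a b : \tr (toeplitz n a *m toeplitz n b) =
  \sum_(j < n) \sum_(k < n) fourier_coef a (j%:Z - k%:Z) * fourier_coef b (j%:Z - k%:Z).
Proof.
rewrite /mxtrace; apply: eq_bigr => j _; rewrite mxE; apply: eq_bigr => k _.
by rewrite !mxE -(fourier_coefN b) opprB.
Qed.

(** The trigonometric polynomial against which [a] is integrated to produce the trace of
    [T(a) T(b)]. *)
Definition trig_trace n b t : R :=
  \sum_(j < n) \sum_(k < n) fourier_coef b (j%:Z - k%:Z) * cos ((j%:Z - k%:Z)%:~R * t).

Definition trig_kernel n x t : R :=
  \sum_(j < n) \sum_(k < n) cos ((j%:Z - k%:Z)%:~R * x) * cos ((j%:Z - k%:Z)%:~R * t).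

(** By product-to-sum the kernel is the mean of the values of [|sum_j e^(i j s)|^2] at [s = x + t]
    and [s = x - t]. *)
Lemma trig_kernel_ge0 n x t : 0 <= trig_kernel n x t.
Proof.
pose e : 'cV[R]_n := const_mx 1.
suff -> : trig_kernel n x t = 2^-1 * (spec e e (x + t) + spec e e (x - t)).
  by rewrite mulr_ge0 // addr_ge0 // spec_ge0.
rewrite !specE -big_split mulr_sumr; apply: eq_bigr => j _.
rewrite -big_split mulr_sumr; apply: eq_bigr => k _.
by rewrite /e !mxE (mulrDr _ x t) (mulrBr _ x t) cosD cosB /=; field.
Qed.

Lemma measurable_trig_trace n b : measurable_fun torus (trig_trace n b).
Proof.
apply: measurable_sum => j; apply: measurable_sum => k; apply: measurable_funM => //.
exact: (measurable_torus_cont _ (continuous_cosm _)).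
Qed.

Lemma trig_trace_bounded n b : exists M, forall t, `|trig_trace n b t| <= M.
Proof.
exists (\sum_(j < n) \sum_(k < n) `|fourier_coef b (j%:Z - k%:Z)|) => t.
apply: (le_trans (ler_norm_sum _ _ _)); apply: ler_sum => j _.
apply: (le_trans (ler_norm_sum _ _ _)); apply: ler_sum => k _.
by rewrite normrM ler_piMr // cos_max.
Qed.

Lemma tintegrable_trig_trace n a b : tintegrable a -> tintegrable (fun t => a t * trig_trace n b t).
Proof.
move=> ia; have [M hM] := trig_trace_bounded n b.
by apply: (tintegrableMb _ _ M) => //; exact: measurable_trig_trace.
Qed.

Lemma tr_toeplitz_tint n a b : tintegrable a ->
  \tr (toeplitz n a *m toeplitz n b) = (2 * pi)^-1 * tint (fun t => a t * trig_trace n b t).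
Proof.
move=> ia.
have -> : (fun t => a t * trig_trace n b t) = fun t => \sum_(j < n) \sum_(k < n)
    fourier_coef b (j%:Z - k%:Z) * (cos ((j%:Z - k%:Z)%:~R * t) * a t).
  apply/funext => t; rewrite mulr_sumr; apply: eq_bigr => j _.
  by rewrite mulr_sumr; apply: eq_bigr => k _; ring.
rewrite tr_toeplitzM tint_sum; last first.
  by move=> j; apply: tintegrable_sum => k; apply: tintegrableZ; exact: tintegrable_cosM.
rewrite mulr_sumr; apply: eq_bigr => j _; rewrite tint_sum; last first.
  by move=> k; apply: tintegrableZ; exact: tintegrable_cosM.
rewrite mulr_sumr; apply: eq_bigr => k _; rewrite tintZ; last exact: tintegrable_cosM.
by rewrite !fourier_coefE mulrC mulrCA.
Qed.

Lemma tintegrable_kernel n b x : tintegrable b -> tintegrable (fun t => b t * trig_kernel n x t).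
Proof.
move=> ib; apply: (tintegrableMb _ _ (\sum_(j < n) \sum_(k < n) 1)) => //.
  apply: measurable_sum => j; apply: measurable_sum => k; apply: measurable_funM => //.
  exact: (measurable_torus_cont _ (continuous_cosm _)).
move=> t _; apply: (le_trans (ler_norm_sum _ _ _)); apply: ler_sum => j _.
apply: (le_trans (ler_norm_sum _ _ _)); apply: ler_sum => k _.
by rewrite normrM mulr_ile1 // cos_max.
Qed.

Lemma trig_traceE n b x : tintegrable b ->
  trig_trace n b x = (2 * pi)^-1 * tint (fun t => b t * trig_kernel n x t).
Proof.
move=> ib.
have -> : (fun t => b t * trig_kernel n x t) = fun t => \sum_(j < n) \sum_(k < n)
    cos ((j%:Z - k%:Z)%:~R * x) * (cos ((j%:Z - k%:Z)%:~R * t) * b t).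
  apply/funext => t; rewrite mulr_sumr; apply: eq_bigr => j _.
  by rewrite mulr_sumr; apply: eq_bigr => k _; ring.
rewrite tint_sum; last first.
  by move=> j; apply: tintegrable_sum => k; apply: tintegrableZ; exact: tintegrable_cosM.
rewrite mulr_sumr; apply: eq_bigr => j _; rewrite tint_sum; last first.
  by move=> k; apply: tintegrableZ; exact: tintegrable_cosM.
rewrite mulr_sumr; apply: eq_bigr => k _; rewrite tintZ; last exact: tintegrable_cosM.
by rewrite !fourier_coefE mulrC mulrCA.
Qed.

Lemma tr_toeplitz n h : \tr (toeplitz n h) = n%:R * fourier_coef h 0.
Proof.
rewrite /mxtrace (eq_bigr (fun=> fourier_coef h 0)).
  by rewrite sumr_const card_ord mulr_natl.
by move=> j _; rewrite mxE subrr.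
Qed.

(* The trace is a double integral of [a x * b t] against the nonnegative [trig_kernel]. *)
Lemma tr_toeplitz_le n a b h : tintegrable a -> tintegrable b -> tintegrable h ->
  (forall x t, torus x -> x != 0 -> torus t -> t != 0 -> a x * b t <= h x + h t) ->
  \tr (toeplitz n a *m toeplitz n b) <= 2 * n%:R * fourier_coef h 0.
Proof.
move=> ia ib ih H.
have i1 : tintegrable (fun=> 1 : R) by exact: tintegrable_cst.
(* The majorant [h x + h t] corresponds to the pairs of symbols [(h, 1)] and [(1, h)]; since [T(1)]
   is the identity, each trace is [n] times the mean of [h]. *)
apply: (@le_trans _ _ (\tr (toeplitz n h *m toeplitz n (fun=> 1)) + \tr (toeplitz n (fun=> 1) *m toeplitz n h))).
  rewrite !tr_toeplitz_tint // -mulrDr -tintD; [|exact: tintegrable_trig_trace..].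
  rewrite ler_pM2l ?inv2pi_gt0 //; apply: le_tint.
  - exact: tintegrable_trig_trace.
  - by apply: tintegrableD; exact: tintegrable_trig_trace.
  move=> x Dx x0; rewrite mul1r !trig_traceE //.
  rewrite !(mulrCA _ (2 * pi)^-1) -mulrDr ler_pM2l ?inv2pi_gt0 //.
  rewrite -!tintZ -?tintD; do ?[by apply: tintegrableZ; exact: tintegrable_kernel | exact: tintegrable_kernel].
  apply: le_tint.
  - by apply: tintegrableZ; exact: tintegrable_kernel.
  - by apply: tintegrableD; [apply: tintegrableZ|]; exact: tintegrable_kernel.
  move=> t Dt t0; rewrite mul1r mulrA -mulrDl ler_wpM2r ?trig_kernel_ge0 //.
  exact: H.
rewrite toeplitz_cst mulmx1 mul1mx tr_toeplitz.
by have -> : 2 * n%:R * fourier_coef h 0 = n%:R * fourier_coef h 0 + n%:R * fourier_coef h 0 by ring.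
Qed.

(** A half-sum of two indicators, so that [m = 0], where they coincide, gives the coefficient 1 of
    the constant function. *)
Definition coscoef (m : nat) (j : int) : R := 2^-1 * ((j == m%:Z)%:R + (j == - m%:Z)%:R).

Lemma fourier_coef_cos m j : fourier_coef (fun t : R => cos (m%:R * t)) j = coscoef m j.
Proof.
have ci (k : int) : tintegrable (fun t : R => cos (k%:~R * t)).
  have := tintegrable_cosM (fun=> 1 : R) k (tintegrable_cst 1).
  by under eq_fun do rewrite mulr1.
have -> : fourier_coef (fun t : R => cos (m%:R * t)) j =
   (2 * pi)^-1 * tint (fun t => 2^-1 * (cos ((j - m%:Z)%:~R * t) + cos ((j + m%:Z)%:~R * t))).
  rewrite fourier_coefE; congr (_ * _); apply: eq_Rintegral => t _.
  by rewrite !rmorphD rmorphN /= !mulrDl mulNr cosB cosD -!pmulrn; field.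
rewrite tintZ; last exact: tintegrableD.
rewrite tintD // !tint_cos subr_eq0 addr_eq0 /coscoef.
have pn0 : pi != 0 :> R by rewrite gt_eqF ?pi_gt0.
by case: eqP => _; case: eqP => _; move: (pi : R) pn0 => q qn0 /=; field.
Qed.

(** [T(cos (m t))] averages the shifts by [m] and [- m]; the indicators record the truncation at
    either end and make the natural subtraction harmless. *)
Lemma sum_coscoef n (i m : nat) (b : nat -> R) : (i < n)%N ->
  \sum_(k < n) coscoef m (i%:Z - k%:Z) * b k =
  2^-1 * ((m <= i)%:R * b (i - m)%N + (i + m < n)%:R * b (i + m)%N).
Proof.
move=> iln.
have e1 : \sum_(k < n) (i%:Z - k%:Z == m%:Z)%:R * b k = (m <= i)%:R * b (i - m)%N.
  case: leqP => mi.
    have kn : (i - m < n)%N by rewrite (leq_ltn_trans _ iln) // leq_subr.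
    rewrite (bigD1 (Ordinal kn)) //= big1 ?addr0.
      by rewrite -subzn // opprB addrC subrK eqxx.
    move=> k /eqP kk; case: eqP => [e|]; last by rewrite mul0r.
    exfalso; apply: kk; apply: val_inj => /=.
    by apply/eqP; rewrite -eqz_nat -subzn // -e opprB addrC subrK.
  rewrite mul0r big1 // => k _; case: eqP => [e|]; last by rewrite mul0r.
  exfalso; move: mi; rewrite ltnNge => /negP; apply.
  have : i%:Z = (m + k)%N%:Z by rewrite PoszD -e subrK.
  by case=> ->; rewrite leq_addr.
have e2 : \sum_(k < n) (i%:Z - k%:Z == - m%:Z)%:R * b k = (i + m < n)%:R * b (i + m)%N.
  have ke (k : nat) : (i%:Z - k%:Z == - m%:Z) = (k == i + m)%N.
    by rewrite -eqz_nat PoszD -[RHS]subr_eq0 -[LHS]subr_eq0 opprK -[LHS]oppr_eq0; congr (_ == _); ring.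
  case: ltnP => im.
    rewrite (bigD1 (Ordinal im)) //= big1 ?addr0; first by rewrite ke eqxx.
    by move=> k kk; rewrite ke; move: kk; rewrite -(inj_eq val_inj) /= => /negbTE ->; rewrite mul0r.
  rewrite mul0r big1 // => k _; rewrite ke; case: eqP => [e|]; last by rewrite mul0r.
  by exfalso; move: im; rewrite -e leqNgt ltn_ord.
rewrite -e1 -e2 -big_split mulr_sumr; apply: eq_bigr => k _.
by rewrite /coscoef /=; ring.
Qed.

Definition cospoly (N : nat) (c : nat -> R) (t : R) : R := \sum_(m < N) c m * cos (m%:R * t).

Lemma continuous_cospoly N c : continuous (cospoly N c).
Proof.
move=> t; rewrite /cospoly; elim: N => [|N IH].
  by under eq_fun do rewrite big_ord0; exact: cvg_cst.
under eq_fun do rewrite big_ord_recr /=.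
apply: cvgD; first exact: IH.
by apply: cvgMr; exact: continuous_cosm.
Qed.

Lemma cospoly_bounded N c : exists M, 0 < M /\ forall t, `|cospoly N c t| <= M.
Proof.
exists (\sum_(m < N) `|c m| + 1); split; first by rewrite ltr_wpDl // sumr_ge0.
move=> t; apply: (le_trans (ler_norm_sum _ _ _)); apply: ler_wpDr => //.
by apply: ler_sum => m _; rewrite normrM ler_piMr // cos_max.
Qed.

Lemma tintegrable_cospoly N c : tintegrable (cospoly N c).
Proof.
have [M [_ hM]] := cospoly_bounded N c.
by apply: (tintegrable_bounded _ M) => // ; exact: (measurable_torus_cont _ (continuous_cospoly _ _)).
Qed.

Lemma fourier_coef_cospoly N c j : fourier_coef (cospoly N c) j = \sum_(m < N) c m * coscoef m j.
Proof.
have ci (m : nat) : tintegrable (fun t : R => cos (m%:R * t)).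
  have := tintegrable_cosM (fun=> 1 : R) m%:Z (tintegrable_cst 1).
  by under eq_fun do rewrite mulr1.
rewrite fourier_coefE.
have -> : (fun t => cos (j%:~R * t) * cospoly N c t) =
    fun t => \sum_(m < N) c m * (cos (j%:~R * t) * cos (m%:R * t)).
  by apply/funext => t; rewrite mulr_sumr; apply: eq_bigr => m _; ring.
rewrite tint_sum; last by move=> m; apply: tintegrableZ; exact: tintegrable_cosM.
rewrite mulr_sumr; apply: eq_bigr => m _; rewrite tintZ; last exact: tintegrable_cosM.
by rewrite -fourier_coef_cos fourier_coefE mulrCA.
Qed.

Lemma coscoef_fourier m j g : coscoef m j * fourier_coef g j = coscoef m j * fourier_coef g m%:Z.
Proof.
rewrite /coscoef; case: eqP => [->//|_]; case: eqP => [->|_]; last by rewrite addr0 mulr0 !mul0r.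
by rewrite fourier_coefN.
Qed.

Lemma coscoefN m j : coscoef m (- j) = coscoef m j.
Proof. by rewrite /coscoef eqr_opp eqr_oppLR addrC. Qed.

Lemma sum_ltn_le (n e : nat) : (\sum_(i < n) (i < e)%N <= e)%N.
Proof.
suff -> : (\sum_(i < n) (i < e)%N = minn n e)%N by exact: geq_minr.
elim: n => [|n IH]; first by rewrite big_ord0 min0n.
rewrite big_ord_recr /= IH; case: (ltnP n e) => h.
  by rewrite (minn_idPl h) addn1.
by rewrite addn0 (minn_idPr (leqW h)).
Qed.

Lemma sum_geq_le (n e : nat) : (\sum_(i < n) (n - e <= i)%N <= e)%N.
Proof.
suff H c m : (\sum_(i < m) (c <= i)%N = m - c)%N by rewrite H leq_subCl.
elim: m => [|m IH]; first by rewrite big_ord0.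
rewrite big_ord_recr /= IH; case: leqP => h; first by rewrite subSn // addn1.
have h1 : (m - c = 0)%N by apply/eqP; rewrite subn_eq0 ltnW.
by rewrite h1; apply/esym/eqP; rewrite subn_eq0.
Qed.

(** Covers both the constant weight 1 and the cutoff [window], so that one trace estimate serves
    every term of the lower form. *)
Definition window_weight (n d : nat) (a : nat -> R) :=
  (forall i, 0 <= a i <= 1) /\ (forall i, (d <= i)%N -> (i + d < n)%N -> a i = 1).

(** Every summand lies in [[0, 1]], and it equals 1 unless [i] is within [d + m] of an end. *)
Lemma weighted_coscoef_sum n d m (a b : nat -> R) : window_weight n d a -> window_weight n d b ->
  n%:R - 2 * (d + m)%:R <= \sum_(i < n) a i * \sum_(k < n) coscoef m (i%:Z - k%:Z) * b k <= n%:R.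
Proof.
move=> [a01 a1] [b01 b1].
have r01 (i : 'I_n) : 0 <= \sum_(k < n) coscoef m (i%:Z - k%:Z) * b k <= 1.
  rewrite sum_coscoef //.
  have /andP[u0 u1] := b01 (i - m)%N; have /andP[v0 v1] := b01 (i + m)%N.
  by case: leqP => _; case: ltnP => _ /=; lra.
have rs : n%:R = \sum_(i < n) 1 :> R by rewrite sumr_const card_ord.
apply/andP; split; last first.
  rewrite [leRHS]rs; apply: ler_sum => i _.
  by have /andP[? ?] := a01 i; have /andP[? ?] := r01 i; rewrite mulr_ile1.
set e := (d + m)%N.
apply: (@le_trans _ _ (\sum_(i < n) (1 - (i < e)%:R - (n - e <= i)%:R))).
  rewrite !sumrB -rs.
  have h1 : \sum_(i < n) ((i < e)%N%:R : R) <= e%:R.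
    by rewrite -natr_sum ler_nat; exact: sum_ltn_le.
  have h2 : \sum_(i < n) ((n - e <= i)%N%:R : R) <= e%:R.
    by rewrite -natr_sum ler_nat; exact: sum_geq_le.
  lra.
apply: ler_sum => i _.
have /andP[r0 r1] := r01 i; have /andP[a0 a'1] := a01 i.
case: (ltnP i e) => ie; first by case: leqP => _ /=; rewrite (le_trans _ (mulr_ge0 a0 r0)) //; lra.
case: (leqP (n - e) i) => ie2; first by rewrite (le_trans _ (mulr_ge0 a0 r0)) //=; lra.
have ien : (i + e < n)%N by rewrite ltn_subRL addnC in ie2.
rewrite a1; last 2 first.
- by rewrite (leq_trans _ ie) // leq_addr.
- by rewrite (leq_ltn_trans _ ien) // leq_add2l leq_addr.
have mi : (m <= i)%N by rewrite (leq_trans _ ie) // leq_addl.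
have imn : (i + m < n)%N by rewrite (leq_ltn_trans _ ien) // leq_add2l leq_addl.
rewrite sum_coscoef // mi imn !b1 /=; first lra.
- by rewrite (leq_trans _ (leq_addr _ _)) // (leq_trans _ ie) // leq_addr.
- by rewrite -addnA (leq_ltn_trans _ ien) // leq_add2l addnC.
- by rewrite leq_subRL // addnC.
- by rewrite (leq_ltn_trans _ ien) // leq_add // ?leq_subr // leq_addr.
Qed.

Lemma tint_cospolyM N c g : tintegrable g ->
  (2 * pi)^-1 * tint (fun t => cospoly N c t * g t) = \sum_(m < N) c m * fourier_coef g m%:Z.
Proof.
move=> ig.
have -> : (fun t => cospoly N c t * g t) = fun t => \sum_(m < N) c m * (cos (m%:Z%:~R * t) * g t).
  by apply/funext => t; rewrite mulr_suml; apply: eq_bigr => m _; ring.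
rewrite tint_sum; last by move=> m; apply: tintegrableZ; exact: tintegrable_cosM.
rewrite mulr_sumr; apply: eq_bigr => m _; rewrite tintZ; last exact: tintegrable_cosM.
by rewrite fourier_coefE mulrCA.
Qed.

(** The Szego limit for a polynomial symbol: only finitely many diagonals are nonzero, and each
    contributes [n] times a product of coefficients up to a boundary error independent of [n]. *)
Lemma weighted_trace_cospoly N c d g : tintegrable g -> exists K, 0 <= K /\ forall n (a b : nat -> R),
  window_weight n d a -> window_weight n d b ->
  `|\sum_(i < n) \sum_(k < n) a i * b k * (fourier_coef (cospoly N c) (i%:Z - k%:Z) * fourier_coef g (i%:Z - k%:Z))
     - n%:R * ((2 * pi)^-1 * tint (fun t => cospoly N c t * g t))| <= K.
Proof.
move=> ig; exists (\sum_(m < N) `|c m * fourier_coef g m%:Z| * (2 * (d + m)%:R)); split.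
  by apply: sumr_ge0 => m _; rewrite mulr_ge0.
move=> n a b wa wb.
have -> : \sum_(i < n) \sum_(k < n) a i * b k * (fourier_coef (cospoly N c) (i%:Z - k%:Z) * fourier_coef g (i%:Z - k%:Z)) =
  \sum_(m < N) c m * fourier_coef g m%:Z * \sum_(i < n) a i * \sum_(k < n) coscoef m (i%:Z - k%:Z) * b k.
  under [RHS]eq_bigr do rewrite mulr_sumr.
  rewrite [RHS]exchange_big; apply: eq_bigr => i _ /=.
  under [RHS]eq_bigr do rewrite mulrA mulr_sumr.
  rewrite [RHS]exchange_big; apply: eq_bigr => k _ /=.
  rewrite fourier_coef_cospoly mulr_suml mulr_sumr; apply: eq_bigr => m _.
  by rewrite -[c m * _ * _]mulrA coscoef_fourier; ring.
rewrite tint_cospolyM // mulr_sumr -sumrB.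
apply: (le_trans (ler_norm_sum _ _ _)); apply: ler_sum => m _.
have /andP[h1 h2] := weighted_coscoef_sum n d m a b wa wb.
rewrite (mulrC n%:R) -mulrBr normrM ler_wpM2l // ler_norml; apply/andP; split; first lra.
by rewrite (le_trans (y := 0)) // ?subr_le0 // mulr_ge0.
Qed.

(** On vectors vanishing in the first and last [N] coordinates truncation is not felt, so the
    Toeplitz matrix acts on [sum_j x_j e^(i j t)] as multiplication by its symbol. *)
Lemma toeplitz_cospolyM N c n (x : 'cV[R]_n) :
  (forall i : 'I_n, ~~ ((N <= i) && (i + N < n))%N -> x i ord0 = 0) ->
  forall t, ctr (toeplitz n (cospoly N c) *m x) t = cospoly N c t * ctr x t /\
            str (toeplitz n (cospoly N c) *m x) t = cospoly N c t * str x t.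
Proof.
move=> hx t.
(* The sequences [cos (i t)] and [sin (i t)] both satisfy this recurrence: averaging the shifts by
   [m] and [- m] multiplies them by [cos (m t)]. *)
have H (u : nat -> R) : (forall i m : nat, (m <= i)%N -> u (i - m)%N + u (i + m)%N = 2 * cos (m%:R * t) * u i) ->
  \sum_(j < n) (toeplitz n (cospoly N c) *m x) j ord0 * u j = cospoly N c t * \sum_(i < n) x i ord0 * u i.
  move=> hu; under eq_bigr do rewrite mxE mulr_suml.
  rewrite exchange_big mulr_sumr; apply: eq_bigr => i _ /=.
  have [/andP[Ni iN]|/hx ->] := boolP ((N <= i) && (i + N < n))%N; last first.
    by rewrite mul0r mulr0 big1 // => j _; rewrite mulr0 mul0r.
  transitivity (x i ord0 * \sum_(m < N) c m * \sum_(j < n) coscoef m (i%:Z - j%:Z) * u j).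
    under [in RHS]eq_bigr do rewrite mulr_sumr.
    rewrite exchange_big mulr_sumr; apply: eq_bigr => j _ /=.
    rewrite mxE fourier_coef_cospoly -opprB mulr_suml mulr_suml mulr_sumr; apply: eq_bigr => m _.
    by rewrite coscoefN; ring.
  rewrite mulrCA; congr (_ * _); rewrite mulr_suml; apply: eq_bigr => m _.
  have mi : (m <= i)%N by rewrite (leq_trans (ltnW (ltn_ord m))).
  have im : (i + m < n)%N by rewrite (leq_ltn_trans _ iN) // leq_add2l ltnW.
  by rewrite sum_coscoef // mi im !mul1r hu //; field.
split.
  by apply: (H (fun i => cos (i%:R * t))) => i m mi; rewrite natrB // natrD mulrBl mulrDl cosB cosD; ring.
by apply: (H (fun i => sin (i%:R * t))) => i m mi; rewrite natrB // natrD mulrBl mulrDl sinB sinD; ring.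
Qed.

End ToeplitzTrace.

(** * Approximation by cosine polynomials *)

Section CosineApproximation.
Context {R : realType}.
Implicit Types (h f g : R -> R) (t x e : R).

Definition is_cospoly f := exists N c, forall t, f t = cospoly N c t.

Lemma cospoly_widen N M c t : (N <= M)%N ->
  cospoly N c t = cospoly M (fun m => if (m < N)%N then c m else 0) t.
Proof.
move=> NM; rewrite /cospoly (big_ord_widen _ (fun m => c m * cos (m%:R * t)) NM) big_mkcond.
by apply: eq_bigr => m _; case: ifP => _; rewrite ?mul0r.
Qed.

Lemma is_cospolyD f g : is_cospoly f -> is_cospoly g -> is_cospoly (fun t => f t + g t).
Proof.
move=> [N [c hc]] [M [c' hc']].
exists (maxn N M), (fun m => (if (m < N)%N then c m else 0) + (if (m < M)%N then c' m else 0)) => t.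
rewrite hc hc' (cospoly_widen N (maxn N M)) ?leq_maxl // (cospoly_widen M (maxn N M)) ?leq_maxr //.
by rewrite /cospoly -big_split; apply: eq_bigr => m _; rewrite mulrDl.
Qed.

Lemma is_cospolyZ (k : R) f : is_cospoly f -> is_cospoly (fun t => k * f t).
Proof.
move=> [N [c hc]]; exists N, (fun m => k * c m) => t.
by rewrite hc mulr_sumr; apply: eq_bigr => m _; rewrite mulrA.
Qed.

Lemma is_cospoly_cos (m : nat) : is_cospoly (fun t => cos (m%:R * t)).
Proof.
exists m.+1, (fun k => (k == m)%:R) => t.
rewrite /cospoly (bigD1 ord_max) //= eqxx mul1r big1 ?addr0 // => k km.
by rewrite (_ : (k == m :> nat) = false) ?mul0r //; apply/negbTE.
Qed.

Lemma is_cospoly_cst (k : R) : is_cospoly (fun=> k).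
Proof.
have [N [c hc]] := is_cospolyZ k _ (is_cospoly_cos 0).
by exists N, c => t; rewrite -hc mul0r cos0 mulr1.
Qed.

Lemma is_cospoly_sum n (F : 'I_n -> R -> R) : (forall i, is_cospoly (F i)) ->
  is_cospoly (fun t => \sum_i F i t).
Proof.
elim: n F => [|n IH] F hF.
  by have [N [c hc]] := is_cospoly_cst 0; exists N, c => t; rewrite -hc big_ord0.
have [N [c hc]] := is_cospolyD _ _ (IH _ (fun i => hF (widen_ord (leqnSn n) i))) (hF ord_max).
by exists N, c => t; rewrite -hc big_ord_recr.
Qed.

Lemma is_cospoly_cosM f : is_cospoly f -> is_cospoly (fun t => cos t * f t).
Proof.
move=> [N [c hc]].
have H (m : 'I_N) : is_cospoly (fun t => c m * (cos t * cos (m%:R * t))).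
  apply: is_cospolyZ; case: m => -[|m] _ /=.
    by have [M [d hd]] := is_cospoly_cos 1; exists M, d => t; rewrite -hd mul0r cos0 mulr1 mul1r.
  have [M [d hd]] := is_cospolyZ 2^-1 _ (is_cospolyD _ _ (is_cospoly_cos m) (is_cospoly_cos m.+2)).
  exists M, d => t; rewrite -hd -(natr1 m.+1) -(natr1 m) !mulrDl !mul1r !cosD sinD.
  apply/eqP; rewrite -subr_eq0.
  set u := cos (m%:R * t); set w := sin (m%:R * t).
  have -> : cos t * (u * cos t - w * sin t) - 2^-1 * (u + ((u * cos t - w * sin t) * cos t -
      (w * cos t + u * sin t) * sin t)) = 2^-1 * u * (cos t ^+ 2 + sin t ^+ 2 - 1) by field.
  by rewrite cos2Dsin2 subrr mulr0.
have [M [d hd]] := is_cospoly_sum _ _ H.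
by exists M, d => t; rewrite -hd hc mulr_sumr; apply: eq_bigr => m _; ring.
Qed.

(** The Bernstein polynomial, as the mean of [f] over a binomial variable, by conditioning on one
    trial; moments then follow by induction without binomial coefficients. *)
Fixpoint bern (n : nat) (f : nat -> R) (x : R) : R :=
  if n is m.+1 then (1 - x) * bern m f x + x * bern m (f \o succn) x else f 0%N.

Lemma le_bern n (f g : nat -> R) x : 0 <= x <= 1 -> (forall k, (k <= n)%N -> f k <= g k) ->
  bern n f x <= bern n g x.
Proof.
move=> /andP[x0 x1]; elim: n f g => [|n IH] f g fg /=; first exact: fg.
rewrite lerD // ler_wpM2l ?subr_ge0 //; apply: IH => k kn /=; apply: fg => //.
exact: leqW.
Qed.

Lemma bern_lin n (f g : nat -> R) (a b x : R) :
  bern n (fun k => a * f k + b * g k) x = a * bern n f x + b * bern n g x.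
Proof.
elim: n f g => [//|n IH] f g /=.
by rewrite IH (IH (f \o succn) (g \o succn)); ring.
Qed.

Lemma bern_cst n (a x : R) : bern n (fun=> a) x = a.
Proof. by elim: n => [//|n IH] /=; rewrite (_ : (fun=> a) \o succn = fun=> a) // IH; ring. Qed.

(** Squared bias plus the binomial variance [n x (1 - x)]. *)
Lemma bern_sqr n (a x : R) : bern n (fun k => (k%:R - a) ^+ 2) x = (n%:R * x - a) ^+ 2 + n%:R * (x * (1 - x)).
Proof.
elim: n a => [|n IH] a /=; first by rewrite !mul0r addr0.
rewrite IH.
have -> : (fun k : nat => (k%:R - a) ^+ 2) \o succn = fun k => (k%:R - (a - 1)) ^+ 2.
  by apply/funext => k /=; rewrite -natr1 opprB addrCA addrA [1 + _]addrC addrC.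
by rewrite IH -(natr1 n); ring.
Qed.

Lemma is_cospoly_bern n (f : nat -> R) : is_cospoly (fun t => bern n f ((1 + cos t) / 2)).
Proof.
elim: n f => [|n IH] f /=; first exact: is_cospoly_cst.
have h (k : R) (g : nat -> R) : is_cospoly (fun t => 2^-1 * bern n g ((1 + cos t) / 2) +
    k * (cos t * bern n g ((1 + cos t) / 2))).
  by apply: is_cospolyD; [|apply: is_cospolyZ; apply: is_cospoly_cosM]; [apply: is_cospolyZ|]; exact: IH.
have [N [c hc]] := is_cospolyD _ _ (h (- 2^-1) f) (h 2^-1 (f \o succn)).
by exists N, c => t; rewrite -hc; field.
Qed.

(** Continuity relative to half a period: the symbols are even and are described only on
    [[- pi, pi]]. *)
Definition cont0pi h := forall t, `[0, pi]%classic t -> h x @[x --> within `[0, pi]%classic (nbhs t)] --> h t.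

Lemma sin_le_sin (a y : R) : 0 <= a -> a <= y -> y <= pi - a -> sin a <= sin y.
Proof.
move=> a0 ay ypi; rewrite -subr_ge0.
set u := (y + a) / 2; set v := (y - a) / 2.
have -> : y = u + v by rewrite /u /v; field.
have -> : a = u - v by rewrite /u /v; field.
rewrite sinD sinB.
have -> : sin u * cos v + cos u * sin v - (sin u * cos v - cos u * sin v) = 2 * (cos u * sin v) by ring.
have pi0 := pi_gt0 R.
rewrite !mulr_ge0 //.
  by apply: cos_ge0_pihalf; rewrite /u; lra.
by apply: sin_ge0_pi; rewrite /v; lra.
Qed.

(** For [s <= t], [cos s - cos t = 2 sin ((t + s) / 2) sin ((t - s) / 2)] and both sines are at
    least [sin (e / 2)]: a quantitative injectivity of [cos] on [[0, pi]]. *)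
Lemma cos_sub_ge (s t e : R) : 0 < e -> 0 <= s <= pi -> 0 <= t <= pi -> e <= `|s - t| ->
  2 * sin (e / 2) ^+ 2 <= `|cos s - cos t|.
Proof.
wlog st : s t / s <= t => [H|].
  have [st|/ltW st] := leP s t => e0 hs ht he; first exact: (H s t).
  by rewrite distrC; apply: (H t s) => //; rewrite distrC.
move=> e0 /andP[s0 sp] /andP[t0 tp]; rewrite ler0_norm ?subr_le0 // opprB => h.
set y := (t + s) / 2; set a := (t - s) / 2.
have es : s = y - a by rewrite /y /a; field.
have et : t = y + a by rewrite /y /a; field.
have -> : cos s - cos t = 2 * (sin y * sin a) by rewrite es et cosB cosD; ring.
have pi0 := pi_gt0 R.
have ha : sin (e / 2) <= sin a by apply: sin_le_sin; rewrite /a; lra.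
have hy : sin a <= sin y by apply: sin_le_sin; rewrite /a /y; lra.
have h0 : 0 <= sin (e / 2) by apply: sin_ge0_pi; lra.
apply: le_trans (ler_norm _); rewrite ler_pM2l // expr2 ler_pM //.
exact: le_trans hy.
Qed.

Lemma cont0pi_bounded h : cont0pi h -> exists M, 0 < M /\ forall t, 0 <= t <= pi -> `|h t| <= M.
Proof.
move=> ch.
have cK : compact `[0, pi : R]%classic by exact: segment_compact.
have := (compact_near_coveringP _).1 cK R (pinfty_nbhs R) (fun M t => `[0, pi]%classic t -> `|h t| <= M) _.
have cov : forall x : R, `[0, pi]%classic x ->
  \forall x' \near x & i \near +oo, `[0, pi]%classic x' -> `|h x'| <= i.
  move=> x Kx.
  have [e /= e0 He] : \forall y \near within `[0, pi]%classic (nbhs x), `|h y - h x| < 1.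
    by apply: cvgr_distC_lt => //; exact: ch.
  exists ([set y | `[0, pi]%classic y -> `|h y - h x| < 1], [set M | `|h x| + 1 <= M]).
    split; first by exists e.
    by apply: nbhs_pinfty_ge; exact: num_real.
  move=> [y M] /= [h1 h2] Ky.
  apply: le_trans h2; rewrite -[h y](subrK (h x)) (le_trans (ler_normD _ _)) // addrC lerD2l ltW //.
  exact: h1.
move=> /(_ _ cov) [M [_ HM]].
pose M' := Num.max M 0 + 1.
have M'M : M < M' by rewrite /M' ltr_pwDr // le_max lexx.
exists M'; split; first by rewrite /M' ltr_wpDl // le_max lexx orbT.
by move=> t ht; apply: (HM M' M'M) => //=; rewrite in_itv.
Qed.

(** A modulus of continuity quadratic in the cosines, whose Bernstein mean is explicit. Nearby
    points use continuity; for distant ones the quadratic term alone exceeds [2 M]. *)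
Lemma cont0pi_modulus h e : cont0pi h -> 0 < e -> exists K, 0 <= K /\
  forall s t, 0 <= s <= pi -> 0 <= t <= pi -> `|h s - h t| <= e + K * (cos s - cos t) ^+ 2.
Proof.
move=> ch e0; have [M [M0 hM]] := cont0pi_bounded h ch.
have cK : compact `[0, pi : R]%classic by exact: segment_compact.
have := (compact_near_coveringP _).1 cK R (pinfty_nbhs R) (fun K s => `[0, pi]%classic s ->
   forall t, 0 <= t <= pi -> `|h s - h t| <= e + K * (cos s - cos t) ^+ 2) _.
have cov : forall x : R, `[0, pi]%classic x ->
  \forall x' \near x & K \near +oo, `[0, pi]%classic x' ->
    forall t, 0 <= t <= pi -> `|h x' - h t| <= e + K * (cos x' - cos t) ^+ 2.
  move=> x Kx.
  have [d /= d0 Hd] : \forall y \near within `[0, pi]%classic (nbhs x), `|h y - h x| < e / 2.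
    by apply: cvgr_distC_lt => //; [exact: ch|rewrite divr_gt0].
  (* The lower bound of [|cos s - cos t|] for [|s - t| >= d / 2]. *)
  pose c := 2 * sin (d / 4) ^+ 2.
  exists (ball x (d / 2), [set K | Num.max (2 * M / c ^+ 2) 0 <= K]).
    split; first by apply: nbhsx_ballx; rewrite divr_gt0.
    by apply: nbhs_pinfty_ge; exact: num_real.
  move=> [s K] /= [bs]; rewrite ge_max => /andP[hK K0]; rewrite in_itv /= => hs t ht.
  have K2 : 0 <= K * (cos s - cos t) ^+ 2 by rewrite mulr_ge0 // sqr_ge0.
  have [st|st] := ltP `|s - t| (d / 2).
    rewrite -[leLHS]addr0 lerD //.
    have -> : h s - h t = (h s - h x) - (h t - h x) by ring.
    rewrite (le_trans (ler_normB _ _)) // [e]splitr lerD // ltW //; apply: Hd => /=.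
    - by rewrite /ball /= (lt_trans bs) // ltr_pdivrMr // ltr_pMr // ltr1n.
    - by rewrite in_itv.
    - rewrite /ball /= -(subrK s x) -addrA (le_lt_trans (ler_normD _ _)) // [d]splitr ltrD //.
    - by rewrite in_itv.
  have pi0 := pi_gt0 R.
  have dpi : d / 2 <= pi.
    by apply: (le_trans st); rewrite ler_norml; move: hs ht => /andP[? ?] /andP[? ?]; lra.
  have := cos_sub_ge s t (d / 2) (divr_gt0 d0 (ltr0n _ 2)) hs ht st.
  have -> : d / 2 / 2 = d / 4 by field.
  rewrite -/c => hc.
  have c0 : 0 < c by rewrite mulr_gt0 // exprn_gt0 // sin_gt0_pi //; lra.
  have c2 : c ^+ 2 <= (cos s - cos t) ^+ 2.
    by rewrite -[leRHS]real_normK ?num_real // ler_pXn2r // nnegrE ltW.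
  rewrite -[leLHS]add0r lerD //; first exact: ltW.
  apply: (@le_trans _ _ (2 * M)).
    by rewrite (le_trans (ler_normB _ _)) // mulr_natl mulr2n lerD // hM.
  rewrite ler_pdivrMr ?exprn_gt0 // in hK.
  by rewrite (le_trans hK) // ler_wpM2l.
move=> /(_ _ cov) [K [_ HK]].
pose K' := Num.max K 0 + 1.
have K'K : K < K' by rewrite /K' ltr_pwDr // le_max lexx.
exists K'; split; first by rewrite /K' addr_ge0 // le_max lexx orbT.
by move=> s t hs ht; apply: (HK K' K'K) => //=; rewrite in_itv.
Qed.

(* Bernstein polynomials in [(1 + cos t) / 2], with nodes [acos (2 k / n - 1)]. *)
Theorem cospoly_approx h e : cont0pi h -> (forall t, - pi <= t <= pi -> h (- t) = h t) -> 0 < e ->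
  exists N c, forall t, - pi <= t <= pi -> `|h t - cospoly N c t| <= e.
Proof.
move=> ch he e0.
have [K [K0 hK]] := cont0pi_modulus h (e / 2) ch (divr_gt0 e0 (ltr0n _ 2)).
(* The binomial variance leaves an error [4 K x (1 - x) / n <= K / n], which this [n] makes at most
   [e / 2]. *)
pose n := (Num.truncn (2 * K / e)).+1.
have n0 : 0 < (n%:R : R) by rewrite ltr0n.
have nK : K / n%:R <= e / 2.
  rewrite ler_pdivrMr // -ler_pdivrMl ?divr_gt0 // invf_div mulrC mulrA [K * 2]mulrC.
  by rewrite ltW // truncnS_gt.
pose tk (k : nat) : R := acos (2 * k%:R / n%:R - 1).
have [N [c hc]] := is_cospoly_bern n (h \o tk).
exists N, c.
suff H t : 0 <= t <= pi -> `|h t - cospoly N c t| <= e.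
  move=> t /andP[t1 t2]; case: (lerP 0 t) => t0; first by apply: H; rewrite t0.
  have cN : cospoly N c (- t) = cospoly N c t.
    by apply: eq_bigr => m _; rewrite mulrN cosN.
  by rewrite -he ?t1 // -cN; apply: H; rewrite oppr_ge0 ltW // lerNl.
move=> ht; rewrite -hc; set x := (1 + cos t) / 2.
have x01 : 0 <= x <= 1 by have := cos_geN1 t; have := cos_le1 t; rewrite /x; lra.
have tkP k : (k <= n)%N -> 0 <= tk k <= pi /\ cos (tk k) = 2 * k%:R / n%:R - 1.
  move=> kn; rewrite /tk; set q : R := 2 * k%:R / n%:R - 1.
  have k01 : -1 <= q <= 1.
    have : 0 <= (k%:R / n%:R : R) <= 1.
      by rewrite divr_ge0 ?ler0n //= ler_pdivrMr // mul1r ler_nat.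
    by rewrite /q -mulrA; lra.
  by rewrite acos_ge0 // acos_lepi // acosK // in_itv.
have bd k : (k <= n)%N -> `|h t - h (tk k)| <= e / 2 + 4 * K / n%:R ^+ 2 * (k%:R - n%:R * x) ^+ 2.
  move=> kn; have [htk ctk] := tkP k kn.
  have := hK t (tk k) ht htk; rewrite ctk.
  have -> : K * (cos t - (2 * k%:R / n%:R - 1)) ^+ 2 = 4 * K / n%:R ^+ 2 * (k%:R - n%:R * x) ^+ 2.
    by rewrite /x; field; rewrite gt_eqF.
  by [].
have bE : bern n (fun k => (e / 2) * 1 + 4 * K / n%:R ^+ 2 * (k%:R - n%:R * x) ^+ 2) x <= e.
  rewrite bern_lin bern_cst bern_sqr subrr expr0n /= add0r mulr1.
  have -> : 4 * K / n%:R ^+ 2 * (n%:R * (x * (1 - x))) = K / n%:R * (4 * (x * (1 - x))).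
    by field; rewrite gt_eqF.
  have : 4 * (x * (1 - x)) <= 1.
    by rewrite -subr_ge0 (_ : 1 - _ = (1 - 2 * x) ^+ 2) ?sqr_ge0 //; ring.
  move=> /(ler_wpM2l (divr_ge0 K0 (ltW n0))); rewrite mulr1 => h1.
  by rewrite [leRHS]splitr lerD2l (le_trans h1).
have hcst : h t = bern n (fun=> h t) x by rewrite bern_cst.
have E : h t - bern n (h \o tk) x = bern n (fun k => 1 * h t + (-1) * (h \o tk) k) x.
  by rewrite bern_lin bern_cst; ring.
rewrite ler_norml E; apply/andP; split; last first.
  apply: le_trans bE; apply: le_bern => // k kn.
  by rewrite mul1r mulN1r mulr1 (le_trans (ler_norm _)) //; exact: bd.
rewrite lerNl; apply: le_trans bE.
have -> : - bern n (fun k => 1 * h t + (-1) * (h \o tk) k) x = bern n (fun k => (-1) * h t + 1 * (h \o tk) k) x.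
  by rewrite !bern_lin; ring.
apply: le_bern => // k kn.
by rewrite mul1r mulN1r mulr1 addrC -opprB (le_trans (ler_norm _)) // normrN; exact: bd.
Qed.

End CosineApproximation.

(** * Symbols with a power singularity *)

Section SmallAngles.
Context {R : realType}.
Implicit Types t x y : R.

Lemma sin_mvt y : 0 <= y -> exists2 c, 0 <= c <= y & sin y = cos c * y.
Proof.
move=> y0; have [c] := @MVT_segment R sin cos 0 y y0 (fun x _ => is_derive_sin x)
  (continuous_subspaceT (@continuous_sin R)).
by rewrite in_itv /= sin0 !subr0; exists c.
Qed.

Lemma half_angle t : 1 - cos t = 2 * sin (t / 2) ^+ 2.
Proof. by rewrite [in LHS](splitr t) cosD -!expr2 sin2cos2; ring. Qed.

Lemma one_sub_cos_le t : 1 - cos t <= t ^+ 2 / 2.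
Proof.
wlog t0 : t / 0 <= t => [H|].
  by have [/H //|/ltW] := lerP 0 t; rewrite -oppr_ge0 => /H; rewrite cosN sqrrN.
have [c _ hs] := sin_mvt (t / 2) (divr_ge0 t0 (ler0n _ 2)).
rewrite half_angle hs exprMn.
have -> : 2 * (cos c ^+ 2 * (t / 2) ^+ 2) = cos c ^+ 2 * (t ^+ 2 / 2) by field.
have : cos c ^+ 2 <= 1 by rewrite cos2sin2 lerBlDr lerDl sqr_ge0.
by move=> h; rewrite -[leRHS]mul1r ler_wpM2r // divr_ge0 // sqr_ge0.
Qed.

(** For [t >= 0], [sin (t / 2) = 2 sin (t / 4) cos (t / 4)]; the mean value theorem gives
    [sin (t / 4) >= (t / 4) cos (t / 4)], and [cos (t / 4)^2 >= 1/2] because [cos (t / 2) >= 0].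
    Hence [sin (t / 2) >= t / 4]. *)
Lemma one_sub_cos_ge t : - pi <= t <= pi -> t ^+ 2 / 8 <= 1 - cos t.
Proof.
wlog t0 : t / 0 <= t => [H|] ht.
  have [t0|/ltW t0] := leP 0 t; first exact: (H t).
  by rewrite -(cosN t) -(sqrrN t); apply: H; lra.
have pi0 := pi_gt0 R.
have [c hc hs] := sin_mvt (t / 2 / 2) ltac:(lra).
have cc : cos (t / 2 / 2) <= cos c.
  have [/andP[c0]] := (hc); rewrite le_eqVlt => /orP[/eqP -> //|ct].
  by rewrite ltW // ltr_cos // in_itv /=; lra.
have c4 : 0 <= cos (t / 2 / 2) by apply: cos_ge0_pihalf; lra.
have c2 : 0 <= cos (t / 2) by apply: cos_ge0_pihalf; lra.
have h1 : t / 2 / 2 <= sin (t / 2).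
  have -> : sin (t / 2) = 2 * (sin (t / 2 / 2) * cos (t / 2 / 2)).
    by rewrite {1}(splitr (t / 2)) sinD; ring.
  have h : (t / 2 / 2) * (cos (t / 2 / 2)) ^+ 2 <= sin (t / 2 / 2) * cos (t / 2 / 2).
    by rewrite hs expr2 mulrA mulrC [leRHS]mulrC ler_wpM2l // [leLHS]mulrC ler_wpM2r //; lra.
  have e : cos (t / 2) = 2 * cos (t / 2 / 2) ^+ 2 - 1.
    by rewrite {1}(splitr (t / 2)) cosD -!expr2 sin2cos2; ring.
  move: h e c2; set s := sin _ * cos _; set k := cos (t / 2 / 2) ^+ 2 => h e c2.
  have k2 : 2^-1 <= k by lra.
  have := ler_wpM2l (_ : 0 <= t / 2 / 2) k2; rewrite (_ : 0 <= t / 2 / 2); last lra.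
  by move=> /(_ erefl); lra.
rewrite half_angle.
have : (t / 2 / 2) ^+ 2 <= sin (t / 2) ^+ 2 by rewrite ler_pXn2r // nnegrE; lra.
lra.
Qed.

End SmallAngles.

Section ContinuityOnHalfPeriod.
Context {R : realType}.
Implicit Types (h k : R -> R) (t : R).

Lemma cont0pi_cont h : continuous h -> cont0pi h.
Proof. by move=> ch t _; apply: cvg_within_filter; exact: ch. Qed.

Lemma cont0piD h k : cont0pi h -> cont0pi k -> cont0pi (fun t => h t + k t).
Proof. by move=> ch ck t ht; apply: cvgD; [exact: ch|exact: ck]. Qed.

Lemma cont0piM h k : cont0pi h -> cont0pi k -> cont0pi (fun t => h t * k t).
Proof. by move=> ch ck t ht; apply: cvgM; [exact: ch|exact: ck]. Qed.

Lemma cont0piV h : cont0pi h -> (forall t, 0 <= t <= pi -> h t != 0) -> cont0pi (fun t => (h t)^-1).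
Proof.
move=> ch h0 t ht; apply: cvgV; last exact: ch.
by apply: h0; move: ht; rewrite /= in_itv.
Qed.

Lemma continuous_one_sub_cos : continuous (fun t : R => 1 - cos t).
Proof. by move=> t; apply: cvgB; [exact: cvg_cst|exact: continuous_cos]. Qed.

End ContinuityOnHalfPeriod.

(** The value of [2 u a - ww a^2] at [a = v] is at least [u v]. Replacing [v] by an approximation
    costs 4 units of [e0] in the linear term and [W (4 / k + 1)] in the square; the last 2 pay for a
    majorant of [ww a^2]. Applied with [u = 1 - cos t] and [ww = f u^2]. *)
Lemma square_completion {R : realFieldType} (u v a ww k W e0 : R) : 0 <= u <= 2 -> 0 < k -> 0 <= ww <= W -> 0 <= e0 <= 1 ->
  (ww + k) * v = u -> `|v| <= 2 / k -> `|v - a| <= e0 ->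
  u * v - (4 + W * (4 / k + 1) + 2) * e0 <= 2 * (u * a) - (ww * a ^+ 2 + 2 * e0).
Proof.
move=> /andP[u0 u2] k0 /andP[w0 wW] /andP[e00 e01] uv vk va.
have h1 : 2 * (u * (v - a)) <= 4 * e0.
  have : u * (v - a) <= 2 * e0.
    apply: (le_trans (ler_wpM2l u0 (ler_norm _))).
    by rewrite ler_pM.
  lra.
have h2 : ww * (a ^+ 2 - v ^+ 2) <= W * (4 / k + 1) * e0.
  have -> : a ^+ 2 - v ^+ 2 = (a - v) * (a + v) by ring.
  have h3 : (a - v) * (a + v) <= (4 / k + 1) * e0.
    rewrite (le_trans (ler_norm _)) // normrM distrC mulrC ler_pM //.
    have -> : a + v = (a - v) + (v + v) by ring.
    rewrite (le_trans (ler_normD _ _)) // distrC addrC.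
    rewrite lerD ?(le_trans va) // (le_trans (ler_normD _ _)) //.
    have -> : 4 / k = 2 / k + 2 / k by ring.
    by rewrite lerD.
  rewrite (le_trans (ler_wpM2l w0 h3)) // mulrA ler_wpM2r // ler_wpM2r //.
  by rewrite addr_ge0 // divr_ge0 // ltW.
have h4 : ww * v ^+ 2 <= u * v.
  rewrite -uv; have : 0 <= k * v ^+ 2 by rewrite mulr_ge0 ?sqr_ge0 // ltW.
  rewrite -mulrA -expr2 mulrDl; lra.
have : 2 * (u * (v - a)) = 2 * (u * v) - 2 * (u * a) by ring.
have : ww * (a ^+ 2 - v ^+ 2) = ww * a ^+ 2 - ww * v ^+ 2 by ring.
lra.
Qed.

(** [al] allows a zero at 0 and [al'] a pole, so both ranges of the Hurst parameter are covered.
    Because of the pole, continuity is asked only on [(0, pi]]; the value 0 at 0 is the one that the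
    formula for the density of fractional Gaussian noise takes. *)
Record powlike_symbol {R : realType} (f : R -> R) (al al' c C : R) : Prop := PowlikeSymbol {
  powlike_measurable : measurable_fun torus f;
  powlike_even : forall t, - pi <= t <= pi -> f (- t) = f t;
  powlike0 : f 0 = 0;
  powlike_cvg : forall t, 0 < t <= pi -> f x @[x --> within `[0, pi]%classic (nbhs t)] --> f t;
  powlike_cst : 0 < c /\ 0 <= C;
  powlike_exp : 0 <= al < 1 /\ 0 <= al' < 1;
  powlike_bounds : forall t, - pi <= t <= pi -> t != 0 -> c * pw al t <= f t <= C * pw (- al') t }.

(** * One-sided approximation of 1/f by cosine polynomials *)

Section SymbolApproximation.
Context {R : realType}.
Variables (f g : R -> R) (al al' be c C C' : R).
Hypothesis pf : powlike_symbol f al al' c C.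
Hypotheses (be0 : 0 <= be) (albe : al + be < 1) (C'0 : 0 <= C').
Hypothesis mg : measurable_fun torus g.
Hypothesis hg : forall t, torus t -> t != 0 -> 0 <= g t <= C' * pw (- be) t.
Implicit Types (t x d e k : R).

Lemma torus_closed t : torus t -> - pi <= t <= pi.
Proof. by rewrite /torus /= in_itv /= => /andP[-> /ltW]. Qed.

Lemma powlike_gt0 t : - pi <= t <= pi -> t != 0 -> 0 < f t.
Proof.
move=> ht t0; have /andP[+ _] := powlike_bounds _ _ _ _ _ pf t ht t0.
by apply: lt_le_trans; rewrite mulr_gt0 ?pw_gt0 //; case: (powlike_cst _ _ _ _ _ pf).
Qed.

Lemma powlike_ge0 t : - pi <= t <= pi -> 0 <= f t.
Proof.
move=> ht; have [->|t0] := eqVneq t 0; first by rewrite (powlike0 _ _ _ _ _ pf).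
by rewrite ltW // powlike_gt0.
Qed.

Lemma tintegrable_powlike : tintegrable f.
Proof.
have [_ /andP[al'0 al'1]] := powlike_exp _ _ _ _ _ pf.
apply: (tintegrable_le _ (fun t => C * pw (- al') t)).
- exact: powlike_measurable _ _ _ _ _ pf.
- by apply: tintegrableZ; apply: tintegrable_pw; rewrite ltrN2.
- move=> t /torus_closed ht t0; rewrite ger0_norm ?powlike_ge0 //.
  by have /andP[] := powlike_bounds _ _ _ _ _ pf t ht t0.
Qed.

Lemma powlike_inv_le t : - pi <= t <= pi -> t != 0 -> (f t)^-1 <= c^-1 * pw (- al) t.
Proof.
move=> ht t0; have /andP[h _] := powlike_bounds _ _ _ _ _ pf t ht t0.
have [c0 _] := powlike_cst _ _ _ _ _ pf.
rewrite /pw powRN -invfM lef_pV2 ?posrE // ?powlike_gt0 //.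
by rewrite mulr_gt0 // pw_gt0.
Qed.

Lemma measurable_powlike_inv : measurable_fun torus (fun t => (f t)^-1).
Proof.
apply: (eq_measurable_fun (fun t => f t `^ (-1))).
  by move=> t; rewrite inE => /torus_closed ht; rewrite powR_inv1 // powlike_ge0.
apply: (@measurableT_comp _ _ _ _ _ _ (fun x : R => x `^ (-1))); first exact: measurable_powR.
exact: powlike_measurable _ _ _ _ _ pf.
Qed.

Lemma tintegrable_powlike_inv : tintegrable (fun t => (f t)^-1).
Proof.
have [/andP[al0 al1] _] := powlike_exp _ _ _ _ _ pf.
apply: (tintegrable_le _ (fun t => c^-1 * pw (- al) t)).
- exact: measurable_powlike_inv.
- by apply: tintegrableZ; apply: tintegrable_pw; rewrite ltrN2.
- move=> t /torus_closed ht t0; rewrite ger0_norm ?invr_ge0 ?powlike_ge0 //.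
  exact: powlike_inv_le.
Qed.

Lemma tintegrable_weight : tintegrable g.
Proof.
have [/andP[al0 al1] _] := powlike_exp _ _ _ _ _ pf.
apply: (tintegrable_le _ (fun t => C' * pw (- be) t)) => //.
- by apply: tintegrableZ; apply: tintegrable_pw; rewrite ltrN2 (le_lt_trans _ albe) // lerDr.
- by move=> t ht t0; have /andP[g0 gC] := hg t ht t0; rewrite ger0_norm.
Qed.

Lemma cut_le t d : torus t -> t != 0 ->
  c^-1 * pw_near (- al) d t * g t <= C' * c^-1 * pw_near (- (al + be)) d t.
Proof.
move=> ht t0; have /andP[g0 gC] := hg t ht t0.
have [c0 _] := powlike_cst _ _ _ _ _ pf.
rewrite /pw_near; case: ifP => _; last by rewrite !mulr0 mul0r.
rewrite opprD pwD // [leRHS](_ : _ = c^-1 * pw (- al) t * (C' * pw (- be) t)); last by ring.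
by rewrite ler_wpM2l // mulr_ge0 ?pw_ge0 // invr_ge0 ltW.
Qed.

(** Whichever of [x] and [t] is closer to 0 absorbs both powers, and it lies within [d] of 0 because
    [x] does. This is the separated majorant required by [tr_toeplitz_le]. *)
Lemma cut2_le x t d : torus x -> x != 0 -> torus t -> t != 0 ->
  c^-1 * pw_near (- al) d x * g t <=
  C' * c^-1 * pw_near (- (al + be)) d x + C' * c^-1 * pw_near (- (al + be)) d t.
Proof.
move=> hx x0 ht t0; have /andP[g0 gC] := hg t ht t0.
have [c0 _] := powlike_cst _ _ _ _ _ pf.
have [/andP[al0 al1] _] := powlike_exp _ _ _ _ _ pf.
have k0 : 0 <= C' * c^-1 by rewrite mulr_ge0 // invr_ge0 ltW.
have kn y : 0 <= C' * c^-1 * pw_near (- (al + be)) d y by rewrite mulr_ge0 // pw_near_ge0.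
rewrite {1}/pw_near; case: ifPn => xd; last by rewrite mulr0 mul0r addr_ge0.
have pwle (r a b : R) : 0 <= r -> a != 0 -> `|a| <= `|b| -> pw (- r) b <= pw (- r) a.
  move=> r0 a0 ab; rewrite /pw !powRN lef_pV2 ?posrE ?powR_gt0 ?normr_gt0 //.
    by rewrite ge0_ler_powR // nnegrE.
  by rewrite -normr_gt0 (lt_le_trans _ ab) // normr_gt0.
apply: (@le_trans _ _ (c^-1 * pw (- al) x * (C' * pw (- be) t))).
  by rewrite ler_wpM2l // mulr_ge0 ?pw_ge0 // invr_ge0 ltW.
rewrite [leLHS](_ : _ = C' * c^-1 * (pw (- al) x * pw (- be) t)); last by ring.
rewrite -mulrDr ler_wpM2l //.
have [xt|/ltW tx] := leP `|x| `|t|.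
  rewrite -[leLHS]addr0 lerD ?pw_near_ge0 // /pw_near xd opprD pwD // ler_wpM2l ?pw_ge0 //.
  exact: pwle.
rewrite -[leLHS]add0r lerD ?pw_near_ge0 // /pw_near (le_lt_trans tx xd) opprD pwD //.
by rewrite ler_wpM2r ?pw_ge0 //; exact: pwle.
Qed.

Lemma small_cut e : 0 < e -> exists d, [/\ 0 < d, d <= pi &
  (2 * pi)^-1 * tint (fun t => C' * c^-1 * pw_near (- (al + be)) d t) <= e].
Proof.
move=> e0; have [c0 _] := powlike_cst _ _ _ _ _ pf.
have pi0 := pi_gt0 R.
set s := al + be; have s1 : 0 < 1 - s by rewrite /s subr_gt0.
set K := (2 * pi)^-1 * (C' * c^-1) * 2 / (1 - s).
have K0 : 0 <= K.
  by rewrite /K divr_ge0 ?(ltW s1) // !mulr_ge0 // ?invr_ge0 ?(ltW c0) // ltW // mulr_gt0.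
set e' := (e / (K + 1)).
have e'0 : 0 < e' by rewrite divr_gt0 // ltr_wpDl.
(* The mass of the cut is at most [K d^(1 - s)], and this [d] gives [d^(1 - s) <= e']. *)
pose d := Num.min pi (e' `^ (1 - s)^-1).
have d0 : 0 < d by rewrite lt_min pi0 powR_gt0.
exists d; split => //; first by rewrite ge_min lexx.
have ns : -1 < - s by lra.
rewrite tintZ; last exact: tintegrable_pw_near.
have h1 := tint_pw_near _ _ ns d0.
have kk : 0 <= (2 * pi)^-1 * (C' * c^-1).
  by rewrite !mulr_ge0 // ?invr_ge0 ?(ltW c0) // ltW // mulr_gt0.
rewrite mulrA (le_trans (ler_wpM2l kk h1)) //.
have -> : (2 * pi)^-1 * (C' * c^-1) * (2 * (d `^ (- s + 1) / (- s + 1))) = K * d `^ (1 - s).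
  by rewrite /K [- s + 1]addrC; ring.
have h2 : d `^ (1 - s) <= e'.
  have -> : e' = (e' `^ (1 - s)^-1) `^ (1 - s).
    by rewrite -powRrM mulVf ?powRr1 ?gt_eqF // ltW.
  by rewrite ge0_ler_powR ?nnegrE ?powR_ge0 ?(ltW d0) ?(ltW s1) // ge_min lexx orbT.
rewrite (le_trans (ler_wpM2l K0 h2)) // /e' mulrA ler_pdivrMr ?ltr_wpDl //.
by rewrite mulrC ler_pM2l // lerDl.
Qed.

(** The factor [(1 - cos t)^2], of order [t^4], absorbs a pole of order below 1 and makes the symbol
    continuous at 0. *)
Let w t := f t * (1 - cos t) ^+ 2.

Lemma powlike_reg_ge0 t : - pi <= t <= pi -> 0 <= w t.
Proof. by move=> ht; rewrite /w mulr_ge0 ?powlike_ge0 // sqr_ge0. Qed.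

Lemma cont0pi_powlike_reg : cont0pi w.
Proof.
move=> t; rewrite /= in_itv /= => /andP[t0 tpi].
have [<-|tn0] := eqVneq 0 t; last first.
  apply: cvgM; first by apply: (powlike_cvg _ _ _ _ _ pf); rewrite lt_neqAle tn0 t0.
  rewrite expr2; apply: cvgM; by apply: cvg_within_filter; exact: continuous_one_sub_cos.
have [_ C0] := powlike_cst _ _ _ _ _ pf.
have [_ /andP[al'0 al'1]] := powlike_exp _ _ _ _ _ pf.
have pi0 := pi_gt0 R.
have w0 : w 0 = 0 by rewrite /w (powlike0 _ _ _ _ _ pf) mul0r.
rewrite w0.
(* From [f <= C x^(- al')], [(1 - cos x)^2 <= (pi x)^2] and [x^(1 - al') <= pi^(1 - al')], which
   together give [w x <= K x]. *)
set K := C * pi `^ (1 - al') * pi ^+ 2.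
have K0 : 0 <= K by apply: mulr_ge0 (sqr_ge0 _); apply: mulr_ge0 => //; exact: powR_ge0.
apply: (@squeeze_cvgr _ _ _ _ (fun=> 0) (fun x => K * x)).
- near=> x.
  have hx : 0 <= x <= pi.
    have : `[0, pi]%classic x by near: x; exact: withinT.
    by rewrite /= in_itv.
  have hx' : - pi <= x <= pi by move: hx; lra.
  rewrite powlike_reg_ge0 //=; have [x0|x0] := eqVneq x 0; first by rewrite x0 w0 mulr0.
  have /andP[_ fC] := powlike_bounds _ _ _ _ _ pf x hx' x0.
  have hc : 0 <= 1 - cos x by rewrite subr_ge0 cos_le1.
  have h1 : (1 - cos x) ^+ 2 <= x * x * pi ^+ 2.
    have h2 : 1 - cos x <= x * pi.
      rewrite (le_trans (one_sub_cos_le x)) //; move: hx => /andP[xx xp].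
      have := ler_wpM2l xx xp; have := mulr_ge0 xx xx; lra.
    have -> : x * x * pi ^+ 2 = (x * pi) ^+ 2 by ring.
    have xp0 : 0 <= x * pi by apply: mulr_ge0 (ltW pi0); case/andP: hx.
    by rewrite ler_pXn2r // nnegrE.
  rewrite /w (le_trans (ler_pM (powlike_ge0 _ hx') (sqr_ge0 _) fC h1)) //.
  have xp : 0 < x by rewrite lt_neqAle eq_sym x0; case/andP: hx.
  have -> : C * pw (- al') x * (x * x * pi ^+ 2) = C * (pw (- al') x * x) * pi ^+ 2 * x by ring.
  have -> : pw (- al') x * x = x `^ (1 - al').
    by rewrite /pw gtr0_norm // -{2}[x]powRr1 ?ltW // -powRD ?x0 ?implybT // addrC.
  rewrite /K ler_wpM2r ?(ltW xp) // ler_wpM2r ?sqr_ge0 // ler_wpM2l //.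
  by rewrite ge0_ler_powR ?nnegrE ?(ltW xp) ?(ltW pi0) ?subr_ge0 ?(ltW al'1) //; case/andP: hx.
- exact: cvg_cst.
- rewrite -[X in _ --> X](mulr0 K); apply: cvgM; first exact: cvg_cst.
  by apply: cvg_within_filter; exact: cvg_id.
Unshelve. all: by end_near. Qed.

(** Off 0 this is [1 / (f + k / (1 - cos t)^2)]: a continuous minorant of [1/f] that increases to it
    as [k] tends to 0. *)
Let psi k t := (1 - cos t) ^+ 2 / (w t + k).

Lemma reg_inverse_near d e : 0 < d -> 0 < e -> exists2 k, 0 < k &
  forall t, torus t -> t != 0 ->
    psi k t <= (f t)^-1 <= psi k t + e + c^-1 * pw_near (- al) d t.
Proof.
move=> d0 e0; have [c0 _] := powlike_cst _ _ _ _ _ pf.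
have [/andP[al0 al1] _] := powlike_exp _ _ _ _ _ pf.
set m := c * d `^ al; set s := d ^+ 2 / 8.
have m0 : 0 < m by rewrite mulr_gt0 // powR_gt0.
have s0 : 0 < s by rewrite divr_gt0 // exprn_gt0.
(* For [|t| >= d] one has [f >= m] and [1 - cos t >= s], so the gap [k / (f (w + k))] is at most
   [k / (m^2 s^2) = e]; for [|t| < d] the cut alone dominates [1/f]. *)
set k := e * m ^+ 2 * s ^+ 2.
have k0 : 0 < k by apply: mulr_gt0 (mulr_gt0 e0 (exprn_gt0 2 m0)) (exprn_gt0 2 s0).
exists k => //.
move=> t ht t0; have ht' := torus_closed _ ht.
have F0 := powlike_gt0 t ht' t0.
have u0 : 0 < 1 - cos t.
  apply: lt_le_trans (one_sub_cos_ge t ht'); rewrite divr_gt0 //.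
  by rewrite exprn_even_gt0.
have psi0 : 0 <= psi k t.
  by rewrite /psi divr_ge0 ?sqr_ge0 // addr_ge0 ?powlike_reg_ge0 // ltW.
have D0 : 0 < f t * (1 - cos t) ^+ 2 + k by rewrite ltr_wpDl // mulr_ge0 ?sqr_ge0 // ltW.
have dE : (f t)^-1 - psi k t = k / (f t * (f t * (1 - cos t) ^+ 2 + k)).
  by rewrite /psi /w; field; rewrite !gt_eqF.
have h0 : 0 <= (f t)^-1 - psi k t.
  by rewrite dE divr_ge0 ?(ltW k0) // mulr_ge0 // ltW.
rewrite -subr_ge0 h0 /= /pw_near; case: ifPn => td.
  rewrite (le_trans (powlike_inv_le t ht' t0)) // lerDr addr_ge0 //; exact: ltW.
rewrite mulr0 addr0 -lerBlDl dE ler_pdivrMr ?mulr_gt0 //.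
have td' : d <= `|t| by rewrite leNgt.
have mF : m <= f t.
  have /andP[+ _] := powlike_bounds _ _ _ _ _ pf t ht' t0.
  apply: le_trans; rewrite /m ler_pM2l // /pw ge0_ler_powR ?nnegrE //; exact: ltW.
have su : s <= 1 - cos t.
  apply: le_trans (one_sub_cos_ge t ht'); rewrite /s ler_pM2r // -(real_normK (num_real t)).
  by rewrite ler_pXn2r // nnegrE ltW.
have h1 : k <= e * (f t * (f t * (1 - cos t) ^+ 2)).
  rewrite /k -mulrA ler_pM2l // mulrA -expr2.
  by rewrite ler_pM ?sqr_ge0 // ler_pXn2r // nnegrE ltW.
apply: (le_trans h1); rewrite ler_pM2l // ler_pM2l // lerDl; exact: ltW.
Qed.

Lemma cont0pi_psi k : 0 < k -> cont0pi (fun t => (w t + k)^-1).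
Proof.
move=> k0; apply: cont0piV.
  apply: cont0piD; first exact: cont0pi_powlike_reg.
  by apply: cont0pi_cont => t; exact: cvg_cst.
move=> t ht; rewrite gt_eqF // ltr_wpDl // powlike_reg_ge0 //.
by have := pi_gt0 R; move: ht; lra.
Qed.

Lemma even_reg t : - pi <= t <= pi -> w (- t) = w t.
Proof. by move=> ht; rewrite /w (powlike_even _ _ _ _ _ pf) ?cosN. Qed.

Lemma tintegrable_cut d :
  tintegrable (fun t => C' * c^-1 * pw_near (- (al + be)) d t).
Proof. by apply: tintegrableZ; apply: tintegrable_pw_near; rewrite ltrN2. Qed.

Lemma tintegrable_cospolyM N p : tintegrable (fun t => cospoly N p t * g t).
Proof.
have [M [M0 hM]] := cospoly_bounded N p.
have h := tintegrableMb _ _ M tintegrable_weight (measurable_torus_cont _ (continuous_cospoly N p)) (fun t _ => hM t).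
rewrite (_ : (fun t => _) = (fun t => g t * cospoly N p t)) //.
by apply/funext => t; rewrite mulrC.
Qed.

Lemma measurable_ratio : measurable_fun torus (fun t => g t / f t).
Proof. by apply: measurable_funM => //; exact: measurable_powlike_inv. Qed.

Lemma tintegrable_ratio : tintegrable (fun t => g t / f t).
Proof.
apply: (tintegrable_le _ (fun t => C' * c^-1 * pw (- (al + be)) t)).
- exact: measurable_ratio.
- by apply: tintegrableZ; apply: tintegrable_pw; rewrite ltrN2.
- move=> t ht t0; have /andP[g0 gC] := hg t ht t0.
  have ht' := torus_closed _ ht.
  rewrite ger0_norm; last by rewrite divr_ge0 // powlike_ge0.
  apply: (le_trans (ler_pM g0 _ gC (powlike_inv_le t ht' t0))).
    by rewrite invr_ge0 powlike_ge0.
  by rewrite opprD pwD // le_eqVlt; apply/orP; left; apply/eqP; ring.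
Qed.

Lemma weight_mass_ge0 : 0 <= (2 * pi)^-1 * tint g.
Proof.
rewrite mulr_ge0 //; first exact: ltW inv2pi_gt0.
rewrite -(mul0r (2 * pi)) -tint_cst; apply: le_tint; first exact: tintegrable_cst.
  exact: tintegrable_weight.
by move=> t ht t0; have /andP[] := hg t ht t0.
Qed.

(* Multiplying the pointwise bound [1/f <= psi + e + cut] by [g]. *)
Lemma inverse_upper_approx e : 0 < e -> exists N p d, [/\ 0 < d,
  forall t, torus t -> t != 0 -> (f t)^-1 <= cospoly N p t + c^-1 * pw_near (- al) d t,
  (2 * pi)^-1 * tint (fun t => cospoly N p t * g t) <= (2 * pi)^-1 * tint (fun t => g t / f t) + e &
  (2 * pi)^-1 * tint (fun t => C' * c^-1 * pw_near (- (al + be)) d t) <= e].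
Proof.
move=> e0; have [d [d0 dpi hd]] := small_cut e e0.
set G := (2 * pi)^-1 * tint g; have G0 : 0 <= G := weight_mass_ge0.
pose e1 := e / (3 * (G + 1)).
have e10 : 0 < e1 by rewrite divr_gt0 // mulr_gt0 // ltr_wpDl.
have [k k0 hk] := reg_inverse_near d e1 d0 e10.
have cpsi : cont0pi (psi k).
  apply: cont0piM; last exact: cont0pi_psi.
  rewrite (_ : (fun t => (1 - cos t) ^+ 2) = (fun t => (1 - cos t) * (1 - cos t))).
    by apply: cont0piM; apply: cont0pi_cont; exact: continuous_one_sub_cos.
  by apply/funext => t; rewrite expr2.
have epsi t : - pi <= t <= pi -> psi k (- t) = psi k t by move=> ht; rewrite /psi even_reg ?cosN.
have [N0 [p0 hp0]] := cospoly_approx (psi k) e1 cpsi epsi e10.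
(* One [e1] pays for the polynomial approximation of [psi k], the other for [1/f - psi k]. The total
   excess over [1/f] is then at most [3 e1], whence the 3 in [e1]. *)
have [N [p hp]] : is_cospoly (fun t => cospoly N0 p0 t + 2 * e1).
  by apply: is_cospolyD; [exists N0, p0|exact: is_cospoly_cst].
exists N, p, d; split => //.
  move=> t ht t0; have /andP[_ h2] := hk t ht t0.
  apply: (le_trans h2); rewrite lerD2r -hp.
  have := hp0 t (torus_closed _ ht); rewrite ler_norml; lra.
rewrite -lerBlDl -mulrBr.
have i1 := tintegrable_cospolyM N p; have i2 := tintegrable_ratio.
have ig := tintegrable_weight.
rewrite -tintB //.
have le3 : tint (fun t => cospoly N p t * g t - g t / f t) <= tint (fun t => 3 * e1 * g t).
  apply: le_tint; [exact: tintegrableB|exact: tintegrableZ|] => t ht t0.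
  have /andP[g0 _] := hg t ht t0; have /andP[h1 _] := hk t ht t0.
  rewrite [g t / _]mulrC -mulrBl ler_wpM2r // -hp.
  have := hp0 t (torus_closed _ ht); rewrite ler_norml; lra.
apply: (le_trans (ler_wpM2l (ltW inv2pi_gt0) le3)).
rewrite tintZ // mulrCA -/G /e1.
have -> : 3 * (e / (3 * (G + 1))) * G = e * (G / (G + 1)).
  by field; rewrite gt_eqF // ltr_wpDl.
by rewrite ler_piMr ?(ltW e0) // ler_pdivrMr ?ltr_wpDl // mul1r lerDl.
Qed.

(* The minorant is [2 phi - f phi^2], the value at [phi] of the quadratic whose maximum is [1/f]. *)
Lemma inverse_lower_approx e : 0 < e -> exists N phi M p,
  (forall t, torus t -> t != 0 -> f t * cospoly N phi t ^+ 2 <= cospoly M p t) /\ (2 * pi)^-1 * tint (fun t => g t / f t) - e <=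
  2 * ((2 * pi)^-1 * tint (fun t => cospoly N phi t * g t)) - (2 * pi)^-1 * tint (fun t => cospoly M p t * g t).
Proof.
move=> e0; have e30 : 0 < e / 3 by rewrite divr_gt0.
have [d [d0 dpi hd]] := small_cut (e / 3) e30.
set G := (2 * pi)^-1 * tint g; have G0 : 0 <= G := weight_mass_ge0.
pose e1 := e / 3 / (G + 1).
have e10 : 0 < e1 by rewrite divr_gt0 // ltr_wpDl.
have [k k0 hk] := reg_inverse_near d e1 d0 e10.
(* Only [v = psi / (1 - cos t)] is approximated, by a polynomial [a]. Then [phi = (1 - cos t) a],
   and [f phi^2 = w a^2] is continuous although [f] may have a pole. *)
pose v t := (1 - cos t) * (w t + k)^-1.
have cv : cont0pi v.
  apply: cont0piM; last exact: cont0pi_psi.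
  by apply: cont0pi_cont; exact: continuous_one_sub_cos.
have ev t : - pi <= t <= pi -> v (- t) = v t by move=> ht; rewrite /v even_reg ?cosN.
have [W [W0 hW]] := cont0pi_bounded w cont0pi_powlike_reg.
have hW' t : - pi <= t <= pi -> w t <= W.
  move=> ht; rewrite (le_trans (ler_norm _)) //.
  have [t0|t0] := leP 0 t; first by apply: hW; lra.
  by rewrite -even_reg //; apply: hW; lra.
pose K := 4 + W * (4 / k + 1) + 2.
have K0 : 0 < K.
  by rewrite /K addr_gt0 // ltr_wpDr // mulr_ge0 ?(ltW W0) // addr_ge0 // divr_ge0 // ltW.
pose e2 := Num.min 1 (e1 / K).
have e20 : 0 < e2 by rewrite lt_min ltr01 divr_gt0.
have [N1 [a1 ha1]] := cospoly_approx v e2 cv ev e20.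
have [N [phi hphi]] : is_cospoly (fun t => cospoly N1 a1 t + -1 * (cos t * cospoly N1 a1 t)).
  apply: is_cospolyD; first by exists N1, a1.
  by apply/is_cospolyZ/is_cospoly_cosM; exists N1, a1.
have cf : cont0pi (fun t => w t * (cospoly N1 a1 t * cospoly N1 a1 t)).
  apply: cont0piM; first exact: cont0pi_powlike_reg.
  by apply: cont0piM; apply: cont0pi_cont; exact: continuous_cospoly.
have cpN t : cospoly N1 a1 (- t) = cospoly N1 a1 t.
  by apply: eq_bigr => m _; rewrite mulrN cosN.
have ef t : - pi <= t <= pi -> w (- t) * (cospoly N1 a1 (- t) * cospoly N1 a1 (- t)) = w t * (cospoly N1 a1 t * cospoly N1 a1 t).
  by move=> ht; rewrite even_reg ?cpN.
have [M0 [p0 hp0]] := cospoly_approx _ e2 cf ef e20.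
(* The shift by [e2] turns an approximation of [f phi^2] into a majorant. *)
have [M [p hp]] : is_cospoly (fun t => cospoly M0 p0 t + e2).
  by apply: is_cospolyD; [exists M0, p0|exact: is_cospoly_cst].
have phiE t : cospoly N phi t = (1 - cos t) * cospoly N1 a1 t by rewrite -hphi; ring.
exists N, phi, M, p; split.
  move=> t ht t0; rewrite phiE exprMn mulrA -/(w t) -hp.
  have := hp0 t (torus_closed _ ht); rewrite ler_norml expr2; lra.
have ip := tintegrable_cospolyM M p; have iphi := tintegrable_cospolyM N phi.
have ir := tintegrable_ratio; have ig := tintegrable_weight.
have ic := tintegrable_cut d.
have key : tint (fun t => g t / f t) <= tint (fun t => 2 * (cospoly N phi t * g t) - cospoly M p t * g t +
    (2 * e1 * g t + C' * c^-1 * pw_near (- (al + be)) d t)).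
  apply: le_tint => //.
    apply: tintegrableD; first by apply: tintegrableB => //; exact: tintegrableZ.
    by apply: tintegrableD => //; exact: tintegrableZ.
  move=> t ht t0; have ht' := torus_closed _ ht.
  have /andP[g0 _] := hg t ht t0; have /andP[_ h2] := hk t ht t0.
  have hcut := cut_le t d ht t0.
  have psiE : psi k t = (1 - cos t) * v t by rewrite /psi /v expr2 mulrA.
  have wk0 : 0 < w t + k by rewrite ltr_wpDl // powlike_reg_ge0.
  have u02 : 0 <= 1 - cos t <= 2 by have := cos_geN1 t; have := cos_le1 t; lra.
  have hv : `|v t| <= 2 / k.
    rewrite /v ger0_norm; last by rewrite divr_ge0 ?(ltW wk0) //; case/andP: u02.
    rewrite ler_pM ?invr_ge0 ?(ltW wk0) //; try by case/andP: u02.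
    by rewrite lef_pV2 ?posrE // lerDr powlike_reg_ge0.
  have := @square_completion R (1 - cos t) (v t) (cospoly N1 a1 t) (w t) k W e2 u02 k0.
  rewrite powlike_reg_ge0 // hW' // (ltW e20) ge_min lexx ha1 // hv /=.
  move=> /(_ isT isT).
  have -> : (w t + k) * v t = 1 - cos t by rewrite /v mulrCA divff ?mulr1 // gt_eqF.
  move=> /(_ erefl isT isT); rewrite -psiE -/K => h3.
  have Ke : K * e2 <= e1.
    by rewrite -ler_pdivlMl // mulrC ge_min lexx orbT.
  have h4 : cospoly M p t <= w t * cospoly N1 a1 t ^+ 2 + 2 * e2.
    by rewrite -hp; have := hp0 t ht'; rewrite ler_norml expr2; lra.
  have h5 : (f t)^-1 <= 2 * cospoly N phi t - cospoly M p t + 2 * e1 + c^-1 * pw_near (- al) d t.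
    by rewrite phiE; lra.
  have := ler_wpM2r g0 h5; rewrite mulrC [in X in _ <= X]mulrDl [in X in _ <= X]mulrDl mulrBl -mulrA; lra.
move: key; rewrite tintD; last 2 first.
  - by apply: tintegrableB => //; exact: tintegrableZ.
  - by apply: tintegrableD => //; exact: tintegrableZ.
rewrite tintB //; last exact: tintegrableZ.
rewrite tintD //; last exact: tintegrableZ.
rewrite !(tintZ 2) // (tintZ (2 * e1)) // => /(ler_wpM2l (ltW (inv2pi_gt0 (R := R)))).
have : 2 * e1 * G <= 2 * (e / 3).
  rewrite /e1 -mulrA ler_pM2l // -mulrA ler_piMr ?(ltW e30) // mulrC ler_pdivrMr ?ltr_wpDl //.
  by rewrite mul1r lerDl.
move: hd; rewrite /G.
move: (tint (fun t => C' / c * _)) (tint (fun t => g t / f t)) (tint g) (tint (fun t => cospoly N phi t * g t))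
  (tint (fun t => cospoly M p t * g t)) ((2 * pi)^-1) => x1 x2 x3 x4 x5 q h1 h2.
rewrite !mulrDr mulrN; move: h1 h2.
have -> : 2 * e1 * (q * x3) = q * (2 * e1 * x3) by ring.
have -> : q * (2 * x4) = 2 * (q * x4) by ring.
lra.
Qed.

End SymbolApproximation.

(** * The inverse form at a fixed parameter *)

Section WindowedForm.
Context {R : realType}.
Implicit Types (h f g : R -> R) (t : R).

(** Polarization, from the diagonal bound [|<z, T(h) z>| <= M |z|^2]. *)
Lemma normr_qform_toeplitz h (M : R) n (x y : 'cV[R]_n) : tintegrable h ->
  (forall t, torus t -> t != 0 -> `|h t| <= M) ->
  `|qform (toeplitz n h) x y| <= M / 2 * (dotv x x + dotv y y).
Proof.
move=> ih hM.
have bd z : `|qform (toeplitz n h) z z| <= M * dotv z z.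
  have ic (k : R) : tintegrable (fun=> k) := tintegrable_cst k.
  have E k : qform (toeplitz n (fun=> k)) z z = k * dotv z z by rewrite toeplitz_cst qform_scalar.
  rewrite ler_norml -mulNr -!E; apply/andP; split; apply: le_qform_toeplitz => // t ht t0;
    by have := hM t ht t0; rewrite ler_norml => /andP[].
have qC : qform (toeplitz n h) y x = qform (toeplitz n h) x y by rewrite qformC // toeplitz_sym.
have -> : qform (toeplitz n h) x y =
    4^-1 * (qform (toeplitz n h) (x + y) (x + y) - qform (toeplitz n h) (x - y) (x - y)).
  by rewrite !qformDl !qformDr !qformNl !qformNr qC; field.
rewrite normrM gtr0_norm ?invr_gt0 //.
have -> : M / 2 * (dotv x x + dotv y y) = 4^-1 * (M * dotv (x + y) (x + y) + M * dotv (x - y) (x - y)).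
  by rewrite !dotvDl !dotvDr !dotvNl !dotvNr (dotvC y x); field.
rewrite ler_pM2l ?invr_gt0 // (le_trans (ler_normB _ _)) //.
by rewrite lerD.
Qed.

Definition window (N n i : nat) : R := ((N <= i) && (i + N < n))%N%:R.

Definition cut_vec N n (x : 'cV[R]_n) : 'cV[R]_n := \col_i (window N n i * x i ord0).

Lemma window01 N n i : 0 <= window N n i <= 1.
Proof. by rewrite /window ler0n lern1 leq_b1. Qed.

Lemma window_weightP N n : window_weight n N (window N n).
Proof. by split=> [i|i h1 h2]; [exact: window01|rewrite /window h1 h2]. Qed.

Lemma window_weight1 N n : window_weight n N (fun=> 1 : R).
Proof. by split=> [i|//]; rewrite ler01 lexx. Qed.

Lemma dotv_cut_vec_le N n (x : 'cV[R]_n) : dotv (cut_vec N n x) (cut_vec N n x) <= dotv x x.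
Proof.
rewrite !dotvE; apply: ler_sum => i _; rewrite mxE /window.
by case: (_ && _); rewrite ?mul1r // !mul0r -expr2 sqr_ge0.
Qed.

(* The form [x |-> 2 <x, T(phi) D x> - <D x, T(p) D x>], where [D] kills the first and last [N]
   coordinates so that [T(phi) D] acts as multiplication by [phi]. *)
Definition minorant N n phi p : 'M[R]_n := \matrix_(i, j)
  ((window N n i + window N n j) * fourier_coef phi (i%:Z - j%:Z)
   - window N n i * window N n j * fourier_coef p (i%:Z - j%:Z)).

Lemma minorant_sym N n phi p : (minorant N n phi p)^T = minorant N n phi p.
Proof.
apply/matrixP => i j; rewrite !mxE -[in LHS]fourier_coefN opprB.
rewrite -[in X in _ - X = _]fourier_coefN opprB; ring.
Qed.

Lemma qform_minorant N n phi p (x : 'cV[R]_n) : qform (minorant N n phi p) x x =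
  2 * qform (toeplitz n phi) x (cut_vec N n x) - qform (toeplitz n p) (cut_vec N n x) (cut_vec N n x).
Proof.
have sumE (S : 'M[R]_n) (a b : 'cV[R]_n) : qform S a b = \sum_i \sum_j a i ord0 * S i j * b j ord0.
  rewrite qformE dotvE; apply: eq_bigr => i _; rewrite mxE mulr_sumr.
  by apply: eq_bigr => j _; rewrite mulrA.
have -> : 2 * qform (toeplitz n phi) x (cut_vec N n x) =
    qform (toeplitz n phi) x (cut_vec N n x) + qform (toeplitz n phi) (cut_vec N n x) x.
  by rewrite (qformC _ (cut_vec N n x)) ?toeplitz_sym // mulr_natl mulr2n.
rewrite !sumE -big_split -sumrB; apply: eq_bigr => i _.
rewrite -big_split -sumrB; apply: eq_bigr => j _; rewrite !mxE /=; ring.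
Qed.

Lemma tr_minorant N n phi p g : \tr (minorant N n phi p *m toeplitz n g) =
  \sum_(i < n) \sum_(k < n) window N n i * 1 * (fourier_coef phi (i%:Z - k%:Z) * fourier_coef g (i%:Z - k%:Z))
  + \sum_(i < n) \sum_(k < n) 1 * window N n k * (fourier_coef phi (i%:Z - k%:Z) * fourier_coef g (i%:Z - k%:Z))
  - \sum_(i < n) \sum_(k < n) window N n i * window N n k * (fourier_coef p (i%:Z - k%:Z) * fourier_coef g (i%:Z - k%:Z)).
Proof.
rewrite /mxtrace -big_split -sumrB; apply: eq_bigr => i _; rewrite mxE -big_split -sumrB.
apply: eq_bigr => k _; rewrite !mxE /= -[fourier_coef g (k%:Z - _)]fourier_coefN opprB; ring.
Qed.

(** The variational bound at [y = T(phi) D x]. Since [T(phi)] multiplies by [phi] on the range of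
    [D], [<y, T(f) y>] is the form of the symbol [f phi^2] at [D x], dominated by that of the
    polynomial [p]. *)
Lemma minorant_le_inverse f N phi M p n (x : 'cV[R]_n) : tintegrable f -> tintegrable (fun t => (f t)^-1) ->
  (forall t, torus t -> t != 0 -> 0 < f t) ->
  (forall t, torus t -> t != 0 -> f t * cospoly N phi t ^+ 2 <= cospoly M p t) ->
  qform (minorant N n (cospoly N phi) (cospoly M p)) x x <= qform (invmx (toeplitz n f)) x x.
Proof.
move=> fi ii f0 fp; set z := cut_vec N n x; set y := toeplitz n (cospoly N phi) *m z.
have hu : toeplitz n f \in unitmx.
  by apply: (toeplitz_unit f (fun t => (f t)^-1)) => // t ht t0; split => //; exact: f0.
have ps : psd (toeplitz n f) by apply: psd_toeplitz => // t ht t0; exact: ltW (f0 t ht t0).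
apply: le_trans (invmx_qform_ge _ x y ps hu).
rewrite qform_minorant -/z qformE -/y lerD2l lerN2.
rewrite !qform_toeplitz //; last exact: tintegrable_cospoly.
rewrite ler_pM2l ?inv2pi_gt0 //; apply: le_tint.
- exact: tintegrable_spec.
- exact: tintegrable_spec (tintegrable_cospoly _ _).
move=> t ht t0; have zk (i : 'I_n) : ~~ ((N <= i) && (i + N < n))%N -> z i ord0 = 0.
  by rewrite mxE /window => /negbTE ->; rewrite mul0r.
have [e1 e2] := toeplitz_cospolyM N phi n z zk t.
have -> : spec y y t = cospoly N phi t ^+ 2 * spec z z t by rewrite /spec e1 e2; ring.
by rewrite mulrA ler_wpM2r ?spec_ge0 // fp.
Qed.

Lemma tr_minorant_cvg N phi M p g : tintegrable g ->
  exists K, 0 <= K /\ forall n, `|\tr (minorant N n (cospoly N phi) (cospoly M p) *m toeplitz n g)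
    - n%:R * (2 * ((2 * pi)^-1 * tint (fun t => cospoly N phi t * g t))
              - (2 * pi)^-1 * tint (fun t => cospoly M p t * g t))| <= K.
Proof.
move=> ig; have [K1 [K10 h1]] := weighted_trace_cospoly N phi N g ig.
have [K2 [K20 h2]] := weighted_trace_cospoly M p N g ig.
exists (K1 + K1 + K2); split; first by rewrite !addr_ge0.
move=> n; rewrite tr_minorant.
have := h1 n _ _ (window_weightP N n) (window_weight1 N n).
have := h1 n _ _ (window_weight1 N n) (window_weightP N n).
have := h2 n _ _ (window_weightP N n) (window_weightP N n).
move: (\sum_(i < n) _) (\sum_(i < n) _) (\sum_(i < n) _) => s1 s2 s3.
move: (_ * tint _) (_ * tint _) => a b; rewrite !ler_norml; lra.
Qed.

End WindowedForm.

(** * Almost sure limit of the normalized inverse form *)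

Section PointwiseLimit.
Context {R : realType} {d : measure_display} {T : measurableType d} (P : probability T R).
Variables (f g : R -> R) (al al' be c C C' : R) (xi : forall n, T -> 'cV[R]_n).
Hypothesis pf : powlike_symbol f al al' c C.
Hypotheses (be0 : 0 <= be) (albe : al + be < 1) (C'0 : 0 <= C').
Hypothesis mg : measurable_fun torus g.
Hypothesis hg : forall t, torus t -> t != 0 -> 0 <= g t <= C' * pw (- be) t.
Hypothesis gxi : forall n, (1 <= n)%N -> centered_gaussian_vector P (xi n) (toeplitz n g).

Let ig : tintegrable g.
Proof. exact: tintegrable_weight pf albe mg hg. Qed.

Let be1 : be < 1.
Proof.
have [/andP[al0 _] _] := powlike_exp _ _ _ _ _ pf.
by apply: le_lt_trans albe; rewrite lerDr.
Qed.

Let pg n : psd (toeplitz n g).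
Proof. by apply: psd_toeplitz => // t ht t0; have /andP[] := hg t ht t0. Qed.

Let f0 t : torus t -> t != 0 -> 0 < f t.
Proof. by move=> /torus_closed; exact: powlike_gt0 pf t. Qed.

(** [A] may be indefinite while the concentration bound is for positive forms, so [A] is written as
    the difference of [A + c0] and [c0], both positive and at most [2 c0]. *)
Lemma bounded_form_ae_cvg (A : forall n, 'M[R]_n) (c0 M : R) : 0 < c0 ->
  (forall n, (A n)^T = A n) -> (forall n x, `|qform (A n) x x| <= c0 * dotv x x) ->
  (forall n, (1 <= n)%N -> \tr (A n *m toeplitz n g) <= M * n%:R) ->
  \forall w \ae P, (qform (A n) (xi n w) (xi n w) - \tr (A n *m toeplitz n g)) / n%:R @[n --> \oo] --> (0 : R).
Proof.
move=> c00 sA nA trA.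
have [K [K0 hK]] := qform_toeplitz_powR g C' be be0 be1 C'0 ig
  (fun t ht t0 => ltac:(by have /andP[] := hg t ht t0)).
pose G := `|fourier_coef g 0|; have G0 : 0 <= G := normr_ge0 _.
pose M' := `|M| + c0 * G + 1.
have M'0 : 0 < M' by rewrite /M' ltr_wpDl // addr_ge0 // mulr_ge0 // ltW.
have cG : 0 <= c0 * G by rewrite mulr_ge0 // ltW.
have trc n : \tr (c0%:M *m toeplitz n g) = c0 * (n%:R * fourier_coef g 0).
  by rewrite mul_scalar_mx mxtraceZ tr_toeplitz.
have trcle n : \tr (c0%:M *m toeplitz n g) <= c0 * G * n%:R.
  by rewrite trc -mulrA ler_pM2l // mulrC ler_wpM2r // ler_norm.
have qc n x : qform (c0%:M : 'M[R]_n) x x = c0 * dotv x x by rewrite qform_scalar.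
have L0 : 0 < 2 * c0 * K by rewrite !mulr_gt0.
have conc (B : forall n, 'M[R]_n) : (forall n, (1 <= n)%N -> [/\ psd (B n),
    \tr (B n *m toeplitz n g) <= M' * n%:R & forall x, qform (B n) x x <= 2 * c0 * dotv x x]) ->
  \forall w \ae P, (qform (B n) (xi n w) (xi n w) - \tr (B n *m toeplitz n g)) / n%:R @[n --> \oo] --> (0 : R).
  move=> hB; apply: (quadratic_form_ae_cvg P xi (fun n => toeplitz n g) B (2 * c0 * K) M' be) => // n n1.
  have [pB tB nB] := hB n n1; split => //; first exact: gxi.
  exists (2 * c0), (K * n%:R `^ be); split => //.
  - by rewrite mulr_gt0.
  - by rewrite mulr_gt0 // powR_gt0 // ltr0n.
  - by rewrite mulrA.
  - by move=> x; exact: hK.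
have h1 := conc (fun n => A n + c0%:M) _.
have h2 := conc (fun n => c0%:M) _.
apply: filterS2 (h1 _) (h2 _).
- move=> w q1 q2; rewrite -[X in _ --> X](subr0 0); apply: cvg_trans (cvgB q1 q2).
  apply: near_eq_cvg; near=> n.
  change ((qform (A n + c0%:M) (xi n w) (xi n w) - \tr ((A n + c0%:M) *m toeplitz n g)) / n%:R
    - (qform c0%:M (xi n w) (xi n w) - \tr (c0%:M *m toeplitz n g)) / n%:R =
    (qform (A n) (xi n w) (xi n w) - \tr (A n *m toeplitz n g)) / n%:R).
  by rewrite mulmxDl mxtraceD qform_addM; ring.
- move=> n n1; split.
  + split; first by rewrite linearD /= sA tr_scalar_mx.
    move=> x; rewrite qform_addM qc; have := nA n x; rewrite ler_norml; lra.
  + rewrite mulmxDl mxtraceD /M' !mulrDl.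
    have := trA n n1; have := trcle n; have n0 : 0 <= n%:R :> R by [].
    have := ler_wpM2r n0 (ler_norm M); lra.
  + by move=> x; rewrite qform_addM qc; have := nA n x; rewrite ler_norml; lra.
- move=> n n1; split.
  + split; first by rewrite tr_scalar_mx.
    by move=> x; rewrite qc mulr_ge0 ?dotv_ge0 // ltW.
  + rewrite (le_trans (trcle n)) // ler_wpM2r // /M'.
    have := normr_ge0 M; lra.
  + move=> x; rewrite qc; have := mulr_ge0 (ltW c00) (dotv_ge0 x); lra.
Unshelve. all: by end_near. Qed.

Let Q n w := n%:R^-1 * qform (invmx (toeplitz n f)) (xi n w) (xi n w).
Let Finf := (2 * pi)^-1 * tint (fun t => g t / f t).

(** Here [e] comes before the null set, because the minorant depends on it; countably many values of
    [e] suffice later. *)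
Lemma inverse_form_liminf e : 0 < e -> \forall w \ae P, \forall n \near \oo, Finf - e <= Q n w.
Proof.
(* Three shares: approximation of the symbol, boundary error of the trace, random fluctuation. *)
move=> e0; have e30 : 0 < e / 3 by rewrite divr_gt0.
have [N [phi [M [p [fp hp]]]]] := inverse_lower_approx f g al al' be c C C' pf albe C'0 mg hg (e / 3) e30.
have [K [K0 hK]] := tr_minorant_cvg N phi M p g ig.
set L := 2 * _ - _ in hp hK; clearbody L.
pose A n := minorant N n (cospoly N phi) (cospoly M p).
have [M1 [M10 hM1]] := cospoly_bounded N phi.
have [M2 [M20 hM2]] := cospoly_bounded M p.
have hA n x : `|qform (A n) x x| <= (2 * M1 + M2) * dotv x x.
  rewrite qform_minorant; set z := cut_vec N n x.
  have zx : dotv z z <= dotv x x := dotv_cut_vec_le N n x.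
  have b1 := normr_qform_toeplitz _ M1 n x z (tintegrable_cospoly N phi) (fun t _ _ => hM1 t).
  have b2 := normr_qform_toeplitz _ M2 n z z (tintegrable_cospoly M p) (fun t _ _ => hM2 t).
  have := ler_wpM2l (ltW M10) zx; have := ler_wpM2l (ltW M20) zx.
  move: b1 b2; rewrite !ler_norml; lra.
have h := @bounded_form_ae_cvg A (2 * M1 + M2) (`|L| + K) _ _ hA _.
apply: filterS (h _ _ _).
- move=> w /cvgr_dist_le /(_ (e / 3) e30) hw; near=> n.
  have n1 : (1 <= n)%N by near: n; exact: nbhs_infty_ge.
  have n0 : 0 < n%:R :> R by rewrite ltr0n.
  have Kn : K <= e / 3 * n%:R.
    by rewrite -ler_pdivrMl // mulrC; near: n; exact: nbhs_infty_ger.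
  have h1 : `|0 - (qform (A n) (xi n w) (xi n w) - \tr (A n *m toeplitz n g)) / n%:R| <= e / 3.
    by near: n.
  have h2 := minorant_le_inverse f N phi M p n (xi n w) (tintegrable_powlike _ _ _ _ _ pf)
    (tintegrable_powlike_inv _ _ _ _ _ pf) f0 fp.
  rewrite /Q -ler_pdivrMl ?invr_gt0 // invrK; apply: le_trans h2.
  move: h1; rewrite sub0r normrN normrM normfV [`|n%:R|]gtr0_norm // ler_pdivrMr // ler_norml => /andP[h1 _].
  have := hK n; rewrite ler_norml => /andP[h2 _].
  have := ler_wpM2l (ltW n0) hp; rewrite -/Finf -/(A n) in h2 *; rewrite !mulrBr.
  have -> : n%:R * (e / 3) = e / 3 * n%:R by rewrite mulrC.
  have -> : n%:R * e = e / 3 * n%:R + e / 3 * n%:R + e / 3 * n%:R by field.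
  move: h1 h2; lra.
- by rewrite addr_gt0 // mulr_gt0.
- by move=> n; exact: minorant_sym.
- move=> n n1; have n1' : 1 <= n%:R :> R by rewrite ler1n.
  have := hK n; rewrite ler_norml => /andP[_ h2].
  have := ler_wpM2r (ler0n R n) (ler_norm L); have := ler_peMr K0 n1'; rewrite mulrDl (mulrC L); lra.
Unshelve. all: by end_near. Qed.

(** The majorant [T_n(1/f)] is the same for all [e], so one null set serves them all. Its norm
    [O(n^al)] and the norm [O(n^be)] of the covariance are compatible with concentration as
    [al + be < 1]; [e] enters only in the deterministic estimate of the trace. *)
Lemma inverse_form_limsup : \forall w \ae P, forall e, 0 < e -> \forall n \near \oo, Q n w <= Finf + e.
Proof.
have [c0 C0] := powlike_cst _ _ _ _ _ pf; have [/andP[al0 al1] _] := powlike_exp _ _ _ _ _ pf.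
have ifv : tintegrable (fun t => (f t)^-1) := tintegrable_powlike_inv _ _ _ _ _ pf.
have iff' : tintegrable f := tintegrable_powlike _ _ _ _ _ pf.
pose B n := toeplitz n (fun t => (f t)^-1).
have fle t : torus t -> t != 0 -> (f t)^-1 <= c^-1 * pw (- al) t.
  by move=> ht t0; apply: (powlike_inv_le f al al' c C pf) => //; exact: torus_closed.
have fv0 t : torus t -> t != 0 -> 0 <= (f t)^-1 by move=> ht t0; rewrite invr_ge0 ltW // f0.
have ci0 : 0 <= c^-1 by rewrite invr_ge0 ltW.
have [K1 [K10 hK1]] := qform_toeplitz_powR _ c^-1 al al0 al1 ci0 ifv fle.
have [K2 [K20 hK2]] := qform_toeplitz_powR g C' be be0 be1 C'0 ig
  (fun t ht t0 => ltac:(by have /andP[] := hg t ht t0)).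
have cutM dl n : \tr (toeplitz n (fun t => c^-1 * pw_near (- al) dl t) *m toeplitz n g) <=
    2 * n%:R * ((2 * pi)^-1 * tint (fun t => C' * c^-1 * pw_near (- (al + be)) dl t)).
  have -> : (2 * pi)^-1 * tint (fun t => C' * c^-1 * pw_near (- (al + be)) dl t) =
      fourier_coef (fun t => C' * c^-1 * pw_near (- (al + be)) dl t) 0.
    rewrite fourier_coefE; congr (_ * tint _); apply/funext => t.
    by rewrite mul0r cos0 mul1r.
  apply: tr_toeplitz_le => //.
  - by apply: tintegrableZ; apply: tintegrable_pw_near; rewrite ltrN2.
  - exact: tintegrable_cut.
  - by move=> x t hx x0 ht t0; exact: (cut2_le f g al al' be c C C' pf).
have trle a b n : tintegrable a -> tintegrable b -> (forall t, torus t -> t != 0 -> a t <= b t) ->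
    \tr (toeplitz n a *m toeplitz n g) <= \tr (toeplitz n b *m toeplitz n g).
  move=> ia ib ab; rewrite -subr_ge0 -raddfB /= -mulmxBl; apply: tr_psdM_ge0 => //.
  split=> [|x]; first by rewrite linearB /= !toeplitz_sym.
  by rewrite qform_addM qform_oppM subr_ge0; exact: le_qform_toeplitz.
have pi0 := pi_gt0 R.
(* On the torus a cut at [2 pi] is the full power, which bounds the trace by a multiple of [n]. *)
have trB n : \tr (B n *m toeplitz n g) <= \tr (toeplitz n (fun t => c^-1 * pw_near (- al) (2 * pi) t) *m toeplitz n g).
  apply: trle => //; first by apply: tintegrableZ; apply: tintegrable_pw_near; rewrite ltrN2.
  move=> t ht t0; rewrite /pw_near ifT ?fle //.
  by have := torus_closed _ ht; rewrite ltr_norml; lra.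
set M0 := `|(2 * pi)^-1 * tint (fun t => C' * c^-1 * pw_near (- (al + be)) (2 * pi) t)|.
have M00 : 0 <= M0 := normr_ge0 _.
have main : \forall w \ae P, (qform (B n) (xi n w) (xi n w) - \tr (B n *m toeplitz n g)) / n%:R @[n --> \oo] --> (0 : R).
  apply: (quadratic_form_ae_cvg P xi (fun n => toeplitz n g) B (K1 * K2) (2 * M0 + 1) (al + be)) => //.
  - by rewrite mulr_gt0.
  - by rewrite ltr_wpDl // mulr_ge0.
  move=> n n1; split=> //.
  - by apply: psd_toeplitz.
  - exact: gxi.
  - rewrite (le_trans (trB n)) // (le_trans (cutM _ n)) //.
    have := ler_wpM2l (ler0n R n) (ler_norm ((2 * pi)^-1 * tint (fun t => C' * c^-1 * pw_near (- (al + be)) (2 * pi) t))).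
    rewrite -/M0; move: (M0) ((2 * pi)^-1 * tint _) => m q h.
    have -> : (2 * m + 1) * n%:R = 2 * (n%:R * m) + n%:R by ring.
    by rewrite -mulrA; have := ler0n R n; lra.
  - have n0 : 0 < n%:R :> R by rewrite ltr0n.
    exists (K1 * n%:R `^ al), (K2 * n%:R `^ be); split.
    + by rewrite mulr_gt0 // powR_gt0.
    + by rewrite mulr_gt0 // powR_gt0.
    + rewrite powRD; last by rewrite (gt_eqF n0) implybT.
      by rewrite le_eqVlt; apply/orP; left; apply/eqP; ring.
    + by move=> x; exact: hK1.
    + by move=> x; exact: hK2.
apply: filterS main => w /cvgr_dist_le hw e e0.
(* Five shares: fluctuation, boundary error [K], integral of the polynomial symbol, and two for the
   cut, whose mass is doubled in the trace bound. *)
have e50 : 0 < e / 5 by rewrite divr_gt0.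
have [N [p [dl [dl0 fp hp hd]]]] := inverse_upper_approx f g al al' be c C C' pf albe C'0 mg hg (e / 5) e50.
have [K [K0 hK]] := weighted_trace_cospoly N p 0 g ig.
have icut : tintegrable (fun t => c^-1 * pw_near (- al) dl t).
  by apply: tintegrableZ; apply: tintegrable_pw_near; rewrite ltrN2.
have icp := tintegrable_cospoly N p.
near=> n.
have n1 : (1 <= n)%N by near: n; exact: nbhs_infty_ge.
have n0 : 0 < n%:R :> R by rewrite ltr0n.
have Kn : K <= n%:R * (e / 5).
  by rewrite mulrC -ler_pdivrMl // mulrC; near: n; exact: nbhs_infty_ger.
have h1 : `|0 - (qform (B n) (xi n w) (xi n w) - \tr (B n *m toeplitz n g)) / n%:R| <= e / 5.
  by near: n; exact: hw.
have h2 : qform (invmx (toeplitz n f)) (xi n w) (xi n w) <= qform (B n) (xi n w) (xi n w).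
  have hu : toeplitz n f \in unitmx.
    by apply: (toeplitz_unit f (fun t => (f t)^-1)) => // t ht t0; split => //; exact: f0.
  have := dotv_toeplitz_le f (fun t => (f t)^-1) (xi n w) (invmx (toeplitz n f) *m xi n w) iff' ifv
    (fun t ht t0 => conj (f0 t ht t0) erefl).
  by rewrite dotv_invmx // qform_at_invmx // -/(B n); lra.
have h3 : \tr (B n *m toeplitz n g) <= \tr (toeplitz n (cospoly N p) *m toeplitz n g) +
    \tr (toeplitz n (fun t => c^-1 * pw_near (- al) dl t) *m toeplitz n g).
  have -> : \tr (toeplitz n (cospoly N p) *m toeplitz n g) +
    \tr (toeplitz n (fun t => c^-1 * pw_near (- al) dl t) *m toeplitz n g) =
    \tr (toeplitz n (fun t => cospoly N p t + c^-1 * pw_near (- al) dl t) *m toeplitz n g).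
    rewrite !tr_toeplitzM -big_split; apply: eq_bigr => i _; rewrite -big_split; apply: eq_bigr => j _ /=.
    rewrite -mulrDl; congr (_ * _); rewrite !fourier_coefE -mulrDr -tintD; last 2 first.
    - exact: tintegrable_cosM.
    - exact: tintegrable_cosM.
    by congr (_ * tint _); apply/funext => t; rewrite mulrDr.
  by apply: trle => //; exact: tintegrableD.
have h4 : \tr (toeplitz n (cospoly N p) *m toeplitz n g) <=
    n%:R * ((2 * pi)^-1 * tint (fun t => cospoly N p t * g t)) + K.
  have := hK n _ _ (window_weight1 0 n) (window_weight1 0 n).
  have -> : \sum_(i < n) \sum_(k < n) 1 * 1 * (fourier_coef (cospoly N p) (i%:Z - k%:Z) *
      fourier_coef g (i%:Z - k%:Z)) = \tr (toeplitz n (cospoly N p) *m toeplitz n g).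
    by rewrite tr_toeplitzM; apply: eq_bigr => i _; apply: eq_bigr => k _; rewrite !mul1r.
  rewrite ler_norml; lra.
have h5 := cutM dl n.
rewrite /Q -ler_pdivlMl ?invr_gt0 // invrK.
move: h1; rewrite sub0r normrN normrM normfV [`|n%:R|]gtr0_norm // ler_pdivrMr // ler_norml => /andP[_ h1].
have h6 := ler_wpM2l (ltW n0) hp; have h7 := ler_wpM2l (ltW n0) hd.
rewrite -/Finf in h6.
move: h2 h3 h4 h5 h6 h7 h1 Kn; rewrite -(mulrA 2) (mulrDr n%:R _ (e / 5)) (mulrDr n%:R Finf) (mulrC (e / 5) n%:R).
have -> : n%:R * e = 5 * (n%:R * (e / 5)) by field.
lra.
Unshelve. all: by end_near. Qed.

Theorem inverse_form_ae_cvg : \forall w \ae P, Q n w @[n --> \oo] --> Finf.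
Proof.
have h1 : \forall w \ae P, forall k : nat, \forall n \near \oo, Finf - k.+1%:R^-1 <= Q n w.
  by apply: ae_foralln => k; apply: inverse_form_liminf; rewrite invr_gt0 ltr0n.
apply: filterS2 h1 inverse_form_limsup => w h1 h2.
apply/cvgrPdist_le => e e0.
pose k := Num.truncn (e^-1).
have ke : k.+1%:R^-1 <= e.
  by rewrite -[leRHS]invrK lef_pV2 ?posrE ?invr_gt0 ?ltr0n // ltW // truncnS_gt.
near=> n; rewrite distrC ler_distl; apply/andP; split.
  apply: (@le_trans _ _ (Finf - k.+1%:R^-1)); first by rewrite lerD2l lerN2.
  by near: n; exact: h1.
by near: n; exact: h2.
Unshelve. all: by end_near. Qed.

End PointwiseLimit.

(** * The spectral density of fractional Gaussian noise *)

Section PowerDifferences.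
Context {R : realType}.
Implicit Types x y a b s e : R.

Lemma powR_gt0E x s : 0 < x -> x `^ s = expR (s * ln x).
Proof. by move=> x0; rewrite /powR gt_eqF. Qed.

Lemma powR_ge1Dln x s : 0 < x -> 1 + s * ln x <= x `^ s.
Proof. by move=> x0; rewrite powR_gt0E // expR_ge1Dx. Qed.

Lemma powR_expD x a b : 0 < x -> x `^ (a + b) = x `^ a * x `^ b.
Proof. by move=> x0; rewrite powRD //; apply/implyP => _; rewrite gt_eqF. Qed.

(** [1 - x^(- (b - a)) <= (b - a) ln x] and [ln x <= x^e / e]: the logarithm produced by varying the
    exponent is paid for with a power [e]. *)
Lemma powR_sub_exp_pos x a b e : 0 < x -> a <= b -> 0 < e ->
  x `^ (- a) - x `^ (- b) <= (b - a) / e * x `^ (- a + e).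
Proof.
move=> x0 ab e0.
have -> : - b = - a + - (b - a) by ring.
rewrite !powR_expD //.
have h1 := powR_ge1Dln x (- (b - a)) x0; have h2 := powR_ge1Dln x e x0.
have xa : 0 < x `^ (- a) by rewrite powR_gt0.
have -> : x `^ (- a) - x `^ (- a) * x `^ (- (b - a)) = x `^ (- a) * (1 - x `^ (- (b - a))) by ring.
rewrite mulrCA ler_pM2l //.
have h3 : ln x <= e^-1 * x `^ e by rewrite -ler_pdivrMl ?invr_gt0 // invrK; lra.
have ba : 0 <= b - a by rewrite subr_ge0.
have := ler_wpM2l ba h3; rewrite mulrA.
move: h1; rewrite mulNr; lra.
Qed.

Lemma powR_sub_exp_neg x a b e : 0 < x -> a <= b -> 0 < e ->
  x `^ a - x `^ b <= (b - a) / e * x `^ (a - e).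
Proof.
move=> x0 ab e0; have := powR_sub_exp_pos x^-1 a b e _ ab e0; rewrite invr_gt0 => /(_ x0).
have V (r : R) : x^-1 `^ r = x `^ (- r) by rewrite -powR_inv1 ?ltW // -powRrM mulN1r.
by rewrite !V !opprK opprD opprK.
Qed.

Lemma powR_sub_base x y s : 0 < x -> x <= y -> 0 <= s ->
  x `^ (- s) - y `^ (- s) <= s * x `^ (- s) * ((y - x) / x).
Proof.
move=> x0 xy s0; have y0 : 0 < y by apply: lt_le_trans xy.
have q0 : 0 < y / x by rewrite divr_gt0.
have -> : y `^ (- s) = x `^ (- s) * (y / x) `^ (- s).
  by rewrite -powRM ?ltW // mulrC divfK // gt_eqF.
have h1 := powR_ge1Dln (y / x) (- s) q0.
have h2 : ln (y / x) <= (y - x) / x.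
  have -> : y / x = 1 + (y - x) / x by field; rewrite gt_eqF.
  apply: le_ln1Dx; apply: (@lt_le_trans _ _ 0); first by rewrite ltrN10.
  by rewrite divr_ge0 ?subr_ge0 // ltW.
have := ler_wpM2l s0 h2; rewrite mulNr in h1 => h3.
have xs : 0 <= x `^ (- s) by exact: powR_ge0.
have h4 : 1 - (y / x) `^ (- s) <= s * ((y - x) / x) by lra.
have := ler_wpM2l xs h4; rewrite mulrBr mulr1 => h5.
by rewrite [leRHS](_ : _ = x `^ (- s) * (s * ((y - x) / x))) //; ring.
Qed.

Lemma sum_powRN_le e n : 0 < e -> \sum_(0 <= k < n) (k.+1%:R : R) `^ (- (1 + e)) <= 1 + e^-1.
Proof.
move=> e0; case: n => [|n]; first by rewrite big_geq // addr_ge0 // invr_ge0 ltW.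
rewrite big_nat_recl // powR1 lerD2l.
(* Telescoping version of the integral test: each term is at most [1 / e] times a decrement of
   [k^(- e)]. *)
suff : \sum_(0 <= i < n) (i.+2%:R : R) `^ (- (1 + e)) <= e^-1 * (1 - n.+1%:R `^ (- e)).
  by move/le_trans; apply; rewrite ler_piMr ?invr_ge0 ?(ltW e0).
elim: n => [|n IH]; first by rewrite big_geq // powR1 subrr mulr0.
rewrite big_nat_recr //= (le_trans (lerD IH (lexx _))) //.
have m0 : 0 < n.+2%:R :> R by [].
have k0 : 0 < n.+1%:R :> R by [].
rewrite -lerBrDl -mulrBr ler_pdivlMl //.
have -> : - (1 + e) = - e + - 1 by ring.
rewrite powR_expD // powR_inv1 ?(ltW m0) //.
have m1 : 1 < n.+2%:R :> R by rewrite ltr1n.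
have mk : n.+1%:R = n.+2%:R - 1 :> R by rewrite -[n.+2%:R]natr1 addrK.
move: (n.+2%:R : R) (n.+1%:R : R) m0 k0 m1 mk => m k m0 k0 m1 mk.
have -> : 1 - m `^ (- e) - (1 - k `^ (- e)) = k `^ (- e) - m `^ (- e) by ring.
have -> : k `^ (- e) = m `^ (- e) * (k / m) `^ (- e).
  by rewrite -powRM ?divr_ge0 ?(ltW m0) ?(ltW k0) // mulrC divfK // gt_eqF.
have q0 : 0 < k / m by rewrite divr_gt0.
have h1 := powR_ge1Dln (k / m) (- e) q0.
have h2 : ln (k / m) <= - m^-1.
  have -> : k / m = 1 + (- m^-1) by rewrite mk mulrBl divff ?gt_eqF // mul1r.
  by apply: le_ln1Dx; rewrite ltrN2 invf_lt1.
have := ler_wpM2l (ltW e0) h2 => h3.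
have xs : 0 <= m `^ (- e) by exact: powR_ge0.
have h4 : e * m^-1 <= (k / m) `^ (- e) - 1 by rewrite mulNr in h1; rewrite mulrN in h3; lra.
have := ler_wpM2l xs h4; rewrite mulrBr mulr1 => h5.
rewrite mulrCA; exact: h5.
Qed.

End PowerDifferences.

Lemma le_lim_series_comb {R : realType} (u v z : R ^nat) (c : R) :
  cvgn (series u) -> cvgn (series v) -> cvgn (series z) ->
  (forall k, u k <= v k + c * z k) ->
  limn (series u) <= limn (series v) + c * limn (series z).
Proof.
move=> cu cv cz h.
have cvz : series v n + c * series z n @[n --> \oo] --> limn (series v) + c * limn (series z).
  by apply: cvgD => //; apply: cvgM => //; exact: cvg_cst.
apply: (ler_cvg_to cu cvz); near=> n.
rewrite /series /= mulr_sumr -big_split; exact: ler_sum.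
Unshelve. all: by end_near. Qed.

(** * The periodization sum without its singular term *)

Section LatticeSum.
Context {R : realType}.
Implicit Types (s t a b e : R).

(** The nonzero translates, paired by sign. For [t] in [[- pi, pi]] their arguments have absolute
    value at least 1, so their sum is bounded and Lipschitz there, and the singular term is kept
    apart. *)
Definition lattice_term s t (k : nat) : R :=
  pw (- s) (t - 2 * pi * k.+1%:R) + pw (- s) (t + 2 * pi * k.+1%:R).

Definition lattice s t : R := limn (series (lattice_term s t)).

Lemma lattice_point_ge t k : - pi <= t <= pi ->
  k.+1%:R <= `|t - 2 * pi * k.+1%:R| /\ k.+1%:R <= `|t + 2 * pi * k.+1%:R|.
Proof.
move=> ht; have pi2 := pi_ge2 R; have k1 : 1 <= k.+1%:R :> R by rewrite ler1n.
have pk : pi <= pi * k.+1%:R :> R by rewrite ler_peMr // ltW // pi_gt0.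
have kk : k.+1%:R <= pi * k.+1%:R :> R by rewrite ler_peMl ?(le_trans ler01 k1) //; lra.
split; first by rewrite distrC (le_trans _ (ler_norm _)) //; lra.
by rewrite (le_trans _ (ler_norm _)) //; lra.
Qed.

Lemma lattice_point_ge1 t k : - pi <= t <= pi ->
  1 <= `|t - 2 * pi * k.+1%:R| /\ 1 <= `|t + 2 * pi * k.+1%:R|.
Proof.
move=> /(lattice_point_ge t k)[h1 h2]; have k1 : 1 <= k.+1%:R :> R by rewrite ler1n.
by split; [exact: le_trans h1|exact: le_trans h2].
Qed.

Lemma lattice_term_ge0 s t k : 0 <= lattice_term s t k.
Proof. by rewrite addr_ge0 // pw_ge0. Qed.

Lemma lattice_term_le s t k : 0 <= s -> - pi <= t <= pi -> lattice_term s t k <= 2 * k.+1%:R `^ (- s).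
Proof.
move=> s0 ht; have [h1 h2] := lattice_point_ge t k ht.
have k0 : 0 < k.+1%:R :> R by [].
have le1 x : k.+1%:R <= `|x| -> pw (- s) x <= k.+1%:R `^ (- s).
  move=> kx; rewrite /pw !powRN lef_pV2 ?posrE ?powR_gt0 //; last exact: lt_le_trans kx.
  by rewrite ge0_ler_powR // nnegrE ltW.
by rewrite mulr_natl mulr2n lerD // le1.
Qed.

Lemma series_lattice_le s t n : 1 < s -> - pi <= t <= pi ->
  series (lattice_term s t) n <= 2 * (1 + (s - 1)^-1).
Proof.
move=> s1 ht; rewrite /series /=.
apply: (@le_trans _ _ (\sum_(0 <= k < n) 2 * k.+1%:R `^ (- s))).
  by apply: ler_sum => k _; apply: lattice_term_le => //; lra.
rewrite -mulr_sumr ler_pM2l //.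
have s10 : 0 < s - 1 by lra.
by have := sum_powRN_le (s - 1) n s10; rewrite (_ : 1 + (s - 1) = s) //; ring.
Qed.

Lemma cvg_lattice s t : 1 < s -> - pi <= t <= pi -> cvgn (series (lattice_term s t)).
Proof.
move=> s1 ht; apply: nondecreasing_is_cvgn.
  by apply: nondecreasing_series => n _ _; exact: lattice_term_ge0.
by exists (2 * (1 + (s - 1)^-1)) => _ [n _ <-]; exact: series_lattice_le.
Qed.

Lemma lattice_ge0 s t : 1 < s -> - pi <= t <= pi -> 0 <= lattice s t.
Proof.
move=> s1 ht; apply: limr_ge; first exact: cvg_lattice.
by near=> n; rewrite /series /= sumr_ge0 // => k _; exact: lattice_term_ge0.
Unshelve. all: by end_near. Qed.

Lemma lattice_le s t : 1 < s -> - pi <= t <= pi -> lattice s t <= 2 * (1 + (s - 1)^-1).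
Proof.
move=> s1 ht; apply: limr_le; first exact: cvg_lattice.
by near=> n; exact: series_lattice_le.
Unshelve. all: by end_near. Qed.

Lemma lattice_anti a b t : 1 < a -> a <= b -> - pi <= t <= pi -> lattice b t <= lattice a t.
Proof.
move=> a1 ab ht; apply: lim_series_le => [||k].
- by apply: cvg_lattice => //; exact: lt_le_trans ab.
- exact: cvg_lattice.
have [h1 h2] := lattice_point_ge1 t k ht.
by rewrite lerD // /pw ler_powR // lerN2.
Qed.

Lemma lattice_exp_lipschitz a b e t : 0 < e -> 1 < a - e -> a <= b -> - pi <= t <= pi ->
  lattice a t <= lattice b t + (b - a) / e * lattice (a - e) t.
Proof.
move=> e0 ae ab ht; have a1 : 1 < a by lra.
have b1 : 1 < b by lra.
have c1 := cvg_lattice _ _ a1 ht; have c2 := cvg_lattice _ _ b1 ht; have c3 := cvg_lattice _ _ ae ht.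
apply: le_lim_series_comb => // k; have [h1 h2] := lattice_point_ge1 t k ht.
have D x : 1 <= `|x| -> pw (- a) x <= pw (- b) x + (b - a) / e * pw (- (a - e)) x.
  move=> x1; rewrite /pw -lerBlDl opprB [e - a]addrC; apply: powR_sub_exp_pos => //.
  exact: lt_le_trans ltr01 x1.
rewrite /lattice_term (mulrDr ((b - a) / e)) addrACA; apply: lerD; exact: D.
Qed.

Lemma lattice_lipschitz s t t' : 1 < s -> - pi <= t <= pi -> - pi <= t' <= pi ->
  lattice s t <= lattice s t' + `|t - t'| * s * (2 * (1 + (s - 1)^-1)).
Proof.
move=> s1 ht ht'; have c1 := cvg_lattice _ _ s1 ht; have c2 := cvg_lattice _ _ s1 ht'.
have s0 : 0 <= s by lra.
apply: (@le_trans _ _ (lattice s t' + `|t - t'| * s * lattice s t)); last first.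
  by rewrite lerD2l ler_wpM2l ?lattice_le // mulr_ge0.
apply: le_lim_series_comb => // k.
have [h1 h2] := lattice_point_ge1 t k ht; have [h1' h2'] := lattice_point_ge1 t' k ht'.
have D x y : 1 <= `|x| -> 1 <= `|y| -> pw (- s) x <= pw (- s) y + `|x - y| * s * pw (- s) x.
  move=> x1 y1; have x0 : 0 < `|x| by exact: lt_le_trans ltr01 x1.
  rewrite /pw -lerBlDl; have [xy|/ltW yx] := leP `|x| `|y|.
    apply: (le_trans (powR_sub_base _ _ _ x0 xy s0)).
    rewrite -[leRHS]mulrA [leLHS]mulrC; apply: ler_wpM2r; first by rewrite mulr_ge0 // powR_ge0.
    rewrite ler_pdivrMr //; apply: (@le_trans _ _ `|x - y|); last by rewrite ler_peMr.
    by rewrite distrC lerB_dist.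
  apply: (@le_trans _ _ 0); last by rewrite !mulr_ge0 // powR_ge0.
  rewrite subr_le0 !powRN lef_pV2 ?posrE ?powR_gt0 //; last exact: lt_le_trans y1.
  by rewrite ge0_ler_powR // nnegrE.
have e1 : `|t - t'| = `|t - 2 * pi * k.+1%:R - (t' - 2 * pi * k.+1%:R)| by congr `|_|; ring.
have e2 : `|t - t'| = `|t + 2 * pi * k.+1%:R - (t' + 2 * pi * k.+1%:R)| by congr `|_|; ring.
rewrite /lattice_term (mulrDr (`|t - t'| * s)) addrACA; apply: lerD; [rewrite e1|rewrite e2]; exact: D.
Qed.

Lemma latticeN s t : lattice s (- t) = lattice s t.
Proof.
rewrite /lattice; congr (limn (series _)); apply/funext => k; rewrite /lattice_term addrC.
congr (_ + _); first by rewrite -pwN; congr (pw _ _); ring.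
by rewrite -pwN; congr (pw _ _); ring.
Qed.

Lemma cvg_pw_lattice s t : 0 < s -> - pi <= t <= pi -> pw (- s) (t + 2 * pi * n.+1%:R) @[n --> \oo] --> (0 : R).
Proof.
move=> s0 ht; apply/cvgrPdist_le => e e0; near=> n.
have [_ h] := lattice_point_ge t n ht.
rewrite sub0r normrN ger0_norm ?pw_ge0 //.
rewrite /pw powRN -[leRHS]invrK lef_pV2 ?posrE ?invr_gt0 ?powR_gt0 //; last first.
  by apply: lt_le_trans h.
have -> : e^-1 = (e^-1 `^ s^-1) `^ s by rewrite -powRrM mulVf ?gt_eqF // powRr1 // invr_ge0 ltW.
rewrite ge0_ler_powR ?nnegrE ?powR_ge0 ?(ltW s0) //.
apply: le_trans h; apply: (@le_trans _ _ n%:R); last by rewrite ler_nat.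
by near: n; exact: nbhs_infty_ger.
Unshelve. all: by end_near. Qed.

(* Regrouping the terms [k] and [- k] of the two-sided series, whose pairing in [fgn_series] is shifted by one. *)
Lemma fgn_seriesE H t : 0 < H -> - pi <= t <= pi ->
  fgn_series H t = pw (- (2 * H + 1)) t + lattice (2 * H + 1) t.
Proof.
move=> H0 ht; set s := 2 * H + 1; have s1 : 1 < s by rewrite /s; lra.
have s0 : 0 < s by lra.
apply: cvg_lim => //; rewrite -cvg_shiftS /=.
have -> : (fun n => series (fun k : nat => `|t - 2 * pi * k%:R| `^ (- s) + `|t + 2 * pi * k.+1%:R| `^ (- s)) n.+1) =
  (fun n => pw (- s) t + series (lattice_term s t) n + pw (- s) (t + 2 * pi * n.+1%:R)).
  apply/funext => n; rewrite /series /=; elim: n => [|n IH].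
    by rewrite big_nat1 big_geq // addr0 mulr0 subr0.
  by rewrite big_nat_recr //= IH big_nat_recr //= /lattice_term /pw; ring.
rewrite -(addr0 (pw (- s) t + lattice s t)); apply: cvgD; last exact: cvg_pw_lattice.
by apply: cvgD; [exact: cvg_cst|exact: cvg_lattice].
Qed.

End LatticeSum.

(** * Bounds on the density and its dependence on the parameter *)

Section FgnDensity.
Context {R : realType}.
Implicit Types (u v p q t r e : R).
Local Notation h := fgn_unnormalized.

Definition fgn_sum u t : R := pw (- (2 * u + 1)) t + lattice (2 * u + 1) t.

Lemma fgn_unnormalizedE u t : 0 < u -> - pi <= t <= pi -> h u t = (2 - 2 * cos t) * fgn_sum u t.
Proof. by move=> u0 ht; rewrite /fgn_unnormalized fgn_seriesE. Qed.

Lemma torus_norm_le t : - pi <= t <= pi -> `|t| <= pi.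
Proof. by rewrite ler_norml. Qed.

Lemma pw_le_pi r r' t : - pi <= t <= pi -> t != 0 -> r' <= r -> pw r t <= pi `^ (r - r') * pw r' t.
Proof.
move=> ht t0 rr; rewrite -{1}(subrK r' r) pwD // ler_wpM2r ?pw_ge0 // /pw.
by rewrite ge0_ler_powR ?subr_ge0 ?nnegrE ?pi_ge0 // torus_norm_le.
Qed.

Lemma pi_powR_le r r' : r <= r' -> pi `^ r <= pi `^ r' :> R.
Proof. by move=> rr; rewrite ler_powR //; have := pi_ge2 R; lra. Qed.

Lemma pw2 t : pw 2 t = t ^+ 2.
Proof. by rewrite /pw powR_mulrn // real_normK ?num_real. Qed.

Lemma two_sub_cos_ge t : - pi <= t <= pi -> t ^+ 2 / 4 <= 2 - 2 * cos t.
Proof. by move=> /one_sub_cos_ge; lra. Qed.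

Lemma two_sub_cos_le t : 2 - 2 * cos t <= t ^+ 2.
Proof. by have := one_sub_cos_le t; lra. Qed.

Lemma two_sub_cos_gt0 t : - pi <= t <= pi -> t != 0 -> 0 < 2 - 2 * cos t.
Proof.
move=> ht t0; apply: lt_le_trans (two_sub_cos_ge t ht).
by rewrite divr_gt0 // exprn_even_gt0.
Qed.

Lemma fgn_sum_ge u t : 0 < u -> - pi <= t <= pi -> pw (- (2 * u + 1)) t <= fgn_sum u t.
Proof. by move=> u0 ht; rewrite lerDl lattice_ge0 //; lra. Qed.

Lemma fgn_sum_gt0 u t : 0 < u -> - pi <= t <= pi -> t != 0 -> 0 < fgn_sum u t.
Proof. by move=> u0 ht t0; apply: lt_le_trans (fgn_sum_ge u t u0 ht); exact: pw_gt0. Qed.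

Lemma fgn_ge u t : 0 < u -> - pi <= t <= pi -> t != 0 -> 4^-1 * pw (1 - 2 * u) t <= h u t.
Proof.
move=> u0 ht t0; rewrite fgn_unnormalizedE //.
have -> : 1 - 2 * u = 2 + - (2 * u + 1) by ring.
rewrite pwD // pw2 mulrA [4^-1 * _]mulrC ler_pM ?pw_ge0 ?divr_ge0 ?sqr_ge0 //.
  exact: two_sub_cos_ge.
exact: fgn_sum_ge.
Qed.

Lemma fgn_gt0 u t : 0 < u -> - pi <= t <= pi -> t != 0 -> 0 < h u t.
Proof.
move=> u0 ht t0; apply: lt_le_trans (fgn_ge u t u0 ht t0).
by rewrite mulr_gt0 ?invr_gt0 // pw_gt0.
Qed.

Lemma fgn_le u : 0 < u -> exists2 C, 0 <= C &
  forall t, - pi <= t <= pi -> t != 0 -> h u t <= C * pw (1 - 2 * u) t.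
Proof.
move=> u0; set s := 2 * u + 1; pose M := 2 * (1 + (s - 1)^-1).
have s1 : 1 < s by rewrite /s; lra.
have M0 : 0 <= M.
  by rewrite mulr_ge0 // addr_ge0 // invr_ge0; lra.
exists (1 + M * pi `^ s); first by rewrite addr_ge0 // mulr_ge0 // powR_ge0.
move=> t ht t0; rewrite fgn_unnormalizedE //.
have -> : 1 - 2 * u = 2 + - s by rewrite /s; ring.
rewrite pwD // pw2 mulrCA ler_pM //.
- by rewrite ltW // fgn_sum_gt0.
- exact: two_sub_cos_le.
rewrite /fgn_sum -/s mulrDl mul1r lerD2l (le_trans (lattice_le s t s1 ht)) // -/M -mulrA.
rewrite ler_peMr // -(powRr0 `|t|) -/(pw 0 t).
have := pw_le_pi 0 (- s) t ht t0; rewrite opprK add0r; apply; lra.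
Qed.

Lemma measurable_fgn u : 0 < u -> measurable_fun torus (h u).
Proof.
move=> u0; set s := 2 * u + 1; have s1 : 1 < s by rewrite /s; lra.
have mp : measurable_fun torus (pw (- s) : R -> R) by apply: measurable_funTS; exact: measurable_pw.
have mpa (a : R) : measurable_fun torus (fun t => pw (- s) (t + a)).
  apply: measurable_funTS; apply: measurableT_comp; first exact: measurable_pw.
  by apply: measurable_funD => //; exact: measurable_id.
apply: (eq_measurable_fun (fun t => (2 - 2 * cos t) * fgn_sum u t)).
  by move=> t; rewrite inE => /torus_closed ht; rewrite fgn_unnormalizedE.
apply: measurable_funM.
  by apply: measurable_torus_cont => t; apply: cvgB; [exact: cvg_cst|apply: cvgM; [exact: cvg_cst|exact: continuous_cos]].
apply: measurable_funD => //.
apply: (@measurable_fun_cvg _ _ _ _ (fun n => fun t => series (lattice_term s t) n)).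
  move=> n; rewrite /series /=.
  apply: measurable_sum => k; apply: measurable_funD; exact: mpa.
by move=> t /torus_closed ht; exact: cvg_lattice.
Qed.

Lemma fgn_cvg u t : 0 < u -> 0 < t <= pi -> h u x @[x --> within `[0, pi]%classic (nbhs t)] --> h u t.
Proof.
move=> u0 /andP[t0 tpi]; set s := 2 * u + 1; have s1 : 1 < s by rewrite /s; lra.
have cl x : `[0, pi]%classic x -> - pi <= x <= pi by rewrite /= in_itv /=; have := pi_ge0 R; lra.
have ht : - pi <= t <= pi by apply: cl; rewrite /= in_itv /= tpi ltW.
rewrite fgn_unnormalizedE //.
apply: (@cvg_trans _ ((2 - 2 * cos x) * fgn_sum u x @[x --> within `[0, pi]%classic (nbhs t)])).
  by apply: near_eq_cvg; near=> x; rewrite fgn_unnormalizedE //; apply: cl; near: x; exact: withinT.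
apply: cvgM.
  apply: cvg_within_filter; apply: cvgB; first exact: cvg_cst.
  by apply: cvgM; [exact: cvg_cst|exact: continuous_cos].
apply: cvgD.
  apply: cvg_within_filter.
  have E x : 0 < x -> pw (- s) x = expR (- s * ln x) by move=> x0; rewrite /pw gtr0_norm // powR_gt0E.
  rewrite -/s E //; apply: (@cvg_trans _ (expR (- s * ln x) @[x --> t])).
    apply: near_eq_cvg; near=> x; rewrite E //; near: x; exact: lt_nbhsr.
  suff H : - s * ln x @[x --> t] --> - s * ln t.
    exact: (@continuous_cvg R R R (nbhs t) _ (fun x => - s * ln x) expR _ (@continuous_expR R _) H).
  by apply: cvgM; [exact: cvg_cst|exact: continuous_ln].
pose M := s * (2 * (1 + (s - 1)^-1)).
have M0 : 0 < M by rewrite !mulr_gt0 ?addr_gt0 ?invr_gt0 //; lra.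
have cvx : x @[x --> within `[0, pi]%classic (nbhs t)] --> t.
  by apply: cvg_within_filter; exact: cvg_id.
apply/cvgrPdist_le => e e0.
have nx : \forall x \near within `[0, pi]%classic (nbhs t), `|t - x| <= e / M.
  by move/cvgrPdist_le: cvx; apply; exact: divr_gt0.
near=> x.
have hx : - pi <= x <= pi by apply: cl; near: x; exact: withinT.
have xt : `|t - x| <= e / M.
  by near: x.
have l1 := lattice_lipschitz s t x s1 ht hx; have l2 := lattice_lipschitz s x t s1 hx ht.
have : `|t - x| * M <= e by rewrite -ler_pdivlMr.
rewrite distrC in l2; move: l1 l2; rewrite -!mulrA -/M ler_norml.
by clear; move: (lattice s t) (lattice s x) (`|t - x| * M) => a b m; lra.
Unshelve. all: by end_near. Qed.

(** The density is of order [|t|^(1 - 2 u)]; the maxima make both exponents nonnegative, at the cost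
    of powers of [pi] in the constants. *)
Lemma powlike_fgn u : 0 < u < 1 ->
  exists c C, powlike_symbol (h u) (Num.max (1 - 2 * u) 0) (Num.max (2 * u - 1) 0) c C.
Proof.
move=> /andP[u0 u1]; have [C C0 hC] := fgn_le u u0.
set al := Num.max _ _; set al' := Num.max _ _.
have al1 : 1 - 2 * u <= al by rewrite le_max lexx.
have al'1 : - al' <= 1 - 2 * u by rewrite lerNl opprB le_max lexx.
set k := pi `^ (al - (1 - 2 * u)) : R; set k' := pi `^ (1 - 2 * u + al') : R.
have k0 : 0 < k by rewrite powR_gt0 // pi_gt0.
exists (4^-1 / k), (C * k'); split.
- exact: measurable_fgn.
- move=> t ht; have ht' : - pi <= - t <= pi by lra.
  by rewrite (fgn_unnormalizedE _ _ u0 ht) (fgn_unnormalizedE _ _ u0 ht') /fgn_sum cosN pwN latticeN.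
- by rewrite /fgn_unnormalized cos0 mulr1 subrr mul0r.
- by move=> t; exact: fgn_cvg.
- by rewrite divr_gt0 ?invr_gt0 // mulr_ge0 // powR_ge0.
- by rewrite /al /al'; split; rewrite le_max lexx orbT gt_max ltr01 andbT; lra.
- move=> t ht t0; apply/andP; split.
    apply: le_trans (fgn_ge u t u0 ht t0); rewrite -mulrA ler_pM2l ?invr_gt0 // ler_pdivrMl //.
    exact: pw_le_pi.
  apply: (le_trans (hC t ht t0)); rewrite -mulrA ler_wpM2l //.
  by have := pw_le_pi (1 - 2 * u) (- al') t ht t0 al'1; rewrite opprK.
Qed.

Lemma tintegrable_fgn u : 0 < u < 1 -> tintegrable (h u).
Proof. by move=> /powlike_fgn[c [C hp]]; exact: tintegrable_powlike _ _ _ _ _ hp. Qed.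

Lemma tintegrable_fgn_inv u : 0 < u < 1 -> tintegrable (fun t => (h u t)^-1).
Proof. by move=> /powlike_fgn[c [C hp]]; exact: tintegrable_powlike_inv _ _ _ _ _ hp. Qed.

(** The singular terms differ by a multiple of [|t|^(- a + 1)] and the lattice sums by a bounded
    one, both at most a constant times [(v - u) |t|^(- b)], and [|t|^(- b)] is itself part of the
    sum defining the density at [v]. *)
Lemma fgn_compare p : 0 < p -> exists2 L, 0 <= L & forall u v t, p <= u -> u <= v -> v < 1 ->
  - pi <= t <= pi -> t != 0 -> h u t <= (1 + L * (v - u)) * h v t.
Proof.
(* [2 v + 1 < 3] gives [pi^3 |t|^(- (2 v + 1)) >= 1]; [M] bounds the lattice sums of exponent at
   least [1 + p]. *)
move=> p0; pose M := 2 * (1 + p^-1); pose K := pi `^ 3 : R.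
have M0 : 0 <= M by rewrite mulr_ge0 // addr_ge0 // invr_ge0 ltW.
have K0 : 0 < K by rewrite powR_gt0 // pi_gt0.
have L0 : 0 <= 2 * (K + p^-1 * (M * K)).
  apply: mulr_ge0 => //; apply: addr_ge0; first exact: ltW.
  by apply: mulr_ge0; [rewrite invr_ge0 ltW|apply: mulr_ge0 => //; exact: ltW].
exists (2 * (K + p^-1 * (M * K))) => //.
move=> u v t pu uv v1 ht t0; have u0 : 0 < u by exact: lt_le_trans pu.
have v0 : 0 < v by exact: lt_le_trans uv.
rewrite !fgn_unnormalizedE // mulrCA ler_pM2l ?two_sub_cos_gt0 //.
set a := 2 * u + 1; set b := 2 * v + 1.
have ab : a <= b by rewrite /a /b; lra.
have ba : 0 <= b - a by rewrite subr_ge0.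
have pb : 1 <= K * pw (- b) t.
  rewrite -(powRr0 `|t|) -/(pw 0 t) (le_trans (pw_le_pi 0 (- b) t ht t0 _)) //.
    by rewrite /b; lra.
  by rewrite ler_wpM2r ?pw_ge0 // pi_powR_le // /b; lra.
have h1 : pw (- a) t - pw (- b) t <= (b - a) * (K * pw (- b) t).
  have := powR_sub_exp_pos `|t| a b 1 _ ab ltr01; rewrite normr_gt0 => /(_ t0)/le_trans; apply.
  rewrite divr1 ler_wpM2l // -/(pw _ t) (le_trans (pw_le_pi _ (- b) t ht t0 _)) //.
    by rewrite /a /b; lra.
  by rewrite ler_wpM2r ?pw_ge0 // pi_powR_le // /a /b; lra.
(* Giving up [p] of the exponent leaves [a - p >= 1 + p], still summable. *)
have ap : 1 < a - p by rewrite /a; lra.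
have h2 := lattice_exp_lipschitz a b p t p0 ap ab ht.
have h3 : lattice (a - p) t <= M * (K * pw (- b) t).
  apply: (le_trans (lattice_le _ t ap ht)); rewrite -/M.
  apply: (@le_trans _ _ M); last by rewrite ler_peMr.
  rewrite ler_pM2l // lerD2l lef_pV2 ?posrE // /a; lra.
have h4 : (b - a) / p * lattice (a - p) t <= (b - a) / p * (M * (K * pw (- b) t)).
  by rewrite ler_wpM2l // divr_ge0 // ltW.
have h5 : (v - u) * (2 * (K + p^-1 * (M * K))) * pw (- b) t <= (v - u) * (2 * (K + p^-1 * (M * K))) * fgn_sum v t.
  by rewrite ler_wpM2l ?fgn_sum_ge // mulr_ge0 // subr_ge0.
have E : (v - u) * (2 * (K + p^-1 * (M * K))) * pw (- b) t =
  (b - a) * (K * pw (- b) t) + (b - a) / p * (M * (K * pw (- b) t)) by rewrite /a /b; ring.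
have E2 : (1 + 2 * (K + p^-1 * (M * K)) * (v - u)) * fgn_sum v t =
  fgn_sum v t + (v - u) * (2 * (K + p^-1 * (M * K))) * fgn_sum v t by ring.
rewrite E2; rewrite E in h5; apply: le_trans (lerD (lexx _) h5).
by rewrite /fgn_sum -/a -/b; clear -h1 h2 h4; lra.
Qed.

(** The lattice sums have the favourable sign here. Only the singular terms remain: [|t|^(- b - e)]
    divided by the product of the density at [p], at least [|t|^(1 - 2 p) / 4], and of [|t|^(- b)].
    The loss [e] stands for a logarithm. *)
Lemma fgn_inv_compare p0 e p q t : 0 < e -> 0 < p0 -> p0 <= p -> p <= q -> q < 1 ->
  - pi <= t <= pi -> t != 0 ->
  (h p t)^-1 - (h q t)^-1 <= 8 / e * pi `^ 2 * (q - p) * pw (2 * p0 - 1 - e) t.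
Proof.
move=> e0 p00 pp pq q1 ht t0; have p1 : 0 < p by exact: lt_le_trans pp.
have q0 : 0 < q by exact: lt_le_trans pq.
set a := 2 * p + 1; set b := 2 * q + 1.
have ab : a <= b by rewrite /a /b; lra.
have hp0 := fgn_gt0 p t p1 ht t0; have hq0 := fgn_gt0 q t q0 ht t0.
have Sq0 := fgn_sum_gt0 q t q0 ht t0.
have c0 := two_sub_cos_gt0 t ht t0.
have h1 : fgn_sum q t - fgn_sum p t <= (b - a) / e * (pw (- b) t * pw (- e) t).
  have := powR_sub_exp_neg `|t| (- b) (- a) e; rewrite normr_gt0 lerN2 => /(_ t0 ab e0).
  rewrite -/(pw (- b) t) -/(pw (- a) t) -/(pw (- b - e) t) pwD // opprK [- a + _]addrC.
  have a1 : 1 < a by rewrite /a; lra.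
  have := lattice_anti a b t a1 ab ht.
  by rewrite /fgn_sum -/a -/b; lra.
have E : (h p t)^-1 - (h q t)^-1 = (fgn_sum q t - fgn_sum p t) / (h p t * fgn_sum q t).
  have Sp0 := fgn_sum_gt0 p t p1 ht t0.
  rewrite !fgn_unnormalizedE //; clear h1; move: c0 Sq0 Sp0.
  move: (fgn_sum q t) (fgn_sum p t) (2 - 2 * cos t) => x y z z0 x0 y0.
  by field; rewrite !gt_eqF.
rewrite E ler_pdivrMr; last exact: mulr_gt0.
apply: (le_trans h1).
have h2 := fgn_ge p t p1 ht t0; have h3 := fgn_sum_ge q t q0 ht.
have ba : 0 <= (b - a) / e by rewrite divr_ge0 ?subr_ge0 // ltW.
have h4 : pw (- e) t <= 4 * (pi `^ 2 * pw (2 * p0 - 1 - e) t) * h p t.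
  have -> : pw (- e) t = 4 * pw (2 * p - 1 - e) t * (4^-1 * pw (1 - 2 * p) t).
    rewrite (_ : pw (- e) t = pw ((2 * p - 1 - e) + (1 - 2 * p)) t); last by congr (pw _ _); ring.
    by rewrite pwD //; field.
  rewrite ler_pM ?mulr_ge0 ?pw_ge0 ?invr_ge0 // ler_pM2l //.
  have le1 : 2 * p0 - 1 - e <= 2 * p - 1 - e by clear -pp; lra.
  apply: le_trans (pw_le_pi _ (2 * p0 - 1 - e) t ht t0 le1) _.
  apply: (ler_wpM2r (pw_ge0 _ _)); apply: pi_powR_le; clear -p00 pq q1; lra.
have h5 : pw (- b) t * pw (- e) t <= fgn_sum q t * (4 * (pi `^ 2 * pw (2 * p0 - 1 - e) t) * h p t).
  by rewrite ler_pM ?pw_ge0.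
apply: (le_trans (ler_wpM2l ba h5)); rewrite le_eqVlt; apply/orP; left; apply/eqP.
by rewrite /a /b; ring.
Qed.

(** The density is at least a positive multiple of [2 - 2 cos t], whose mean is explicit. *)
Lemma fgn_mass_gt0 u : 0 < u < 1 -> 0 < fourier_coef (h u) 0.
Proof.
move=> u01; have /andP[u0 u1] := u01.
rewrite fourier_coefE mulr_gt0 ?inv2pi_gt0 //.
have -> : (fun t => cos (0%:~R * t) * h u t) = h u by apply/funext => t; rewrite mul0r cos0 mul1r.
set k := pi `^ (- (2 * u + 1)) : R; have k0 : 0 < k by rewrite powR_gt0 // pi_gt0.
have ic : tintegrable (fun t : R => cos (1%:~R * t)).
  have := tintegrable_cosM (fun=> 1 : R) 1 (tintegrable_cst 1).
  by rewrite (_ : (fun t => _) = (fun t : R => cos (1%:~R * t))) //; apply/funext => t; rewrite mulr1.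
have i1 : tintegrable (fun t : R => k * (2 - 2 * cos (1%:~R * t))).
  by apply: tintegrableZ; apply: tintegrableB; [exact: tintegrable_cst|exact: tintegrableZ].
apply: (@lt_le_trans _ _ (tint (fun t : R => k * (2 - 2 * cos (1%:~R * t))))).
  rewrite tintZ; last by apply: tintegrableB; [exact: tintegrable_cst|exact: tintegrableZ].
  rewrite tintB ?tint_cst ?tintZ //; [|exact: tintegrable_cst|exact: tintegrableZ].
  by rewrite tint_cos mulr0 subr0 !mulr_gt0 // pi_gt0.
apply: le_tint => //; first exact: tintegrable_fgn.
move=> t /torus_closed ht t0; rewrite mul1r fgn_unnormalizedE // mulrC ler_pM2l ?two_sub_cos_gt0 //.
apply: le_trans (fgn_sum_ge u t u0 ht); rewrite /k /pw !powRN lef_pV2 ?posrE ?powR_gt0 ?normr_gt0 ?pi_gt0 //.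
by rewrite ge0_ler_powR ?nnegrE ?pi_ge0 ?torus_norm_le //; lra.
Qed.

End FgnDensity.

(** * Uniformity in the parameter *)

Section LocalUniformity.
Context {R : realType}.

(** [xp], [xq], [xu] stand for the values at [p], [q], [u] for a fixed [n], and [ip], [iq], [iu] for
    the limits; [l] is the loss in quasi-monotonicity and [eta] the accuracy reached at [p] and
    [q]. *)
Lemma squeeze_between (xp xq xu ip iq iu l k B eta : R) :
  0 <= l <= 1 -> 0 <= eta <= 1 -> 0 <= xu -> ip <= B -> iu <= B ->
  xp <= ip + eta -> iq - eta <= xq -> xu <= (1 + l) * xp -> xq <= (1 + l) * xu ->
  iq <= (1 + l) * iu -> iu <= (1 + l) * ip -> ip - iq <= k ->
  k + 2 * (l * B) + 3 * l <= eta -> 0 <= k -> 0 <= B -> `|iu - xu| <= 3 * eta.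
Proof.
move=> /andP[l0 l1] /andP[e0 e1] xu0 ipB iuB hp hq; rewrite !mulrDl !mul1r => m1 m2 m3 m4 m5 m6 k0 B0.
have n1 : l * xp <= l * B + l * eta by rewrite -mulrDr ler_wpM2l //; lra.
have n2 := ler_wpM2l l0 iuB; have n3 := ler_wpM2l l0 ipB.
have n4 : l * eta <= eta by rewrite ler_piMl.
have n5 : 0 <= l * B by rewrite mulr_ge0.
have up : xu <= iu + 3 * eta by lra.
have n6 : l * xu <= l * B + 3 * l by rewrite (_ : l * B + 3 * l = l * (B + 3)); [rewrite ler_wpM2l //; lra|ring].
rewrite ler_norml; lra.
Qed.

(* Quasi-monotonicity in the parameter squeezes the values on [[p, q]] between those at [p] and [q]. *)
Lemma local_uniform_cvg (X : nat -> R -> R) (Xi A : R -> R) (p0 q0 u0 L K M e : R) :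
  p0 < u0 < q0 -> 0 <= L -> 0 <= K -> 0 < M -> 0 < e ->
  (forall n u, p0 <= u <= q0 -> 0 <= X n u) -> (forall u, p0 <= u <= q0 -> 0 <= Xi u) ->
  (forall n u v, p0 <= u -> u <= v -> v <= q0 -> X n v <= (1 + L * (v - u)) * X n u) ->
  (forall u v, p0 <= u -> u <= v -> v <= q0 -> Xi v <= (1 + L * (v - u)) * Xi u) ->
  (forall u v, p0 <= u -> u <= v -> v <= q0 -> Xi u - Xi v <= K * (v - u)) ->
  (forall u, p0 <= u <= q0 -> 0 <= A u <= M) ->
  (forall a b, p0 <= a -> a < b -> b <= q0 -> exists2 s, a < s < b & X n s @[n --> \oo] --> Xi s) ->
  \forall u \near u0 & n \near \oo, `|A u * Xi u - A u * X n u| <= e.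
Proof.
move=> /andP[pu uq] L0 K0 M0 e0 X0 Xi0 Xm Xim XiK AM dense.
set B := (1 + L * (q0 - p0)) * Xi p0.
have p00 : 0 <= Xi p0 by apply: Xi0; rewrite lexx /= ltW // (lt_trans pu).
have hB u : p0 <= u <= q0 -> Xi u <= B.
  move=> /andP[h1 h2]; apply: (le_trans (Xim p0 u (lexx _) h1 h2)).
  by rewrite ler_wpM2r // lerD2l ler_wpM2l // lerD2r.
have B0 : 0 <= B by apply: le_trans p00 (hB p0 _); rewrite lexx /= ltW // (lt_trans pu).
set eta := Num.min 1 (e / (3 * M)).
have eta0 : 0 < eta by rewrite lt_min ltr01 divr_gt0 // mulr_gt0.
have eta1 : eta <= 1 by rewrite ge_min lexx.
have etae : M * (3 * eta) <= e.
  have : eta <= e / (3 * M) by rewrite ge_min lexx orbT.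
  by rewrite ler_pdivlMr ?mulr_gt0 // => h; rewrite (_ : M * (3 * eta) = eta * (3 * M)) //; ring.
(* [D] collects the coefficients of [dl] in the smallness condition of [squeeze_between]; its
   summand [L] ensures [L dl <= eta <= 1]. *)
set D := K + L * (2 * B + 3) + L + 1.
have LB : 0 <= L * (2 * B + 3) by rewrite mulr_ge0 // addr_ge0 // mulr_ge0.
have D0 : 0 < D by rewrite /D; lra.
set dl := eta / D.
have dl0 : 0 < dl by rewrite divr_gt0.
have dlD : dl * D = eta by rewrite /dl divfK // gt_eqF.
have [p /andP[p1 p2] cp] : exists2 s, Num.max p0 (u0 - dl / 2) < s < u0 & X n s @[n --> \oo] --> Xi s.
  apply: dense; rewrite ?le_max ?lexx // ?gt_max ?pu /=; last exact: ltW.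
  by rewrite ltrBlDr ltrDl divr_gt0.
have [q /andP[q1 q2] cq] : exists2 s, u0 < s < Num.min q0 (u0 + dl / 2) & X n s @[n --> \oo] --> Xi s.
  apply: dense; rewrite ?ge_min ?lexx // ?lt_min ?uq /=; first exact: ltW.
  by rewrite ltrDl divr_gt0.
move: p1 q2; rewrite gt_max lt_min => /andP[pp0 pdl] /andP[qq0 qdl].
exists ([set u | p < u < q], [set n | X n p <= Xi p + eta /\ Xi q - eta <= X n q]).
  split=> /=.
    have : u0 \in `]p, q[ by rewrite in_itv /= p2 q1.
    move=> /near_in_itvoo; apply: filterS => u; by rewrite in_itv.
  move/cvgrPdist_le: cp => /(_ _ eta0); move/cvgrPdist_le: cq => /(_ _ eta0).
  apply: filterS2 => n; rewrite !ler_distl => /andP[_ h1] /andP[h2 _].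
  split; lra.
move=> [u n] /= [/andP[pu' uq'] [hp hq]].
have [pu0 uq0] : p0 <= u /\ u <= q0 by split; [exact: ltW (lt_trans pp0 pu')|exact: ltW (lt_trans uq' qq0)].
have hu : p0 <= u <= q0 by rewrite pu0.
have [pq0 qp0] : p <= q0 /\ p0 <= q by split; [exact: le_trans (ltW pu') uq0|exact: le_trans pu0 (ltW uq')].
have hp' : p0 <= p <= q0 by rewrite (ltW pp0).
have qpdl : q - p <= dl by clear -pdl qdl; lra.
have /andP[A0 AM'] := AM u hu.
have step a b y : 0 <= y -> p <= a -> b <= q -> (1 + L * (b - a)) * y <= (1 + L * dl) * y.
  move=> y0 pa bq; rewrite ler_wpM2r // lerD2l ler_wpM2l // (le_trans _ qpdl) // lerB //.
rewrite -mulrBr normrM ger0_norm // (le_trans _ etae) // ler_pM //.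
apply: (@squeeze_between (X n p) (X n q) (X n u) (Xi p) (Xi q) (Xi u) (L * dl) (K * dl) B) => //.
- rewrite mulr_ge0 ?(ltW dl0) //= mulrC (le_trans _ eta1) // -dlD ler_pM2l //.
  by rewrite /D; clear -K0 LB L0; lra.
- by rewrite (ltW eta0).
- exact: X0.
- exact: hB.
- exact: hB.
- apply: le_trans (Xm n p u (ltW pp0) (ltW pu') uq0) _; apply: step => //; [exact: X0|exact: ltW].
- apply: le_trans (Xm n u q pu0 (ltW uq') (ltW qq0)) _; apply: step => //; [exact: X0|exact: ltW].
- apply: le_trans (Xim u q pu0 (ltW uq') (ltW qq0)) _; apply: step => //; [exact: Xi0|exact: ltW].
- apply: le_trans (Xim p u (ltW pp0) (ltW pu') uq0) _; apply: step => //; [exact: Xi0|exact: ltW].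
- apply: le_trans (XiK p q (ltW pp0) (ltW (lt_trans pu' uq')) (ltW qq0)) _.
  by rewrite ler_wpM2l.
- have -> : K * dl + 2 * (L * dl * B) + 3 * (L * dl) = dl * (K + L * (2 * B + 3)) by ring.
  by rewrite -dlD ler_pM2l // /D; clear -L0; lra.
- by rewrite mulr_ge0 // ltW.
Qed.

End LocalUniformity.

(** * The inverse forms of fractional Gaussian noise *)

Section InverseFormOfFgn.
Context {R : realType} {d : measure_display} {Omega : measurableType d} (P : probability Omega R).
Variables (Hh : R) (xi : forall n, Omega -> 'cV[R]_n).
Hypothesis Hh01 : 0 < Hh < 1.
Hypothesis gxi : forall n, (1 <= n)%N -> centered_gaussian_vector P (xi n) (toeplitz n (f_fgn Hh)).
Implicit Types (u v p q t e : R) (w : Omega).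

Local Notation h := fgn_unnormalized.
Let G := f_fgn Hh.
Let mass u := fourier_coef (h u) 0.

(** Taken for the unnormalized density: as [f_fgn u] is [h u] divided by [mass u], normalization
    only multiplies this form and its limit by [mass u]. *)
Definition inverse_form n u w := n%:R^-1 * qform (invmx (toeplitz n (h u))) (xi n w) (xi n w).
Definition inverse_mass u := (2 * pi)^-1 * tint (fun t => G t / h u t).

Let Hh0 : 0 < Hh. Proof. by case/andP: Hh01. Qed.

Lemma toeplitzZ n (c : R) (g : R -> R) : tintegrable g -> toeplitz n (fun t => c * g t) = c *: toeplitz n g.
Proof.
move=> ig; apply/matrixP => i j; rewrite !mxE !fourier_coefE [RHS]mulrCA -(tintZ c); last exact: tintegrable_cosM.
by congr (_ * tint _); apply/funext => t; rewrite mulrCA.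
Qed.

Lemma fgn_toeplitz_unit n u : 0 < u < 1 -> toeplitz n (h u) \in unitmx.
Proof.
move=> u01; have /andP[u0 _] := u01.
apply: (toeplitz_unit _ (fun t => (h u t)^-1)); [exact: tintegrable_fgn|exact: tintegrable_fgn_inv|].
by move=> t /torus_closed ht t0; split => //; exact: fgn_gt0.
Qed.

Lemma rho_nE n u w : 0 < u < 1 -> rho_n (xi n w) u = mass u * inverse_form n u w.
Proof.
move=> u01; have m0 : 0 < mass u := fgn_mass_gt0 u u01.
rewrite /rho_n /inverse_form (toeplitzZ n (C_fgn u) (h u)); last exact: tintegrable_fgn.
rewrite invmxZ; last first.
  by rewrite unitmxZ ?fgn_toeplitz_unit // unitfE invr_eq0 gt_eqF.
rewrite -[((xi n w)^T *m _ *m _) _ _]/(qform _ (xi n w) (xi n w)) qform_scaleM.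
by rewrite /C_fgn invrK -/(mass u) mulrCA.
Qed.

Lemma fgn_weight_bounds : measurable_fun torus G /\ exists2 C, 0 <= C &
  forall t, - pi <= t <= pi -> t != 0 -> 0 <= G t <= C * pw (1 - 2 * Hh) t.
Proof.
have m0 : 0 < C_fgn Hh by rewrite invr_gt0; exact: fgn_mass_gt0.
split; first by apply: measurable_funM => //; exact: measurable_fgn.
have [C C0 hC] := fgn_le Hh Hh0.
exists (C_fgn Hh * C); first by rewrite mulr_ge0 // ltW.
move=> t ht t0; rewrite mulr_ge0 ?(ltW m0) ?(ltW (fgn_gt0 Hh t Hh0 ht t0)) //=.
by rewrite -mulrA ler_pM2l // hC.
Qed.

Definition admissible u := Hh - 2^-1 < u < 1 /\ 0 < u.

(** The exponents [max(1 - 2 u, 0)] of the inverse symbol and [max(2 Hh - 1, 0)] of the covariance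
    add up to less than 1 because [u > Hh - 1/2]; the abstract limit theorem then applies. *)
Lemma inverse_form_cvg u : admissible u ->
  tintegrable (fun t => G t / h u t) /\
  \forall w \ae P, inverse_form n u w @[n --> \oo] --> inverse_mass u.
Proof.
move=> [/andP[hu u1] u0].
have [c [C pf]] := powlike_fgn u (introT andP (conj u0 u1)).
have [mG [C1 C10 hG]] := fgn_weight_bounds.
have /andP[_ Hh1] := Hh01.
set be := Num.max (2 * Hh - 1) 0.
have be0 : 0 <= be by rewrite le_max lexx orbT.
have albe : Num.max (1 - 2 * u) 0 + be < 1.
  by rewrite /be !maxEge; do 2 case: ifP => _; lra.
have hG' t : torus t -> t != 0 -> 0 <= G t <= C1 * pi `^ (1 - 2 * Hh + be) * pw (- be) t.
  move=> /torus_closed ht t0; have /andP[-> h2] := hG t ht t0.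
  apply: (le_trans h2); rewrite -mulrA ler_wpM2l //.
  have b1 : - be <= 1 - 2 * Hh by rewrite lerNl opprB le_max lexx.
  by have := pw_le_pi (1 - 2 * Hh) (- be) t ht t0 b1; rewrite opprK.
have C20 : 0 <= C1 * pi `^ (1 - 2 * Hh + be) by rewrite mulr_ge0 // powR_ge0.
split; first exact: (tintegrable_ratio (h u) G _ _ be c C _ pf albe mG hG').
exact: (inverse_form_ae_cvg P (h u) G _ _ be c C _ xi pf be0 albe C20 mG hG' gxi).
Qed.

Lemma F_limE u : admissible u -> F_lim u Hh = mass u * inverse_mass u.
Proof.
move=> au; have [[/andP[_ u1] u0]] := au; have u01 : 0 < u < 1 by rewrite u0 u1.
have m0 : 0 < mass u := fgn_mass_gt0 u u01.
have E : (fun t => f_fgn Hh t / f_fgn u t) = (fun t => mass u * (G t / h u t)).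
  by apply/funext => t; rewrite {2}/f_fgn /C_fgn invfM invrK -/(mass u) mulrCA.
rewrite /F_lim -/(tint _) E /inverse_mass tintZ 1?mulrCA //.
exact: (inverse_form_cvg u au).1.
Qed.

Section Comparison.
Variable p0 : R.
Hypothesis p00 : 0 < p0.
Hypothesis p0H : Hh - 2^-1 < p0.

Let range_adm u : p0 <= u -> u < 1 -> admissible u.
Proof. by have := p00; have := p0H; move=> *; split; lra. Qed.

Lemma inverse_mass_ge0 u : p0 <= u -> u < 1 -> 0 <= inverse_mass u.
Proof.
move=> pu u1; have [_ [C C0 hC]] := fgn_weight_bounds.
rewrite mulr_ge0 ?(ltW inv2pi_gt0) // -(mul0r (2 * pi)) -tint_cst.
apply: le_tint; first exact: tintegrable_cst.
  exact: (inverse_form_cvg u (range_adm u pu u1)).1.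
move=> t /torus_closed ht t0; have /andP[G0 _] := hC t ht t0.
by rewrite divr_ge0 // ltW // fgn_gt0 // (lt_le_trans p00).
Qed.

Lemma inverse_form_ge0 n u w : p0 <= u -> u < 1 -> 0 <= inverse_form n u w.
Proof.
move=> pu u1; have u01 : 0 < u < 1 by rewrite u1 (lt_le_trans p00).
rewrite mulr_ge0 // -qform_at_invmx; last exact: fgn_toeplitz_unit.
have [_] : psd (toeplitz n (h u)); last exact.
apply: psd_toeplitz; first exact: tintegrable_fgn.
by move=> t /torus_closed ht t0; rewrite ltW // fgn_gt0 //; case/andP: u01.
Qed.

Lemma fgn_monotone_bounds : exists L, [/\ 0 <= L,
  forall n u v w, p0 <= u -> u <= v -> v < 1 -> inverse_form n v w <= (1 + L * (v - u)) * inverse_form n u w,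
  forall u v, p0 <= u -> u <= v -> v < 1 -> inverse_mass v <= (1 + L * (v - u)) * inverse_mass u &
  forall u v, p0 <= u -> u <= v -> v < 1 -> mass u <= (1 + L * (v - u)) * mass v].
Proof.
have [L L0 hL] := fgn_compare p0 p00; exists L.
have u01 u : p0 <= u -> u < 1 -> 0 < u < 1 by move=> h1 ->; rewrite (lt_le_trans p00).
have c0 u v : u <= v -> 0 < 1 + L * (v - u) by move=> uv; rewrite ltr_wpDr // mulr_ge0 // subr_ge0.
split => // [n u v w pu uv v1|u v pu uv v1|u v pu uv v1].
- have u1 : u < 1 := le_lt_trans uv v1; have pv := le_trans pu uv.
  rewrite /inverse_form mulrCA ler_wpM2l //; apply: invmx_qform_anti.
  + apply: psd_toeplitz; first exact/tintegrable_fgn/u01.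
    by move=> t /torus_closed ht t0; rewrite ltW // fgn_gt0 //; case/andP: (u01 u pu u1).
  + exact/fgn_toeplitz_unit/u01.
  + exact/fgn_toeplitz_unit/u01.
  + exact: c0.
  + move=> y; rewrite -qform_scaleM -toeplitzZ; last exact/tintegrable_fgn/u01.
    apply: le_qform_toeplitz; first exact/tintegrable_fgn/u01.
      exact/tintegrableZ/tintegrable_fgn/u01.
    by move=> t /torus_closed ht t0; exact: hL.
- have u1 : u < 1 := le_lt_trans uv v1; have pv := le_trans pu uv.
  have iu := (inverse_form_cvg u (range_adm u pu u1)).1.
  have iv := (inverse_form_cvg v (range_adm v pv v1)).1.
  rewrite /inverse_mass mulrCA ler_wpM2l ?(ltW inv2pi_gt0) // -tintZ //.
  apply: le_tint => //; first exact: tintegrableZ.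
  move=> t /torus_closed ht t0; have [_ [C C0 hC]] := fgn_weight_bounds.
  have /andP[G0 _] := hC t ht t0; rewrite mulrCA ler_wpM2l //.
  have /andP[uu _] := u01 u pu u1; have /andP[vv _] := u01 v pv v1.
  have hu0 := fgn_gt0 u t uu ht t0; have hv0 := fgn_gt0 v t vv ht t0.
  by rewrite ler_pdivlMr // mulrC ler_pdivrMr //; exact: hL.
- have u1 : u < 1 := le_lt_trans uv v1; have pv := le_trans pu uv.
  have E z : mass z = (2 * pi)^-1 * tint (h z).
    by rewrite /mass fourier_coefE; congr (_ * tint _); apply/funext => t; rewrite mul0r cos0 mul1r.
  have iu := tintegrable_fgn u (u01 u pu u1); have iv := tintegrable_fgn v (u01 v pv v1).
  rewrite !E mulrCA ler_wpM2l ?(ltW inv2pi_gt0) // -tintZ //.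
  apply: le_tint => //; first exact: tintegrableZ.
  by move=> t /torus_closed ht t0; exact: hL.
Qed.

Lemma inverse_mass_lipschitz : exists2 K, 0 <= K & forall u v, p0 <= u -> u <= v -> v < 1 ->
  inverse_mass u - inverse_mass v <= K * (v - u).
Proof.
have [mG [C C0 hC]] := fgn_weight_bounds.
(* Half of the available room: the exponent [s] below becomes [p0 - Hh - 1/2], which exceeds -1. *)
pose e := (2 * p0 - 2 * Hh + 1) / 2; have e0 : 0 < e by rewrite divr_gt0 //; have := p0H; lra.
pose k := 8 / e * pi `^ 2 : R.
have k0 : 0 <= k by rewrite mulr_ge0 ?powR_ge0 // divr_ge0 // ltW.
pose s := 2 * p0 - 1 - e + (1 - 2 * Hh).
have s1 : -1 < s by rewrite /s /e; have := p0H; lra.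
have ip : tintegrable (pw s) := tintegrable_pw _ s1.
have I0 : 0 <= (2 * pi)^-1 * tint (pw s).
  by rewrite mulr_ge0 ?(ltW inv2pi_gt0) // tint_ge0 // => t _; exact: pw_ge0.
exists (k * C * ((2 * pi)^-1 * tint (pw s))); first by apply: mulr_ge0 I0; exact: mulr_ge0.
move=> u v pu uv v1; have u1 : u < 1 := le_lt_trans uv v1; have pv := le_trans pu uv.
have iu := (inverse_form_cvg u (range_adm u pu u1)).1.
have iv := (inverse_form_cvg v (range_adm v pv v1)).1.
rewrite /inverse_mass -mulrBr -tintB //.
have -> : k * C * ((2 * pi)^-1 * tint (pw s)) * (v - u) = (2 * pi)^-1 * (k * (v - u) * C * tint (pw s)) by ring.
rewrite ler_wpM2l ?(ltW inv2pi_gt0) // -tintZ //.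
apply: le_tint; [exact: tintegrableB|exact: tintegrableZ|].
move=> t /torus_closed ht t0; have /andP[G0 GC] := hC t ht t0.
have h1 := fgn_inv_compare p0 e u v t e0 p00 pu uv v1 ht t0.
rewrite -mulrBr /s pwD //.
have -> : k * (v - u) * C * (pw (2 * p0 - 1 - e) t * pw (1 - 2 * Hh) t) =
  (C * pw (1 - 2 * Hh) t) * (k * (v - u) * pw (2 * p0 - 1 - e) t) by ring.
apply: (le_trans (ler_wpM2l G0 h1)); rewrite -/k ler_wpM2r //.
by apply: mulr_ge0 (pw_ge0 _ _); apply: mulr_ge0 => //; rewrite subr_ge0.
Qed.

End Comparison.

(** A countable union of null sets, with the rationals enumerated through [pickle]. *)
Lemma inverse_form_cvg_rat : \forall w \ae P, forall r : rat, admissible (ratr r) ->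
  inverse_form n (ratr r) w @[n --> \oo] --> inverse_mass (ratr r).
Proof.
have : \forall w \ae P, forall k, if unpickle k is Some r then admissible (ratr r) ->
    inverse_form n (ratr r) w @[n --> \oo] --> inverse_mass (ratr r) else True.
  apply: ae_foralln => k; case: (unpickle k) => [r|]; last exact: aeW.
  have [ar|nar] := pselect (admissible (ratr r)); last by apply: aeW.
  by apply: filterS (inverse_form_cvg _ ar).2.
by apply: filterS => w hw r ar; have := hw (pickle r); rewrite pickleK; apply.
Qed.

(** Phrased with a product of filters, the local form that compactness upgrades to uniformity.
    Convergence at rationals is a hypothesis on one fixed [w], so no further null set appears. *)
Lemma rho_n_near w u0 e : admissible u0 -> 0 < e ->
  (forall r : rat, admissible (ratr r) -> inverse_form n (ratr r) w @[n --> \oo] --> inverse_mass (ratr r)) ->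
  \forall u \near u0 & n \near \oo, admissible u -> `|F_lim u Hh - rho_n (xi n w) u| <= e.
Proof.
move=> [/andP[hu u1] u00] e0 cvr.
(* [p0] and [q0] lie halfway between [u0] and the two ends of the admissible interval, so all
   constants are uniform on [[p0, q0]]. *)
pose p0 := (Num.max 0 (Hh - 2^-1) + u0) / 2; pose q0 := (u0 + 1) / 2.
have p00 : 0 < p0 by rewrite /p0 maxEge; case: ifP; lra.
have p0H : Hh - 2^-1 < p0 by rewrite /p0 maxEge; case: ifP; lra.
have p0u : p0 < u0 by rewrite /p0 maxEge; case: ifP; lra.
have uq0 : u0 < q0 by rewrite /q0; lra.
have q01 : q0 < 1 by rewrite /q0; lra.
have [L [L0 L1 L2 L3]] := fgn_monotone_bounds p0 p00 p0H.
have [K K0 hK] := inverse_mass_lipschitz p0 p00 p0H.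
have q001 : 0 < q0 < 1 by rewrite q01 andbT; lra.
have mq : 0 < mass q0 := fgn_mass_gt0 q0 q001.
(* Quasi-monotonicity of [mass] bounds it on [[p0, q0]] through its value at [q0]. *)
pose M := (1 + L * (q0 - p0)) * mass q0.
have M0 : 0 < M by rewrite mulr_gt0 // ltr_wpDr // mulr_ge0 //; lra.
have near_u : \forall u \near u0 & n \near \oo,
    `|mass u * inverse_mass u - mass u * inverse_form n u w| <= e.
  apply: (local_uniform_cvg (fun n u => inverse_form n u w) inverse_mass mass p0 q0 u0 L K M e) => //.
  - by rewrite p0u uq0.
  - by move=> n u /andP[h1 h2]; apply: (inverse_form_ge0 p0 p00 n u w h1); lra.
  - by move=> u /andP[h1 h2]; apply: (inverse_mass_ge0 p0 p00 p0H u h1); lra.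
  - by move=> n u v h1 h2 h3; apply: L1 => //; lra.
  - by move=> u v h1 h2 h3; apply: L2 => //; lra.
  - by move=> u v h1 h2 h3; apply: hK => //; lra.
  - move=> u /andP[h1 h2]; have u01 : 0 < u < 1 by apply/andP; split; lra.
    rewrite (ltW (fgn_mass_gt0 u u01)) /= (le_trans (L3 u q0 h1 h2 q01)) //.
    by rewrite ler_wpM2r ?(ltW mq) // lerD2l ler_wpM2l //; lra.
  - move=> a b h1 ab h2; have [r] := rat_in_itvoo ab; rewrite in_itv /= => hr.
    by exists (ratr r) => //; apply: cvr; split; [apply/andP; split|]; move: hr => /andP[]; lra.
have [[U V] /= [hU hV] hUV] := near_u.
exists (U, V) => //= -[u n] /= [Uu Vn] au.
have u01 : 0 < u < 1 by case: au => /andP[_ ->] ->.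
by rewrite F_limE // rho_nE //; apply: (hUV (u, n)).
Qed.

End InverseFormOfFgn.

Theorem theorem3 (R : realType) (d : measure_display) (Omega : measurableType d)
  (P : probability Omega R) (Hh : R) (xi : forall n : nat, Omega -> 'cV[R]_n) :
  0 < Hh < 1 ->
  (forall n : nat, (1 <= n)%N ->
     centered_gaussian_vector P (xi n) (toeplitz n (f_fgn Hh))) ->
  let I := [set u : R | Hh - 2^-1 < u < 1 /\ 0 < u] in
  exists A : set Omega, measurable A /\ P A = 1%E /\
    forall w, A w ->
      forall K : set R, compact K -> K `<=` I ->
        {uniform K, (fun n : nat => rho_n (xi n w)) @ \oo --> (fun u => F_lim u Hh)}.
Proof.
move=> Hh01 gxi I.
have [N [mN N0 hN]] := inverse_form_cvg_rat P Hh xi Hh01 gxi.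
exists (~` N); split; first exact: measurableC.
split; first by rewrite probability_setC // N0 sube0.
move=> w Nw K cK KI.
have hw : forall r : rat, admissible Hh (ratr r) ->
    inverse_form xi n (ratr r) w @[n --> \oo] --> inverse_mass Hh (ratr r).
  by apply: contrapT => hw; apply: Nw; exact: hN.
move=> U /uniform_nbhs[E [entE EU]].
have [e /= e0 hE] : exists2 e : R, 0 < e & forall x y, `|x - y| <= e -> E (x, y).
  move: entE; rewrite -entourage_ballE => -[e /= e0 eE]; exists (e / 2); first exact: divr_gt0.
  move=> x y xy; apply: eE; rewrite /= -ball_normE /=.
  by apply: le_lt_trans xy _; rewrite ltr_pdivrMr // ltr_pMr // ltr1n.
(* Each point of [K] has a neighbourhood on which the estimate holds for all large [n]; compactness
   makes the threshold common to [K]. *)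
have := (compact_near_coveringP _).1 cK nat \oo (fun n u => admissible Hh u -> `|F_lim u Hh - rho_n (xi n w) u| <= e) _.
move=> /(_ _)[] //; first by move=> u Ku; exact: (rho_n_near P Hh xi Hh01 gxi w u e (KI u Ku) e0 hw).
move=> m _ hm; exists m => // n mn; apply: EU => u Ku; apply: hE; apply: hm => //; exact: KI.
Qed.
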